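(* Let $\lambda$ be a partition of $d$. The singular locus of the coincident root locus $X_\lambda$ equals $\bigcup_{\mu\in\mathcal{S}_\lambda}X_\mu$, where $\mathcal{S}_\lambda=\mathcal{S}_\lambda^{(a)}\cup\mathcal{S}_\lambda^{(b)}\cup\mathcal{S}_\lambda^{(c)}$ is the set of partitions of $d$ defined in the context.
   Context: Base field $\mathbb{C}$. $V$ is a two-dimensional vector space with basis $x,y$; $\mathrm{Sym}^kV$ is identified with binary forms of degree $k$, and $\mathbb{P}\,\mathrm{Sym}^kV\cong\mathbb{P}^k$ is the space of nonzero such forms up to scalar. For a partition $\lambda=(1^{e_1}2^{e_2}\cdots d^{e_d})$ of $d$ (with $e_r$ parts of size $r$), $Y_\lambda=\prod_{r=1}^d\mathbb{P}\,\mathrm{Sym}^{e_r}V$ and $f_\lambda:Y_\lambda\to\mathbb{P}^d=\mathbb{P}\,\mathrm{Sym}^dV$, $(G_1,\dots,G_d)\mapsto\prod_rG_r^{\,r}$. $X_\lambda\subseteq\mathbb{P}^d$ is the scheme-theoretic image of $f_\lambda$ (a reduced closed subvariety). Definition of $\mathcal{S}_\lambda$: a partition $\mu=(1^{f_1}2^{f_2}\cdots d^{f_d})$ of $d$ (all $f_r\ge0$) belongs to $\mathcal{S}_\lambda$ in one of the following cases (all indices and $t,t_1,t_2$ are positive integers). (a) [$\mu\in\mathcal{S}_\lambda^{(a)}$] There exist distinct $r_1,r_2$ such that $f_{r_1}=e_{r_1}-1$, $f_{r_2}=e_{r_2}-1$, $f_{r_1+r_2}=e_{r_1+r_2}+1$,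 and $f_r=e_r$ for all other $r$. (b) [$\mu\in\mathcal{S}_\lambda^{(b)}$] There exist $r_1,r_2,t$ with $r_1\ne r_2$, $e_{r_1}>0$ such that $f_{r_1}=e_{r_1}+1$, $f_{r_2}=e_{r_2}-t$, and $f_r=e_r$ for all other $r$ (this forces $r_1=t\,r_2$). (c) [$\mu\in\mathcal{S}_\lambda^{(c)}$] There exist $r_1,r_2,r_3,t_1,t_2$ with $r_1,r_2,r_3$ pairwise distinct and $r_3=t_1r_1=t_2r_2$ such that $f_{r_1}=e_{r_1}-t_1$, $f_{r_2}=e_{r_2}-t_2$, $f_{r_3}=e_{r_3}+2$, and $f_r=e_r$ for all other $r$. *)

(* Defs.v *)
From HB Require Import structures.
From mathcomp Require Export all_boot all_order all_algebra.
From mathcomp Require Export complex mpoly boolp classical_sets reals.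

Set Implicit Arguments.
Unset Strict Implicit.
Unset Printing Implicit Defensive.

Import Order.TTheory GRing.Theory Num.Theory.
Local Open Scope ring_scope.
Local Open Scope classical_set_scope.

(* Points of the projective space P^n over K are represented by their vectors
   of homogeneous coordinates, i.e. by the nonzero v : 'rV[K]_n.+1.  A subset
   of P^n is a set of such vectors; every set built below from homogeneous
   equations consists of nonzero vectors and is stable under rescaling by
   nonzero scalars. *)

Section ProjectiveGeometry.
Variables (K : fieldType) (n : nat).
Implicit Types (X Y Z : set 'rV[K]_n.+1) (p v : 'rV[K]_n.+1).
Implicit Types (P : {mpoly K[n.+1]}) (S : set {mpoly K[n.+1]}).

Definition homogeneous P : Prop := exists k : nat, P \is k.-homog.

Definition zero_locus S : set 'rV[K]_n.+1 :=
  [set v : 'rV[K]_n.+1 | v != 0 /\ forall P, S P -> P.@[v 0] = 0].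

(* The homogeneous elements of the radical homogeneous ideal I(X). *)
Definition hom_ideal X : set {mpoly K[n.+1]} :=
  [set P | homogeneous P /\ forall v, v != 0 -> X v -> P.@[v 0] = 0].

Definition zariski_closed X : Prop :=
  exists S, (forall P, S P -> homogeneous P) /\ X = zero_locus S.

Definition zariski_closure X : set 'rV[K]_n.+1 := zero_locus (hom_ideal X).

Definition irreducible_closed Z : Prop :=
  [/\ zariski_closed Z, Z !=set0 &
      forall A B, zariski_closed A -> zariski_closed B ->
        Z `<=` A `|` B -> Z `<=` A \/ Z `<=` B].

(* A strictly increasing chain C_0 < ... < C_k of irreducible closed subsets
   of X, all containing p: under localization, a chain of k + 1 primes of the
   local ring O_{X,p}. *)
Definition irreducible_chain X p (k : nat) (C : nat -> set 'rV[K]_n.+1) :=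
  [/\ forall i, (i <= k)%N -> irreducible_closed (C i),
      forall i, (i < k)%N -> C i `<` C i.+1,
      C 0%N p & C k `<=` X].

(* k is the Krull dimension of O_{X,p}, i.e. the dimension of X at p. *)
Definition local_dim X p (k : nat) : Prop :=
  (exists C, irreducible_chain X p k C) /\
  (forall l C, irreducible_chain X p l C -> (l <= k)%N).

(* The common kernel of the differentials at p of the elements of I(X).  The
   Zariski tangent space of X (with its reduced structure) at the point [p]
   is, up to a twist by the line K p, the quotient of this space by K p. *)
Definition tangent_cone_space X p : set 'rV[K]_n.+1 :=
  [set v | forall P, hom_ideal X P ->
     \sum_(i < n.+1) (mderiv i P).@[p 0] * v 0 i = 0].

Definition tangent_dim X p (k : nat) : Prop :=
  exists U : {vspace 'rV[K]_n.+1},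
    [set v | v \in U] = tangent_cone_space X p /\ \dim U = k.+1.

Definition regular_point X p : Prop :=
  exists k : nat, local_dim X p k /\ tangent_dim X p k.

Definition singular_locus X : set 'rV[K]_n.+1 :=
  [set p | X p /\ ~ regular_point X p].

End ProjectiveGeometry.

Definition is_partition (d : nat) (lam : seq nat) : bool :=
  [&& sorted geq lam, 0%N \notin lam & sumn lam == d].

(* The exponents e_r in lam = (1^{e_1} 2^{e_2} ...). *)
Definition mult (lam : seq nat) (r : nat) : nat := count_mem r lam.

Section CoincidentRootLoci.
Variable K : fieldType.

(* The identification of P^d with P Sym^d V: homogeneous coordinates on the
   former are coefficients of binary forms of degree d in x = 'X_0, y = 'X_1. *)
Definition binary_form (d : nat) (v : 'rV[K]_d.+1) : {mpoly K[2]} :=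
  \sum_(i < d.+1) v 0 i *: ('X_0 ^+ (d - i) * 'X_1 ^+ i).

(* Representatives (G_1, ..., G_d) of the points of Y_lam. *)
Definition Y_point (d : nat) (lam : seq nat) (G : nat -> {mpoly K[2]}) :=
  forall r, (0 < r <= d)%N -> G r \is (mult lam r).-homog /\ G r != 0.

Definition f_image (d : nat) (lam : seq nat) : set 'rV[K]_d.+1 :=
  [set v | exists (G : nat -> {mpoly K[2]}) (c : K),
     [/\ Y_point d lam G, c != 0 &
         binary_form v = c *: \prod_(1 <= r < d.+1) G r ^+ r]].

(* As Y_lam is reduced, the ideal of the scheme-theoretic image of f_lam is
   generated by the forms vanishing on the image of its points. *)
Definition X_locus (d : nat) (lam : seq nat) : set 'rV[K]_d.+1 :=
  zariski_closure (@f_image d lam).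

End CoincidentRootLoci.

Arguments X_locus K d lam : clear implicits.

(* The relations f_r = e_r - t are written e_r = f_r + t, so that no truncated
   subtraction is involved. *)

Definition S_a (d : nat) (lam : seq nat) : set (seq nat) :=
  [set mu | is_partition d mu /\
    exists r1 r2 : nat, [/\ (0 < r1)%N, (0 < r2)%N & r1 <> r2] /\
    [/\ mult lam r1 = (mult mu r1 + 1)%N,
        mult lam r2 = (mult mu r2 + 1)%N,
        mult mu (r1 + r2) = (mult lam (r1 + r2) + 1)%N &
        forall r, r \notin [:: r1; r2; (r1 + r2)%N] -> mult mu r = mult lam r]].

Definition S_b (d : nat) (lam : seq nat) : set (seq nat) :=
  [set mu | is_partition d mu /\
    exists r1 r2 t : nat, [/\ (0 < r1)%N, (0 < r2)%N, (0 < t)%N & r1 <> r2] /\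
    [/\ (0 < mult lam r1)%N,
        mult mu r1 = (mult lam r1 + 1)%N,
        mult lam r2 = (mult mu r2 + t)%N &
        forall r, r \notin [:: r1; r2] -> mult mu r = mult lam r]].

Definition S_c (d : nat) (lam : seq nat) : set (seq nat) :=
  [set mu | is_partition d mu /\
    exists r1 r2 r3 t1 t2 : nat,
    [/\ (0 < r1)%N, (0 < r2)%N, (0 < r3)%N, (0 < t1)%N & (0 < t2)%N] /\
    [/\ uniq [:: r1; r2; r3], r3 = (t1 * r1)%N & r3 = (t2 * r2)%N] /\
    [/\ mult lam r1 = (mult mu r1 + t1)%N,
        mult lam r2 = (mult mu r2 + t2)%N,
        mult mu r3 = (mult lam r3 + 2)%N &
        forall r, r \notin [:: r1; r2; r3] -> mult mu r = mult lam r]].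

Definition S_set (d : nat) (lam : seq nat) : set (seq nat) :=
  S_a d lam `|` S_b d lam `|` S_c d lam.

(* Main.v *)
From HB Require Import structures.
Require Import Defs.
From mathcomp Require Import ring zify.

(* Dehomogenized, the points of X_lam are the products c prod_i L_i^(lam_i) of
   linear forms.  The map to P^d is finite, so this set is closed, irreducible
   and of dimension l = size lam.  At prod_r G_r^r the differential of the
   parametrization has as image the multiples of D = prod_r G_r^(r-1) in degree d,
   of (affine) dimension l + 1, and this space is always tangent to X_lam; the
   point is therefore regular exactly when nothing else is tangent.
   - If no mu in S_lam occurs, the G_r are pairwise coprime (case (a)) and the
     preimage is unique (cases (b), (c)): the parametrization is finite, injective
     and unramified over the point, hence a closed immersion there, and all
     tangent vectors are multiples of D.
   - On a general point of X_mu an extra tangent vector comes from the cubic term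
     of the arc (x + r2 s)^r1 (x - r1 s)^r2 in case (a), and from a second
     preimage in cases (b), (c); tangent dimension is upper semicontinuous. *)

Set Implicit Arguments.
Unset Strict Implicit.
Unset Printing Implicit Defensive.
Import Order.TTheory GRing.Theory Num.Theory.
Local Open Scope ring_scope.
Local Open Scope classical_set_scope.

(** * Ideals, Taylor expansion and polynomial functions *)

(** Three obstacles shape the proof. Roots at infinity: the affine finite maps live on the chart
    where the top coefficient is nonzero, so a point is first moved by a substitution that sends one
    of its non-roots to infinity. Ramification: the map from individual roots to coefficients is
    finite, which suffices for closedness and for counting forms, but it ramifies where one [G_r]
    has a repeated root. Regularity therefore uses the coefficients of the [G_r] as coordinates.
    Dimension: [local_dim] speaks of chains of irreducible sets. The upper bound l comes from
    counting forms that are independent on the locus, the lower bound from releasing the roots of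
    the point one at a time. Since no chain is longer than l, a point of [X_mu] is singular as soon
    as its tangent dimension exceeds l. In the other direction, being outside all strata is turned
    into a statement about lists of pairs (part, root), and closed immersion near the point becomes
    a Nakayama argument carried out with determinants. *)

Lemma mpoly_ring_ind (R : comNzRingType) n (P : {mpoly R[n]} -> Prop) :
  (forall c, P c%:MP) -> (forall i, P 'X_i) ->
  (forall p q, P p -> P q -> P (p + q)) ->
  (forall p q, P p -> P q -> P (p * q)) -> forall p, P p.
Proof.
move=> PC PX PD PM p; rewrite [p]mpolyE.
apply: (big_ind P); [by rewrite -mpolyC0 | exact: PD |].
move=> m _; rewrite -mul_mpolyC; apply: (PM) => //.
rewrite mpolyXE_id; apply: (big_ind P); [by rewrite -mpolyC1 | exact: PM |].
move=> i _; elim: (m i) => [|k IH]; first by rewrite expr0 -mpolyC1.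
by rewrite exprS; apply: (PM).
Qed.

Section Ideals.
Variable S : comNzRingType.

Definition is_ideal (I : S -> Prop) : Prop :=
  [/\ I 0, forall x y, I x -> I y -> I (x + y) & forall a x, I x -> I (a * x)].

Lemma ideal_sum (I : S -> Prop) (J : Type) (r : seq J) (P : pred J) F :
  is_ideal I -> (forall j, P j -> I (F j)) -> I (\sum_(j <- r | P j) F j).
Proof. by case=> I0 ID _ IF; apply: big_ind. Qed.

Lemma idealB (I : S -> Prop) x y : is_ideal I -> I x -> I y -> I (x - y).
Proof. by case=> _ ID IM Ix Iy; apply: ID => //; rewrite -mulN1r; apply: IM. Qed.

Definition gen_ideal (J : finType) (g : J -> S) (x : S) : Prop :=
  exists c : J -> S, x = \sum_j c j * g j.

Lemma gen_ideal_is_ideal (J : finType) (g : J -> S) : is_ideal (gen_ideal g).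
Proof.
split=> [|_ _ [c ->] [c' ->]|a _ [c ->]].
- by exists (fun=> 0); rewrite big1 // => j _; rewrite mul0r.
- exists (fun j => c j + c' j); rewrite -big_split /=.
  by apply: eq_bigr => j _; rewrite mulrDl.
- by exists (fun j => a * c j); rewrite mulr_sumr; apply: eq_bigr => j _; rewrite mulrA.
Qed.

Lemma gen_ideal_mem (J : finType) (g : J -> S) j : gen_ideal g (g j).
Proof.
exists (fun k => (k == j)%:R); rewrite (bigD1 j) //= eqxx mul1r big1 ?addr0 //.
by move=> k /negbTE ->; rewrite mul0r.
Qed.

Definition adjoin_ideal (I : S -> Prop) (a x : S) : Prop :=
  exists b, I (x - b * a).

Lemma adjoin_ideal_is_ideal I a : is_ideal I -> is_ideal (adjoin_ideal I a).
Proof.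
move=> [I0 ID IM]; split=> [|x y [b Ib] [c Ic]|e x [b Ib]].
- by exists 0; rewrite mul0r subr0.
- exists (b + c); suff ->: x + y - (b + c) * a = (x - b * a) + (y - c * a) by apply: ID.
  by ring.
- by exists (e * b); rewrite -mulrA -mulrBr; apply: IM.
Qed.

Lemma sub_adjoin_ideal I a x : is_ideal I -> I x -> adjoin_ideal I a x.
Proof. by move=> _ Ix; exists 0; rewrite mul0r subr0. Qed.

Lemma adjoin_ideal_mem I a : is_ideal I -> adjoin_ideal I a a.
Proof. by case=> I0 _ _; exists 1; rewrite mul1r subrr. Qed.

(** If every factor were a unit modulo [I], so would be the product, which is zero there. This takes
    the place of choosing a maximal ideal: a proper ideal that contains a split product can be
    enlarged by one of the factors and stay proper. *)
Lemma adjoin_ideal_prod I (s : seq S) : is_ideal I -> ~ I 1 ->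
  I (\prod_(a <- s) a) -> exists2 a, a \in s & ~ adjoin_ideal I a 1.
Proof.
move=> idI; have [I0 ID IM] := idI.
move=> nI1 Ip; apply: contrapT => none; apply: nI1.
have all1 a : a \in s -> adjoin_ideal I a 1.
  by move=> sa; apply: contrapT => n1; apply: none; exists a.
have key t : (forall a, a \in t -> adjoin_ideal I a 1) ->
    exists b, I (1 - b * \prod_(a <- t) a).
  elim: t => [|a t IH] ta; first by exists 1; rewrite big_nil mulr1 subrr.
  have [|b Ib] := IH; first by move=> c tc; apply: ta; rewrite inE tc orbT.
  have [c Ic] := ta a (mem_head _ _).
  exists (b * c); rewrite big_cons.
  have -> : 1 - b * c * (a * \prod_(j <- t) j) =
    (1 - c * a) + c * a * (1 - b * \prod_(j <- t) j) by ring.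
  by apply: ID => //; apply: IM.
have [b Ib] := key s all1.
by rewrite -[1](subrK (b * \prod_(a <- s) a)); apply: ID => //; apply: IM.
Qed.

End Ideals.

Section Taylor.
Variables (R S : comNzRingType) (n : nat) (f : {rmorphism R -> S}).

(** The ideal [Q] is left abstract so that one expansion serves both for powers of [X] along an arc
    and for the square of a maximal ideal. The product rule needs [Q] only to absorb the product of
    two linear parts. *)
Lemma mpoly_taylor (P : {mpoly R[n]}) (p : 'I_n -> R) (h : 'I_n -> S)
    (Q : S -> Prop) (u := fun i => h i - f (p i)) :
  is_ideal Q -> (forall i j, Q (u i * u j)) ->
  Q (mmap f h P - f P.@[p] - \sum_i f (P^`M(i)).@[p] * u i).
Proof.
move=> idQ Quu; have [Q0 QD QM] := idQ.
elim/mpoly_ring_ind: P => [c|k|A B IA IB|A B IA IB].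
- rewrite mmapC mevalC subrr sub0r -mulN1r; apply: (QM).
  by rewrite big1 // => i _; rewrite mderivC meval0 rmorph0 mul0r.
- rewrite mmapX mmap1U mevalXU (bigD1 k) //= mderivX mnm1E eqxx.
  have -> : (U_(k) - U_(k) = 0 :> 'X_{1..n})%MM.
    by apply/mnmP => i; rewrite mnmBE mnm0E subnn.
  rewrite scale1r mpolyX0 meval1 rmorph1 mul1r big1 ?addr0 ?subrr // => i nik.
  by rewrite mderivX mnm1E eq_sym (negbTE nik) scale0r meval0 rmorph0 mul0r.
- have -> : mmap f h (A + B) - f (A + B).@[p] - \sum_i f ((A + B)^`M(i)).@[p] * u i =
    (mmap f h A - f A.@[p] - \sum_i f (A^`M(i)).@[p] * u i) +
    (mmap f h B - f B.@[p] - \sum_i f (B^`M(i)).@[p] * u i).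
    have -> : \sum_i f ((A + B)^`M(i)).@[p] * u i =
      (\sum_i f (A^`M(i)).@[p] * u i) + (\sum_i f (B^`M(i)).@[p] * u i).
      by rewrite -big_split; apply: eq_bigr => i _; rewrite mderivD mevalD rmorphD mulrDl.
    by rewrite mmapD mevalD rmorphD; ring.
  exact: QD.
- set dA := \sum_i f (A^`M(i)).@[p] * u i in IA *.
  set dB := \sum_i f (B^`M(i)).@[p] * u i in IB *.
  have -> : \sum_i f ((A * B)^`M(i)).@[p] * u i = f B.@[p] * dA + f A.@[p] * dB.
    rewrite !mulr_sumr -big_split; apply: eq_bigr => i _ /=.
    by rewrite mderivM mevalD !mevalM rmorphD !rmorphM; ring.
  rewrite rmorphM mevalM rmorphM /=.
  have QdAB : Q (dA * dB).
    rewrite mulr_suml; apply: ideal_sum => // i _.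
    rewrite mulr_sumr; apply: ideal_sum => // j _.
    have -> : f (A^`M(i)).@[p] * u i * (f (B^`M(j)).@[p] * u j) =
       f (A^`M(i)).@[p] * f (B^`M(j)).@[p] * (u i * u j) by ring.
    exact: QM.
  set a := mmap f h A in IA *; set b := mmap f h B in IB *.
  have -> : a * b - f A.@[p] * f B.@[p] - (f B.@[p] * dA + f A.@[p] * dB) =
    b * (a - f A.@[p] - dA) + (f A.@[p] + dA) * (b - f B.@[p] - dB) + dA * dB.
    by ring.
  by apply: (QD) => //; apply: (QD); apply: QM.
Qed.

End Taylor.

Lemma meval_mmap (R : comNzRingType) n k (h : 'I_n -> {mpoly R[k]}) y
    (P : {mpoly R[n]}) :
  (mmap (@mpolyC k R) h P).@[y] = P.@[fun i => (h i).@[y]].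
Proof.
elim/mpoly_ring_ind: P => [c|i|p q Hp Hq|p q Hp Hq].
- by rewrite mmapC !mevalC.
- by rewrite mmapX mmap1U !mevalXU.
- by rewrite !rmorphD /= Hp Hq.
- by rewrite !rmorphM /= Hp Hq.
Qed.

Lemma horner_mmap (R : comNzRingType) n (h : 'I_n -> {poly R}) s
    (P : {mpoly R[n]}) :
  (mmap polyC h P).[s] = P.@[fun i => (h i).[s]].
Proof.
elim/mpoly_ring_ind: P => [c|i|p q Hp Hq|p q Hp Hq].
- by rewrite mmapC mevalC hornerC.
- by rewrite mmapX mmap1U mevalXU.
- by rewrite !rmorphD /= hornerD Hp Hq.
- by rewrite !rmorphM /= hornerM Hp Hq.
Qed.

Section PolyFun.
Variable K : numFieldType.

(** A function with a polynomial witness rather than a polynomial: points and products that depend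
    on a parameter are then handled pointwise, and the witness appears only when a density argument
    asks for it. *)
Definition polyfun (f : K -> K) : Prop := exists q : {poly K}, forall s, f s = q.[s].

Lemma polyfun_ext f g : f =1 g -> polyfun f -> polyfun g.
Proof. by move=> fg [q Hq]; exists q => s; rewrite -fg. Qed.

Lemma polyfunC c : polyfun (fun=> c).
Proof. by exists c%:P => s; rewrite hornerC. Qed.

Lemma polyfunX : polyfun id.
Proof. by exists 'X => s; rewrite hornerX. Qed.

Lemma polyfunD f g : polyfun f -> polyfun g -> polyfun (fun s => f s + g s).
Proof. by move=> [p Hp] [q Hq]; exists (p + q) => s; rewrite hornerD Hp Hq. Qed.

Lemma polyfunM f g : polyfun f -> polyfun g -> polyfun (fun s => f s * g s).
Proof. by move=> [p Hp] [q Hq]; exists (p * q) => s; rewrite hornerM Hp Hq. Qed.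

Lemma polyfun_sum (J : Type) (r : seq J) (P : pred J) (F : J -> K -> K) :
  (forall j, polyfun (F j)) -> polyfun (fun s => \sum_(j <- r | P j) F j s).
Proof.
move=> HF; elim: r => [|j r IH].
  by apply: polyfun_ext (polyfunC 0) => s; rewrite big_nil.
have H : polyfun (fun s => (if P j then F j s else 0) + \sum_(j <- r | P j) F j s).
  by apply: polyfunD => //; case: (P j); [apply: HF | apply: polyfunC].
by apply: polyfun_ext H => s; rewrite big_cons; case: (P j); rewrite ?add0r.
Qed.

Lemma polyfun_prod (J : Type) (r : seq J) (P : pred J) (F : J -> K -> K) :
  (forall j, polyfun (F j)) -> polyfun (fun s => \prod_(j <- r | P j) F j s).
Proof.
move=> HF; elim: r => [|j r IH].
  by apply: polyfun_ext (polyfunC 1) => s; rewrite big_nil.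
have H : polyfun (fun s => (if P j then F j s else 1) * \prod_(j <- r | P j) F j s).
  by apply: polyfunM => //; case: (P j); [apply: HF | apply: polyfunC].
by apply: polyfun_ext H => s; rewrite big_cons; case: (P j); rewrite ?mul1r.
Qed.

Lemma polyfun_meval n (g : 'I_n -> K -> K) (P : {mpoly K[n]}) :
  (forall i, polyfun (g i)) -> polyfun (fun s => P.@[fun i => g i s]).
Proof.
move=> Hg; elim/mpoly_ring_ind: P => [c|i|p q Hp Hq|p q Hp Hq].
- by apply: polyfun_ext (polyfunC c) => s; rewrite mevalC.
- by apply: polyfun_ext (Hg i) => s; rewrite mevalXU.
- by apply: polyfun_ext (polyfunD Hp Hq) => s; rewrite mevalD.
- by apply: polyfun_ext (polyfunM Hp Hq) => s; rewrite mevalM.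
Qed.

Lemma poly_all_eq0 (q : {poly K}) : (forall s, q.[s] = 0) -> q = 0.
Proof.
move=> q0; apply/eqP; case: (eqVneq q 0) => // nq.
pose rs := [seq (i%:R : K) | i <- iota 0 (size q)].
have urs : uniq rs.
  rewrite map_inj_uniq ?iota_uniq // => i j /eqP; rewrite eqr_nat => /eqP //.
have ars : all (root q) rs by apply/allP => x _; apply/rootP.
by have := max_poly_roots nq ars urs; rewrite size_map size_iota ltnn.
Qed.

Lemma poly_neq0_nonroot (q : {poly K}) : q != 0 -> exists s, q.[s] != 0.
Proof.
move=> nq; apply: contrapT => h; case/negP: nq; apply/eqP/poly_all_eq0 => s.
by apply: contrapT => /eqP qs; apply: h; exists s.
Qed.

Lemma polyfun_seq_neq0 (J : eqType) (r : seq J) (F : J -> K -> K) :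
  (forall j, j \in r -> polyfun (F j)) -> (forall j, j \in r -> exists s, F j s != 0) ->
  exists s, forall j, j \in r -> F j s != 0.
Proof.
move=> PF NF.
suff [q nq Hq] : exists2 q : {poly K}, q != 0 &
    forall s, q.[s] != 0 -> forall j, j \in r -> F j s != 0.
  by have [s Hs] := poly_neq0_nonroot nq; exists s; apply: Hq.
elim: r PF NF => [|j r IH] PF NF; first by exists 1; rewrite ?oner_neq0.
have [||q nq Hq] := IH.
- by move=> k kr; apply: PF; rewrite inE kr orbT.
- by move=> k kr; apply: NF; rewrite inE kr orbT.
have [p Hp] := PF j (mem_head _ _).
have [s0 Hs0] := NF j (mem_head _ _).
exists (p * q).
  rewrite mulf_neq0 //; apply: contra_neq Hs0 => p0.
  by rewrite Hp p0 horner0.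
move=> s; rewrite hornerM mulf_eq0 negb_or => /andP[ps qs] k.
by rewrite inE => /predU1P[->|]; [rewrite Hp | apply: Hq].
Qed.

(** The form in which density along a curve is used below: the product of the two functions vanishes
    everywhere, and [g] is not the zero polynomial. *)
Lemma polyfun_density (f g : K -> K) s0 : polyfun f -> polyfun g -> g s0 != 0 ->
  (forall s, g s != 0 -> f s = 0) -> forall s, f s = 0.
Proof.
move=> [p Hp] [q Hq] gs0 fg.
suff p0 : p = 0 by move=> s; rewrite Hp p0 horner0.
have : p * q = 0.
  apply: poly_all_eq0 => s; rewrite hornerM -Hp -Hq.
  by have [->|/fg ->] := eqVneq (g s) 0; rewrite ?mulr0 ?mul0r.
move/eqP; rewrite mulf_eq0 => /orP[/eqP //|/eqP q0].
by move: gs0; rewrite Hq q0 horner0 eqxx.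
Qed.

Definition ppolyfun (F : K -> {poly K}) : Prop := forall k, polyfun (fun s => (F s)`_k).

Lemma ppolyfun_ext F G : F =1 G -> ppolyfun F -> ppolyfun G.
Proof. by move=> FG HF k; apply: polyfun_ext (HF k) => s; rewrite FG. Qed.

Lemma ppolyfunC p : ppolyfun (fun=> p).
Proof. by move=> k; apply: polyfunC. Qed.

Lemma ppolyfunD F G : ppolyfun F -> ppolyfun G -> ppolyfun (fun s => F s + G s).
Proof.
move=> HF HG k.
by apply: polyfun_ext (polyfunD (HF k) (HG k)) => s; rewrite coefD.
Qed.

Lemma ppolyfunZ f F : polyfun f -> ppolyfun F -> ppolyfun (fun s => f s *: F s).
Proof.
move=> Hf HF k.
by apply: polyfun_ext (polyfunM Hf (HF k)) => s; rewrite coefZ.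
Qed.

Lemma ppolyfunM F G : ppolyfun F -> ppolyfun G -> ppolyfun (fun s => F s * G s).
Proof.
move=> HF HG k.
have H : polyfun (fun s => \sum_(i < k.+1) (F s)`_i * (G s)`_(k - i)).
  by apply: polyfun_sum => i; apply: polyfunM.
by apply: polyfun_ext H => s; rewrite coefM.
Qed.

Lemma ppolyfun_exp F m : ppolyfun F -> ppolyfun (fun s => F s ^+ m).
Proof.
move=> HF; elim: m => [|m IH]; first exact: ppolyfunC.
by apply: ppolyfun_ext (ppolyfunM HF IH) => s; rewrite exprS.
Qed.

Lemma ppolyfun_prod (J : Type) (r : seq J) (F : J -> K -> {poly K}) :
  (forall j, ppolyfun (F j)) -> ppolyfun (fun s => \prod_(j <- r) F j s).
Proof.
move=> HF; elim: r => [|j r IH].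
  by apply: ppolyfun_ext (ppolyfunC 1) => s; rewrite big_nil.
by apply: ppolyfun_ext (ppolyfunM (HF j) IH) => s; rewrite big_cons.
Qed.

End PolyFun.

(** Induction on the degree of the monomial whose coefficient is read. On a line parallel to an axis
    [P] is a polynomial without nonzero value, so its partial derivatives vanish everywhere too; in
    characteristic 0 they determine the coefficients of [P] one degree higher. *)
Lemma mpoly_all_eq0 (K : numFieldType) n (P : {mpoly K[n]}) :
  (forall y, P.@[y] = 0) -> P = 0.
Proof.
move=> P0; apply/mpolyP => m; rewrite mcoeff0.
have [k] := ubnP (mdeg m); elim: k P P0 m => // k IH P P0 m; rewrite ltnS => mk.
have [/eqP m0|] := eqVneq (mdeg m) 0%N.
  rewrite mdeg_eq0 in m0; rewrite (eqP m0) -(P0 (fun=> 0)).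
  elim/mpoly_ring_ind: {P0} P => [c|i|p q Hp Hq|p q Hp Hq].
  - by rewrite mevalC mcoeffC eqxx mulr1.
  - by rewrite mevalXU mcoeffX mnm1_eq0.
  - by rewrite mcoeffD mevalD Hp Hq.
  - by rewrite mevalM -Hp -Hq (rmorphM (@mcoeff n K 0%MM)).
rewrite mdeg_eq0 => nm0.
have [i mi] : exists i, m i != 0%N.
  apply: contrapT => h; case/negP: nm0; apply/eqP/mnmP => i; rewrite mnm0E.
  by apply: contrapT => /eqP mi; apply: h; exists i.
have Um : (U_(i) <= m)%MM by rewrite lep1mP.
have dP0 y : (P^`M(i)).@[y] = 0.
  pose h (j : 'I_n) : {poly K} := (y j)%:P + (j == i)%:R *: 'X.
  pose Q (q : {poly K}) := 'X^2 %| q.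
  have idQ : is_ideal Q.
    by split=> [|a b|a b]; rewrite /Q ?dvdp0 //; [apply: dvdp_add | apply: dvdp_mull].
  have uE j : h j - (y j)%:P = (j == i)%:R *: 'X by rewrite /h addrC addKr.
  have Quu j l : Q ((h j - (y j)%:P) * (h l - (y l)%:P)).
    by rewrite !uE -!mul_polyC mulrACA /Q -expr2 dvdp_mull.
  have := mpoly_taylor P idQ Quu.
  have -> : mmap polyC h P = 0.
    by apply: poly_all_eq0 => s; rewrite horner_mmap.
  rewrite P0 subr0 sub0r (bigD1 i) //= big1 ?addr0; last first.
    by move=> j /negbTE ji; rewrite uE ji scale0r mulr0.
  rewrite uE eqxx scale1r /Q dvdpNr expr2 dvdp_mul2r ?polyX_eq0 //.
  by rewrite -['X]subr0 -polyC0 dvdp_XsubCl rootC => /eqP.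
have := IH _ dP0 (m - U_(i))%MM; rewrite mcoeff_deriv submK //.
have -> : (mdeg (m - U_(i)) < k)%N.
  have := submK Um; move/(congr1 (@mdeg n)); rewrite mdegD mdeg1; lia.
move=> /(_ isT)/eqP; rewrite mulrn_eq0 /= => /eqP //.
Qed.

(** * Finite polynomial maps *)

(** The monic equations split over a closed field, so for each coordinate some [X_i - z] can be
    adjoined without reaching 1. Once all coordinates are treated, every polynomial is congruent to
    its value at [w], and a nonzero value in the ideal would be a unit. *)
Lemma weak_nullstellensatz (K : closedFieldType) n (I : {mpoly K[n]} -> Prop) :
  is_ideal I -> ~ I 1 ->
  (forall i, exists2 c : {poly K}, c \is monic & I (map_poly (@mpolyC n K) c).['X_i]) ->
  exists w, forall f, I f -> f.@[w] = 0.
Proof.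
move=> idI nI1 Hc.
have key (s : seq 'I_n) : exists I' : {mpoly K[n]} -> Prop,
    [/\ is_ideal I', forall f, I f -> I' f, ~ I' 1 &
        exists w, forall i, i \in s -> I' ('X_i - (w i)%:MP)].
  elim: s => [|i s [I' [idI' sub n1 [w Hw]]]].
    by exists I; split=> //; exists (fun=> 0).
  have [c mc Ic] := Hc i.
  have [r cE] := closed_field_poly_normal c.
  rewrite (monicP mc) scale1r in cE.
  have [|_ /mapP[z _ ->] nz] := @adjoin_ideal_prod _ I' [seq 'X_i - z%:MP | z <- r] idI' n1.
    rewrite big_map; apply: sub; move: Ic; rewrite {1}cE rmorph_prod horner_prod /=.
    by under eq_bigr => z _ do rewrite map_polyXsubC hornerXsubC.
  exists (adjoin_ideal I' ('X_i - z%:MP)); split=> //.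
  - exact: adjoin_ideal_is_ideal.
  - by move=> f /sub; apply: sub_adjoin_ideal.
  exists (fun j => if j == i then z else w j) => j.
  rewrite inE; case: eqVneq => [-> _|_ js]; first exact: adjoin_ideal_mem.
  by apply: sub_adjoin_ideal => //; apply: Hw.
have [I' [idI' sub n1 [w Hw]]] := key (enum 'I_n).
have [I0 ID IM] := idI'.
have Iw f : I' (f - f.@[w]%:MP).
  elim/mpoly_ring_ind: f => [c|i|p q Hp Hq|p q Hp Hq].
  - by rewrite mevalC subrr.
  - by rewrite mevalXU; apply: Hw; rewrite mem_enum.
  - rewrite mevalD mpolyCD; have := ID _ _ Hp Hq; congr I'; ring.
  - rewrite mevalM mpolyCM.
    have -> : p * q - p.@[w]%:MP * q.@[w]%:MP =
      q * (p - p.@[w]%:MP) + p.@[w]%:MP * (q - q.@[w]%:MP) by ring.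
    by apply: ID; apply: IM.
exists w => f /sub If; apply: contrapT => /eqP fw; apply: n1.
have : I' (f.@[w]^-1%:MP * f.@[w]%:MP).
  apply: IM; have := idealB idI' If (Iw f); congr I'; ring.
by rewrite -mpolyCM mulVf.
Qed.

(** Nakayama by Cramer's rule: the system reads [(1 - M) b = e] and is multiplied by the adjugate of
    [1 - M]. The determinant [h] evaluates to 1 because [M] evaluates to 0. *)
Lemma det_trick (A B E : comNzRingType) (phi : {rmorphism A -> B})
    (ev : {rmorphism A -> E}) (J : finType) (b : J -> B) (e : J -> A) (M : J -> J -> A) :
  (forall i, b i = phi (e i) + \sum_j phi (M i j) * b j) ->
  (forall i j, ev (M i j) = 0) ->
  exists (h : A) (D : J -> J -> A), ev h = 1 /\
    forall i, phi h * b i = phi (\sum_j D i j * e j).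
Proof.
move=> Hb HM.
pose T : 'M[A]_#|J| := 1%:M - \matrix_(i, j) M (enum_val i) (enum_val j).
pose bv : 'cV[B]_#|J| := \col_i b (enum_val i).
pose ec : 'cV[A]_#|J| := \col_i e (enum_val i).
have Tb : map_mx phi T *m bv = map_mx phi ec.
  apply/matrixP => i j; rewrite !mxE.
  under eq_bigr => k _ do rewrite !mxE rmorphB mulrBl.
  rewrite sumrB (bigD1 i) //= eqxx rmorph1 mul1r big1 ?addr0; last first.
    by move=> k /negbTE ki; rewrite eq_sym ki rmorph0 mul0r.
  apply/eqP; rewrite subr_eq; apply/eqP; rewrite {1}(Hb (enum_val i)).
  by congr (_ + _); rewrite (reindex _ (onW_bij _ (enum_val_bij J))).
pose adj := \adj T.
exists (\det T), (fun i j => adj (enum_rank i) (enum_rank j)); split.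
  rewrite -det_map_mx -(det1 E #|J|); congr (\det _).
  by apply/matrixP => i j; rewrite !mxE rmorphB rmorph_nat HM subr0.
move=> i.
have := congr1 (mulmx (map_mx phi adj)) Tb.
rewrite mulmxA -map_mxM mul_adj_mx -map_mxM.
move/matrixP/(_ (enum_rank i) 0); rewrite map_scalar_mx mul_scalar_mx !mxE enum_rankK => ->.
congr (phi _).
rewrite [RHS](reindex _ (onW_bij _ (enum_val_bij J))) /=.
by apply: eq_bigr => j _; rewrite !mxE enum_valK.
Qed.

Section FiniteMap.
Variables (K : numClosedFieldType) (N n : nat) (phi : 'I_N -> {mpoly K[n]}).

Definition pullback : {mpoly K[N]} -> {mpoly K[n]} := mmap (@mpolyC n K) phi.
HB.instance Definition _ := GRing.RMorphism.on pullback.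

Hypothesis phi_int : forall j, integralOver pullback ('X_j).

Lemma pullbackC c : pullback c%:MP = c%:MP.
Proof. exact: mmapC. Qed.

Lemma pullbackX k : pullback 'X_k = phi k.
Proof. by rewrite /pullback mmapX mmap1U. Qed.

Lemma meval_pullback y P : (pullback P).@[y] = P.@[fun k => (phi k).@[y]].
Proof. exact: meval_mmap. Qed.

Lemma finite_span : exists2 b, (0 < b)%N & forall g, exists c : 'X_{1..n < b.+1} -> {mpoly K[N]},
  g = \sum_m pullback (c m) * 'X_[m].
Proof.
pose e j := (size (projT1 (cid2 (phi_int j)))).-1.
(* By pigeonhole a monomial of degree above [b] has an exponent at least the degree [e j] of the
   monic equation of [X_j], which rewrites it in lower degree. The successor keeps the variables
   themselves among the spanning monomials. *)
pose b := (\sum_j e j).+1; exists b => //.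
pose Sp g := exists c : 'X_{1..n < b.+1} -> {mpoly K[N]}, g = \sum_m pullback (c m) * 'X_[m].
have Sp0 : Sp 0 by exists (fun=> 0); rewrite big1 // => m _; rewrite rmorph0 mul0r.
have SpD x y : Sp x -> Sp y -> Sp (x + y).
  move=> [c ->] [c' ->]; exists (fun m => c m + c' m); rewrite -big_split.
  by apply: eq_bigr => m _; rewrite rmorphD mulrDl.
have SpM a x : Sp x -> Sp (pullback a * x).
  move=> [c ->]; exists (fun m => a * c m); rewrite mulr_sumr.
  by apply: eq_bigr => m _; rewrite rmorphM mulrA.
suff SpX m : Sp 'X_[m].
  move=> g; rewrite [g]mpolyE; apply: (big_ind Sp) => // m _.
  by rewrite -mul_mpolyC -pullbackC; apply: (SpM).
have [k] := ubnP (mdeg m); elim: k m => // k IH m; rewrite ltnS => mk.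
case: (ltnP (mdeg m) b.+1) => [mb|bm].
  exists (fun m' => (m' == BMultinom mb)%:R).
  rewrite (bigD1 (BMultinom mb)) //= eqxx rmorph1 mul1r big1 ?addr0 //.
  by move=> m' /negbTE ->; rewrite rmorph0 mul0r.
have [j ejm] : exists j, (e j <= m j)%N.
  apply: contrapT => h; move: bm; rewrite ltnNge mdegE; case/negP; apply: leqW.
  by apply: leq_sum => j _; rewrite ltnW // ltnNge; apply/negP => ?; apply: h; exists j.
move: ejm; rewrite /e; case: (cid2 _) => p mp rp /= ejm.
have sp : (0 < (size p).-1)%N.
  rewrite -subn1 subn_gt0 ltnNge; apply/negP => /size1_polyC pC; move: rp.
  have := mp; rewrite pC monicE lead_coefC => /eqP ->.
  by rewrite map_polyC /= rmorph1 rootC oner_eq0.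
set d := (size p).-1 in ejm sp.
have -> : m = (m - U_(j) *+ d + U_(j) *+ d)%MM.
  rewrite submK //; apply/mnm_lepP => i; rewrite mulmnE mnm1E.
  by case: eqP => [<-|_]; rewrite ?mul1n ?mul0n.
rewrite mpolyXD -(mpolyXn _ U_(j)).
have -> : 'X_j ^+ d = - \sum_(i < d) pullback p`_i * ('X_j : {mpoly K[n]}) ^+ i.
  apply/eqP; rewrite -addr_eq0 addrC; apply/eqP; move/rootP: rp.
  rewrite (@horner_coef_wide _ d.+1); last first.
    by rewrite (leq_trans (size_poly _ _)) // /d; lia.
  rewrite big_ord_recr /= coef_map /= -lead_coefE (monicP mp) rmorph1 mul1r.
  by under eq_bigr => i _ do rewrite coef_map.
rewrite mulrN -mulN1r -(rmorphN1 pullback); apply: (SpM).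
rewrite mulr_sumr; apply: (big_ind Sp) => // i _.
rewrite mulrCA mpolyXn -mpolyXD; apply: (SpM); apply: IH.
apply: leq_trans mk; rewrite mdegD.
have : (U_(j) *+ d <= m)%MM.
  apply/mnm_lepP => l; rewrite mulmnE mnm1E.
  by case: eqP => [<-|_]; rewrite ?mul1n ?mul0n.
move/submK/(congr1 (@mdeg n)); rewrite mdegD !mdegMn !mdeg1 !mul1n => <-.
by rewrite ltn_add2l.
Qed.

(** Modulo an ideal that contains the fibre equations, a pulled back polynomial is congruent to its
    value at [x0], so the integral equation of [X_j] acquires constant coefficients. *)
Lemma fiber_ideal_monic (x0 : 'I_N -> K) (I : {mpoly K[n]} -> Prop) :
  is_ideal I -> (forall k, I (phi k - (x0 k)%:MP)) ->
  forall j, exists2 c : {poly K}, c \is monic & I (map_poly (@mpolyC n K) c).['X_j].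
Proof.
move=> idI Ik j; have [I0 ID IM] := idI.
have Ia a : I (pullback a - a.@[x0]%:MP).
  elim/mpoly_ring_ind: a => [c|i|p q Hp Hq|p q Hp Hq].
  - by rewrite mevalC pullbackC subrr.
  - by rewrite mevalXU pullbackX.
  - rewrite mevalD mpolyCD rmorphD; have := ID _ _ Hp Hq; congr I; ring.
  - rewrite mevalM mpolyCM rmorphM.
    have -> : pullback p * pullback q - p.@[x0]%:MP * q.@[x0]%:MP =
      pullback q * (pullback p - p.@[x0]%:MP) + p.@[x0]%:MP * (pullback q - q.@[x0]%:MP) by ring.
    by apply: ID; apply: IM.
have [p mp rp] := phi_int j.
exists (map_poly (meval x0) p); first exact: monic_map.
have H (q : {poly {mpoly K[N]}}) : I ((map_poly pullback q).['X_j] -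
    (map_poly (@mpolyC n K) (map_poly (meval x0) q)).['X_j]).
  elim/poly_ind: q => [|q c IH]; first by rewrite !rmorph0 horner0 subrr.
  have mapE (R S : nzRingType) (f : {rmorphism R -> S}) (a : {poly R}) b x :
    (map_poly f (a * 'X + b%:P)).[x] = (map_poly f a).[x] * x + f b.
    by rewrite rmorphD rmorphM /= map_polyX map_polyC hornerMXaddC.
  have -> : (map_poly pullback (q * 'X + c%:P)).['X_j] =
    (map_poly pullback q).['X_j] * 'X_j + pullback c by exact: mapE.
  have -> : map_poly (meval x0) (q * 'X + c%:P) =
      map_poly (meval x0) q * 'X + (meval x0 c)%:P.
    by rewrite rmorphD rmorphM /= map_polyX map_polyC.
  have -> : (map_poly (@mpolyC n K) (map_poly (meval x0) q * 'X + (meval x0 c)%:P)).['X_j] =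
    (map_poly (@mpolyC n K) (map_poly (meval x0) q)).['X_j] * 'X_j + (c.@[x0])%:MP by exact: mapE.
  have -> : forall a b c d : {mpoly K[n]}, a * 'X_j + c - (b * 'X_j + d) =
    'X_j * (a - b) + (c - d) by move=> *; ring.
  by apply: ID => //; apply: IM.
have := H p; rewrite (rootP rp) sub0r => /(IM (-1)).
by rewrite mulN1r opprK.
Qed.

(** Lying over. If the fibre over [x0] were empty, its equations would generate 1. Multiplying the
    spanning monomials by that relation and applying [det_trick] gives [h] with value 1 at [x0]
    whose pullback kills every spanning monomial, in particular 1; the hypothesis excludes this. *)
Theorem finite_image_closed (x0 : 'I_N -> K) :
  (forall h, pullback h = 0 -> h.@[x0] = 0) ->
  exists y, forall k, (phi k).@[y] = x0 k.
Proof.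
move=> Hx0.
pose g k := phi k - (x0 k)%:MP.
have idI := gen_ideal_is_ideal g.
have [[c c1]|nI1] := pselect (gen_ideal g 1); last first.
  have [w Hw] := weak_nullstellensatz idI nI1 (fiber_ideal_monic idI (gen_ideal_mem g)).
  exists w => k; have := Hw _ (gen_ideal_mem g k).
  by rewrite mevalB mevalC => /eqP; rewrite subr_eq0 => /eqP.
have [b _ spanb] := finite_span.
pose d k m := projT1 (cid (spanb (c k * 'X_[m]))).
have dE k m : c k * 'X_[m] = \sum_m' pullback (d k m m') * 'X_[m'].
  by rewrite /d; case: cid.
pose M (m m' : 'X_{1..n < b.+1}) := \sum_k ('X_k - (x0 k)%:MP) * d k m m'.
have [||h [D [h1 HD]]] := @det_trick _ _ _ pullback (meval x0) _
    (fun m : 'X_{1..n < b.+1} => 'X_[m]) (fun=> 0) M.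
- move=> m; rewrite rmorph0 add0r -[LHS]mul1r {1}c1 mulr_suml.
  rewrite /M; under [RHS]eq_bigr => m' _ do rewrite rmorph_sum mulr_suml.
  rewrite exchange_big /=; apply: eq_bigr => k _.
  under eq_bigr => m' _ do rewrite rmorphM rmorphB /= pullbackX pullbackC -mulrA.
  by rewrite -mulr_sumr -dE mulrA [g k * _]mulrC.
- move=> m m'; rewrite /M rmorph_sum big1 //= => k _.
  by rewrite mevalM mevalB mevalXU mevalC subrr mul0r.
have /Hx0/eqP : pullback h = 0.
  have := HD (BMultinom (bm0_proof n b)); rewrite /= mpolyX0 mulr1 => ->.
  by rewrite big1 ?rmorph0 // => j _; rewrite mulr0.
by rewrite h1 oner_eq0.
Qed.

Section UnramifiedPoint.
Variable q : 'I_n -> K.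
Let p k := (phi k).@[q].
Hypothesis fiber_q : forall y, (forall k, (phi k).@[y] = p k) -> y =1 q.
Hypothesis inj_q :
  forall u : 'I_n -> K, (forall k, \sum_j u j * ((phi k)^`M(j)).@[q] = 0) -> forall j, u j = 0.

Let g k := phi k - (p k)%:MP.
Let idI := gen_ideal_is_ideal g.

(** The fibre is the reduced point [q]. Injectivity of the differential puts each [X_j - q_j] in the
    fibre ideal up to the square of the maximal ideal at [q]; [det_trick] then gives [h] with
    [h(q) = 1] such that [h (X_j - q_j)] lies in the fibre ideal. Adjoining [h] leaves no zero,
    since [q] was the only one, so [h] is invertible modulo the fibre ideal. *)
Let maximal_at_q : forall j, gen_ideal g ('X_j - (q j)%:MP).
Proof.
have [I0 ID IM] := idI.
pose Jac : 'M[K]_(n, N) := \matrix_(j, k) ((phi k)^`M(j)).@[q].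
have freeJ : row_free Jac.
  rewrite -kermx_eq0; apply/eqP/row_matrixP => i; rewrite row0.
  have /sub_kermxP : (row i (kermx Jac) <= kermx Jac)%MS by rewrite row_sub.
  set v := row i _ => vJ; apply/rowP => j; rewrite [RHS]mxE; apply: (@inj_q (v 0)) => k.
  have /rowP/(_ k) := vJ; rewrite !mxE => vk; rewrite -[RHS]vk.
  by apply: eq_bigr => l _; rewrite !mxE.
pose y j : {mpoly K[n]} := 'X_j - (q j)%:MP.
pose Q (x : {mpoly K[n]}) := exists c : 'I_n -> {mpoly K[n]},
  x = \sum_j c j * y j /\ forall j, (c j).@[q] = 0.
have idQ : is_ideal Q.
  split=> [|_ _ [c [-> Hc]] [c' [-> Hc']]|a _ [c [-> Hc]]].
  - by exists (fun=> 0); split=> [|j]; rewrite ?meval0 // big1 // => j _; rewrite mul0r.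
  - exists (fun j => c j + c' j); split=> [|j]; last by rewrite mevalD Hc Hc' addr0.
    by rewrite -big_split; apply: eq_bigr => j _; rewrite mulrDl.
  - exists (fun j => a * c j); split=> [|j]; last by rewrite mevalM Hc mulr0.
    by rewrite mulr_sumr; apply: eq_bigr => j _; rewrite mulrA.
have Qyy i j : Q (y i * y j).
  exists (fun k => if k == j then y i else 0); split=> [|k].
    rewrite (bigD1 j) //= eqxx big1 ?addr0 // => k /negbTE ->; exact: mul0r.
  by case: eqP => _; rewrite ?meval0 // mevalB mevalXU mevalC subrr.
have taylor k : Q (g k - \sum_j ((phi k)^`M(j)).@[q]%:MP * y j).
  have := mpoly_taylor (phi k) (f := @mpolyC n K) idQ Qyy.
  congr (Q (_ - _ - _)); elim/mpoly_ring_ind: (phi k) => [c|i|a b Ha Hb|a b Ha Hb].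
  - by rewrite mmapC.
  - by rewrite mmapX mmap1U.
  - by rewrite rmorphD /= Ha Hb.
  - by rewrite rmorphM /= Ha Hb.
(* The rows of [Jac] are independent, so [Jinv] inverts it on the right, and [z i] is the
   combination of fibre equations with linear part [y i]. *)
pose Jinv := pinvmx Jac.
pose z i := \sum_k (Jinv k i)%:MP * g k.
have Iz i : gen_ideal g (z i).
  by apply: ideal_sum => // k _; apply: IM; apply: gen_ideal_mem.
have Qz i : Q (z i - y i).
  have -> : z i - y i =
      \sum_k (Jinv k i)%:MP * (g k - \sum_j ((phi k)^`M(j)).@[q]%:MP * y j).
    under eq_bigr => k _ do rewrite mulrBr.
    rewrite sumrB; congr (_ - _).
    under eq_bigr => k _ do rewrite mulr_sumr.
    rewrite exchange_big /=.
    transitivity (\sum_j ((Jac *m Jinv) j i)%:MP * y j).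
      rewrite mulmxVp // (bigD1 i) //= mxE eqxx mul1r big1 ?addr0 // => j /negbTE ji.
      by rewrite mxE ji mpolyC0 mul0r.
    apply: eq_bigr => j _; rewrite mxE rmorph_sum mulr_suml.
    by apply: eq_bigr => k _; rewrite rmorphM /= mxE; ring.
  by apply: ideal_sum => // k _; case: idQ => _ _; apply.
pose c i := projT1 (cid (Qz i)).
have cP i : z i - y i = \sum_j c i j * y j /\ forall j, (c i j).@[q] = 0.
  by rewrite /c; case: cid.
have [||h [D [h1 HD]]] := @det_trick _ _ _ idfun (meval q) _ y z (fun i j => - c i j).
- move=> i /=; under eq_bigr => j _ do rewrite mulNr.
  by rewrite sumrN -(cP i).1 opprB addrC subrK.
- by move=> i j /=; rewrite mevalN (cP i).2 oppr0.
have Ihy i : gen_ideal g (h * y i).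
  by have /= -> := HD i; apply: ideal_sum => // j _; apply: IM.
pose I' := adjoin_ideal (gen_ideal g) h.
have idI' : is_ideal I' by apply: adjoin_ideal_is_ideal.
have I'1 : I' 1.
  apply: contrapT => nI'1.
  have gI' k : I' (g k) by apply: sub_adjoin_ideal => //; apply: gen_ideal_mem.
  have [w Hw] := weak_nullstellensatz idI' nI'1 (fiber_ideal_monic idI' gI').
  have wq : w =1 q.
    apply: fiber_q => k; have := Hw _ (gI' k).
    by rewrite mevalB mevalC => /eqP; rewrite subr_eq0 => /eqP.
  have /eqP := Hw _ (adjoin_ideal_mem h idI).
  by rewrite (meval_eq _ wq) h1 oner_eq0.
have [b Ib] := I'1.
move=> j; rewrite -/(y j).
have -> : y j = y j * (1 - b * h) + b * (h * y j) by ring.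
by apply: ID; apply: IM.
Qed.

(* Since [q] is alone in its fibre and [phi] is unramified there, Nakayama's lemma
   makes the coordinates near [q] quotients of pulled back polynomials. *)
Lemma local_inverse :
  exists2 h : {mpoly K[N]}, h.@[p] = 1 &
    forall j, exists a, pullback a = pullback h * 'X_j.
Proof.
have [I0 ID IM] := idI.
have Iy f : gen_ideal g (f - f.@[q]%:MP).
  elim/mpoly_ring_ind: f => [c|i|a b Ha Hb|a b Ha Hb].
  - by rewrite mevalC subrr.
  - by rewrite mevalXU; apply: maximal_at_q.
  - rewrite mevalD mpolyCD; have := ID _ _ Ha Hb; congr gen_ideal; ring.
  - rewrite mevalM mpolyCM.
    have -> : a * b - a.@[q]%:MP * b.@[q]%:MP =
      b * (a - a.@[q]%:MP) + a.@[q]%:MP * (b - b.@[q]%:MP) by ring.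
    by apply: ID; apply: IM.
have [b b0 spanb] := finite_span.
pose c (m : 'X_{1..n < b.+1}) := projT1 (cid (Iy 'X_[m])).
have cE (m : 'X_{1..n < b.+1}) : 'X_[m] - 'X_[m].@[q]%:MP = \sum_k c m k * g k by rewrite /c; case: cid.
pose d m k := projT1 (cid (spanb (c m k))).
have dE m k : c m k = \sum_m' pullback (d m k m') * 'X_[m'] by rewrite /d; case: cid.
pose M (m m' : 'X_{1..n < b.+1}) := \sum_k ('X_k - (p k)%:MP) * d m k m'.
have [||h [D [h1 HD]]] := @det_trick _ _ _ pullback (meval p) _
    (fun m : 'X_{1..n < b.+1} => 'X_[m]) (fun m => 'X_[m].@[q]%:MP) M.
- move=> m /=; rewrite pullbackC; apply/eqP; rewrite addrC -subr_eq cE; apply/eqP.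
  rewrite /M; under [RHS]eq_bigr => m' _ do rewrite rmorph_sum mulr_suml.
  rewrite exchange_big /=; apply: eq_bigr => k _.
  under eq_bigr => m' _ do rewrite rmorphM rmorphB /= pullbackX pullbackC -mulrA.
  by rewrite -mulr_sumr -dE mulrC.
- move=> m m'; rewrite /M rmorph_sum big1 //= => k _.
  by rewrite mevalM mevalB mevalXU mevalC subrr mul0r.
exists h => // j.
have Ub : (mdeg U_(j) < b.+1)%N by rewrite mdeg1.
by eexists; rewrite (HD (BMultinom Ub)).
Qed.

(** The vector [w] defines a derivation [del] at [p] that descends to the image of [pullback]. By
    [local_inverse] every polynomial on the source becomes a pulled back one after multiplication by
    a power of [h], so the quotient rule extends [del] to the source, where a derivation at [q] is
    given by a vector [u]. *)
Theorem tangent_lift (w : 'I_N -> K) :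
  (forall e, pullback e = 0 -> \sum_k (e^`M(k)).@[p] * w k = 0) ->
  exists u : 'I_n -> K, forall k, w k = \sum_j u j * ((phi k)^`M(j)).@[q].
Proof.
move=> Hw; pose del e := \sum_k (e^`M(k)).@[p] * w k.
have delD a b : del (a + b) = del a + del b.
  by rewrite -big_split; apply: eq_bigr => k _; rewrite mderivD mevalD mulrDl.
have delM a b : del (a * b) = b.@[p] * del a + a.@[p] * del b.
  rewrite !mulr_sumr -big_split; apply: eq_bigr => k _.
  by rewrite mderivM mevalD !mevalM /=; ring.
have delC c : del c%:MP = 0.
  by rewrite /del big1 // => k _; rewrite mderivC meval0 mul0r.
have delX k : del 'X_k = w k.
  rewrite /del (bigD1 k) //= mderivX mnm1E eqxx scale1r.
  have -> : (U_(k) - U_(k) = 0 :> 'X_{1..N})%MM.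
    by apply/mnmP => i; rewrite mnmBE mnm0E subnn.
  rewrite mpolyX0 meval1 mul1r big1 ?addr0 // => i nik.
  by rewrite mderivX mnm1E eq_sym (negbTE nik) scale0r meval0 mul0r.
have delB a b : pullback a = pullback b -> del a = del b.
  move=> ab; have /Hw : pullback (a - b) = 0 by rewrite rmorphB /= ab subrr.
  rewrite -/(del _) delD -[- b]mulN1r -(rmorphN1 (@mpolyC N K)) delM delC mulr0 add0r.
  by rewrite mevalC mulN1r => /eqP; rewrite subr_eq0 => /eqP.
have [h h1 Ha] := local_inverse.
have delXn k : del (h ^+ k) = k%:R * del h.
  elim: k => [|k IH]; first by rewrite expr0 -mpolyC1 delC mul0r.
  by rewrite exprS delM IH rmorphXn /= h1 expr1n -natr1; ring.
pose a j := projT1 (cid (Ha j)).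
have aE j : pullback (a j) = pullback h * 'X_j by rewrite /a; case: cid.
(* Quotient rule for [a j / h], which represents the coordinate [X_j]; the denominator is 1 because
   [h] has value 1 at [p]. *)
pose u j := del (a j) - q j * del h.
have evp e : e.@[p] = (pullback e).@[q] by rewrite meval_pullback.
have key (b : {mpoly K[n]}) : exists (e : {mpoly K[N]}) (k : nat),
    pullback e = pullback h ^+ k * b /\
    del e = k%:R * del h * b.@[q] + \sum_j u j * (b^`M(j)).@[q].
  elim/mpoly_ring_ind: b => [c|j|b c [e [k [He de]]] [f [l [Hf df]]]|
      b c [e [k [He de]]] [f [l [Hf df]]]].
  - exists c%:MP, 0%N; split; first by rewrite pullbackC mul1r.
    by rewrite delC !mul0r add0r big1 // => j _; rewrite mderivC meval0 mulr0.
  - exists (a j), 1%N; split; first by rewrite aE.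
    rewrite (bigD1 j) //= mderivX mnm1E eqxx scale1r.
    have -> : (U_(j) - U_(j) = 0 :> 'X_{1..n})%MM.
      by apply/mnmP => i; rewrite mnmBE mnm0E subnn.
    rewrite mpolyX0 meval1 big1 ?addr0; last first.
      by move=> i nik; rewrite mderivX mnm1E eq_sym (negbTE nik) scale0r meval0 mulr0.
    by rewrite mevalXU /u; ring.
  - have ep : e.@[p] = b.@[q] by rewrite evp He mevalM rmorphXn /= -evp h1 expr1n mul1r.
    have fp : f.@[p] = c.@[q] by rewrite evp Hf mevalM rmorphXn /= -evp h1 expr1n mul1r.
    exists (e * h ^+ l + f * h ^+ k), (k + l)%N; split.
      by rewrite rmorphD !rmorphM !rmorphXn /= He Hf exprD; ring.
    rewrite delD !delM !delXn !rmorphXn /= h1 !expr1n ep fp de df.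
    under [in RHS]eq_bigr => j _ do rewrite mderivD mevalD mulrDr.
    by rewrite big_split /= mevalD natrD; ring.
  - have ep : e.@[p] = b.@[q] by rewrite evp He mevalM rmorphXn /= -evp h1 expr1n mul1r.
    have fp : f.@[p] = c.@[q] by rewrite evp Hf mevalM rmorphXn /= -evp h1 expr1n mul1r.
    exists (e * f), (k + l)%N; split.
      by rewrite rmorphM /= He Hf exprD; ring.
    rewrite delM ep fp de df.
    have -> : \sum_j u j * ((b * c)^`M(j)).@[q] =
        c.@[q] * (\sum_j u j * (b^`M(j)).@[q]) + b.@[q] * (\sum_j u j * (c^`M(j)).@[q]).
      rewrite !mulr_sumr -big_split; apply: eq_bigr => j _.
      by rewrite mderivM mevalD !mevalM /=; ring.
    by rewrite mevalM natrD; ring.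
exists u => k.
have [e [l [He de]]] := key (phi k).
have : del e = del (h ^+ l * 'X_k).
  by apply: delB; rewrite He rmorphM /= rmorphXn /= pullbackX.
rewrite de delM delXn delX rmorphXn /= h1 expr1n mul1r mevalXU => /eqP.
by rewrite mulrC (inj_eq (addrI _)) => /eqP ->.
Qed.

End UnramifiedPoint.
End FiniteMap.

(** * Cones, tangent vectors and linear changes of coordinates *)

Lemma homog_meval (K : comNzRingType) n k (P : {mpoly K[n]}) t v :
  P \is k.-homog -> P.@[fun i => t * v i] = t ^+ k * P.@[v].
Proof.
move=> /dhomogP hP; rewrite !mevalE mulr_sumr.
apply: eq_big_seq => m /hP <-.
under eq_bigr => i _ do rewrite exprMn.
by rewrite big_split /= prodrXr -mdegE; ring.
Qed.

Lemma homog_sum (K : nzRingType) n k (J : Type) (r : seq J) (Q : pred J) (F : J -> {mpoly K[n]}) :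
  (forall j, Q j -> F j \is k.-homog) -> \sum_(j <- r | Q j) F j \is k.-homog.
Proof. by move=> HF; apply: rpred_sum. Qed.

Lemma homog_prod_ord (K : comNzRingType) n N (F : 'I_N -> {mpoly K[n]}) (k : 'I_N -> nat) :
  (forall i, F i \is (k i).-homog) -> \prod_i F i \is (\sum_i k i).-homog.
Proof.
move=> HF; elim/big_rec2: _ => [|i y1 y2 _ Hy]; first exact: dhomog1.
exact: dhomogM.
Qed.

(** Turns affine equations on the chart where the last coordinate is 1 into forms, which are what
    [hom_ideal] accepts. *)
Lemma homogenize (K : comNzRingType) n (h : {mpoly K[n.+1]}) :
  exists N (H : {mpoly K[n.+1]}), H \is N.-homog /\
    forall c x, x ord_max = 1 -> H.@[fun i => c * x i] = c ^+ N * h.@[x].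
Proof.
exists (msize h), (\sum_(m <- msupp h) h@_m *: ('X_[m] * 'X_ord_max ^+ (msize h - mdeg m))).
split.
  rewrite big_seq; apply: homog_sum => m /msize_mdeg_lt mh; apply: dhomogZ.
  have -> : msize h = (mdeg m + 1 * (msize h - mdeg m))%N by rewrite mul1n subnKC // ltnW.
  apply: dhomogM; first by rewrite dhomogX.
  by rewrite mul1n addKn -[X in X.-homog]mul1n; apply: dhomogMn; rewrite dhomogX /= mdeg1.
move=> c x x1; rewrite rmorph_sum [h.@[x]]mevalE mulr_sumr.
apply: eq_big_seq => m /msize_mdeg_lt /ltnW mh.
rewrite /= mevalZ mevalM rmorphXn /= mevalXU x1 mulr1 mevalX.
have -> : \prod_(i < n.+1) (c * x i) ^+ m i = c ^+ mdeg m * \prod_(i < n.+1) x i ^+ m i.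
  rewrite mdegE -prodrXr -big_split /=.
  by apply: eq_bigr => i _; rewrite exprMn.
rewrite -{2}(subnKC mh) exprD.
move: (c ^+ mdeg m) (c ^+ (msize h - mdeg m)) (\prod_(i < n.+1) _) => a b e; ring.
Qed.

Section Projective.
Variables (K : numClosedFieldType) (n : nat).
Implicit Types (X Y : set 'rV[K]_n.+1) (p v : 'rV[K]_n.+1) (P : {mpoly K[n.+1]}).

Definition is_cone X := forall t v, t != 0 -> X v -> X (t *: v).

(** Meant for a [P] that is not homogeneous, such as the determinant that witnesses semicontinuity.
    Along a line of the cone [P] is a polynomial in the scaling factor whose coefficients are the
    homogeneous components, so each component is a form vanishing on [X]. *)
Lemma cone_vanish_closure X P p : is_cone X ->
  (forall v, v != 0 -> X v -> P.@[v 0] = 0) -> zariski_closure X p -> P.@[p 0] = 0.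
Proof.
move=> coneX PX [np Hp].
rewrite (pihomog_partitionE (mf := mdeg) (leqnn (msize P))) rmorph_sum /=.
apply: big1 => k _; apply: Hp; split; first by exists k; apply: pihomogP.
move=> v nv Xv.
pose q : {poly K} := \poly_(j < msize P) (pihomog mdeg j P).@[v 0].
suff q0 : q = 0 by have := congr1 (fun r : {poly K} => r`_k) q0; rewrite coef_poly ltn_ord coef0.
have Hq t : q.[t] = P.@[fun i => t * v 0 i].
  rewrite horner_poly [in RHS](pihomog_partitionE (mf := mdeg) (leqnn (msize P))) rmorph_sum /=.
  by apply: eq_bigr => j _; rewrite (homog_meval _ _ (pihomogP _ _ _)) mulrC.
(* Multiplying by [X] takes care of the scaling factor 0, where the cone gives no information. *)
apply/eqP; move: (mulf_eq0 q 'X); rewrite polyX_eq0 orbF => <-.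
apply/eqP/poly_all_eq0 => t; rewrite hornerM hornerX Hq.
have [->|nt] := eqVneq t 0; first by rewrite mulr0.
rewrite -(@meval_eq _ _ ((t *: v) 0)); last by move=> i; rewrite mxE.
by rewrite PX ?mul0r // ?scaler_eq0 ?negb_or ?nt //; apply: coneX.
Qed.

Lemma sub_closure X v : v != 0 -> X v -> zariski_closure X v.
Proof. by move=> nv Xv; split=> // P [_]; apply. Qed.

Lemma closureS X Y : (forall v, v != 0 -> X v -> Y v) ->
  forall p, zariski_closure X p -> zariski_closure Y p.
Proof.
move=> XY p [np Hp]; split=> // P [hP PY]; apply: Hp; split=> // v nv Xv.
by apply: PY => //; apply: XY.
Qed.

Lemma hom_ideal_closure X P : hom_ideal (zariski_closure X) P <-> hom_ideal X P.
Proof.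
split=> [[hP PX]|[hP PX]]; split=> // v nv Xv; first by apply: PX => //; apply: sub_closure.
by case: Xv => _; apply; split.
Qed.

Lemma closure_closed X : zariski_closed (zariski_closure X).
Proof. by exists (hom_ideal X); split=> // P []. Qed.

Lemma closed_separation X Y : zariski_closed X -> (forall v, Y v -> v != 0) -> ~ Y `<=` X ->
  exists2 P, hom_ideal X P & exists2 v, Y v & P.@[v 0] != 0.
Proof.
move=> [S [hS XE]] Y0 nYX; apply: contrapT => none; apply: nYX => v Yv.
rewrite XE; split; first exact: Y0.
move=> P SP; apply: contrapT => /eqP Pv; apply: none; exists P; last by exists v.
by split; [apply: hS | move=> w _; rewrite XE => -[_]; apply].
Qed.

(** [P] vanishes identically along the arc. As [gam - p] is divisible by [X^k], the error of the
    first-order expansion is divisible by [X^(2k)], so every coefficient of the arc in degrees 1 to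
    2k - 1 is tangent, not just the leading one. With [k = 2] this reaches the cubic term. *)
Lemma arc_tangent X p (gam : 'I_n.+1 -> {poly K}) k (g : K -> K) s0 :
  polyfun g -> g s0 != 0 ->
  (forall s, g s != 0 -> (\row_i (gam i).[s]) != 0 /\ X (\row_i (gam i).[s])) ->
  (forall i, 'X^k %| gam i - (p 0 i)%:P) ->
  forall j, (0 < j < k + k)%N -> tangent_cone_space X p (\row_i (gam i)`_j).
Proof.
move=> pg gs0 Xg Hk j /andP[j0 jk] P [hP PX].
have P0 : mmap polyC gam P = 0.
  apply: poly_all_eq0; apply: (polyfun_density _ pg gs0); first by exists (mmap polyC gam P).
  move=> s /Xg [nv Xv]; rewrite horner_mmap -(PX _ nv Xv).
  by apply: meval_eq => i; rewrite mxE.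
pose Q (q : {poly K}) : Prop := 'X^(k + k) %| q.
have idQ : is_ideal Q.
  by split=> [|a b|a b]; rewrite /Q ?dvdp0 //; [apply: dvdp_add | apply: dvdp_mull].
have Quu i l : Q ((gam i - (p 0 i)%:P) * (gam l - (p 0 l)%:P)).
  by rewrite /Q exprD dvdp_mul.
have := mpoly_taylor P idQ Quu; rewrite P0 sub0r.
case/dvdpP => q /(congr1 (fun r : {poly K} => r`_j)).
rewrite coefMXn jk coefB coefN coefC gtn_eqF // oppr0 sub0r coef_sum => /eqP.
rewrite oppr_eq0 => /eqP => H; rewrite -[RHS]H; apply: eq_bigr => i _.
by rewrite mxE coefCM coefB coefC gtn_eqF // subr0.
Qed.

End Projective.

Section LinearSubspaces.
Variable K : fieldType.

Lemma row_free_inj m N (A : 'M[K]_(m, N)) :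
  (forall u : 'rV_m, u *m A = 0 -> u = 0) -> row_free A.
Proof.
move=> H; rewrite -kermx_eq0; apply/eqP/row_matrixP => i; rewrite row0; apply: H.
by apply/sub_kermxP; rewrite row_sub.
Qed.

Lemma row_free_leq_dim m N (W : 'M[K]_(m, N)) (U : {vspace 'rV[K]_N}) :
  row_free W -> (forall u : 'rV_m, u *m W \in U) -> (m <= \dim U)%N.
Proof.
move=> fW WU; pose f := linfun (mulmxr W : 'rV[K]_m -> 'rV[K]_N).
have kf : lker f = 0%VS.
  apply/eqP; rewrite -subv0; apply/subvP => u; rewrite memv_ker lfunE /= memv0 => /eqP uW.
  by rewrite -(mulmxKp fW u) [u *m W]uW mul0mx.
have <- : \dim (limg f) = m.
  by rewrite limg_dim_eq ?kf ?capv0 // dimvf /dim /= mul1n.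
have sub : (limg f <= U)%VS.
  by apply/subvP => x /memv_imgP[u _ ->]; rewrite lfunE; apply: WU.
exact: dimvS sub.
Qed.

End LinearSubspaces.

Section Semicontinuity.
Variables (K : numClosedFieldType) (n : nat).
Variable X : set 'rV[K]_n.+1.

Let J (s : seq {mpoly K[n.+1]}) (x : 'rV[K]_n.+1) : 'M[K]_(size s, n.+1) :=
  \matrix_(i, j) ((nth 0 s i)^`M(j)).@[x 0].

(** Rank can only drop under specialization: at [p] there are as many equations with independent
    differentials as the codimension of the tangent space, and they remain independent wherever [M]
    does not vanish. *)
Lemma tangent_semicontinuous p k : tangent_dim X p k ->
  exists2 M : {mpoly K[n.+1]}, M.@[p 0] != 0 &
    forall (x : 'rV_n.+1) m (W : 'M_(m, n.+1)), M.@[x 0] != 0 -> row_free W ->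
      (forall u, tangent_cone_space X x (u *m W)) -> (m <= k.+1)%N.
Proof.
move=> [U [UE dU]].
have memU v : (v \in U) <-> tangent_cone_space X p v by rewrite -UE.
have [s [ss Xs fJ]] : exists s, [/\ size s = (n.+1 - k.+1)%N,
    forall P, P \in s -> hom_ideal X P & row_free (J s p)].
  have : (n.+1 - k.+1 <= n.+1 - k.+1)%N by [].
  elim: {1 3}(n.+1 - k.+1)%N => [|r IH] rk.
    exists [::]; split=> //; apply: row_free_inj => u _.
    by apply/rowP; case.
  have [s [ss Xs fJ]] := IH (ltnW rk).
  (* The common kernel of the differentials chosen so far is larger than [U]. An equation whose
     differential does not vanish on such a [v] is independent of the earlier ones, which all kill
     [v]. *)
  have [v [vJ nv]] : exists v, J s p *m v^T = 0 /\ v \notin U.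
    apply: contrapT => none.
    pose B := row_base (kermx (J s p)^T).
    have rB : \rank (kermx (J s p)^T) = (n.+1 - r)%N.
      by rewrite mxrank_ker mxrank_tr (eqP fJ) ss.
    suff : (\rank (kermx (J s p)^T) <= \dim U)%N by rewrite rB dU; lia.
    apply: (row_free_leq_dim (row_base_free (kermx (J s p)^T))) => u.
    apply/negPn/negP => nU; apply: none; exists (u *m B); split=> //.
    have /sub_kermxP : (u *m B <= kermx (J s p)^T)%MS.
      by rewrite (submx_trans (submxMl _ _)) // eq_row_base.
    by move=> /(congr1 trmx); rewrite trmx_mul trmxK trmx0.
  have [Q XQ Qv] : exists2 Q, hom_ideal X Q & \sum_i (Q^`M(i)).@[p 0] * v 0 i != 0.
    apply: contrapT => none; case/negP: nv; apply/memU => Q XQ.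
    by apply: contrapT => /eqP Qv; apply: none; exists Q.
  exists (Q :: s); split=> [|P|]; first by rewrite /= ss.
    by rewrite inE => /predU1P[->|/Xs].
  apply: row_free_inj => u uJ.
  pose u' : 'rV[K]_(1 + size s) := u.
  have JE : J (Q :: s) p = col_mx (\row_j (Q^`M(j)).@[p 0]) (J s p) :> 'M_(1 + size s, n.+1).
    apply/matrixP => i j; rewrite !mxE.
    by case: (splitP i) => l iE; rewrite iE ?(ord1 l) /= !mxE.
  have : u' *m J (Q :: s) p = 0 by [].
  rewrite JE -[u']hsubmxK mul_row_col => uJ'.
  have := congr1 (mulmx^~ v^T) uJ'; rewrite mulmxDl -!mulmxA vJ mulmx0 addr0 mul0mx.
  move=> /matrixP/(_ 0 0); rewrite !mxE big_ord_recl big_ord0 addr0 !mxE => /eqP.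
  rewrite mulf_eq0 => /orP[/eqP l0|]; last first.
    by move=> /eqP H; case/eqP: Qv; rewrite -[RHS]H; apply: eq_bigr => i _; rewrite ?mxE.
  have {}l0 : lsubmx u' = 0 by apply/matrixP => i j; rewrite !ord1 !mxE -[RHS]l0 ?mxE.
  move: uJ'; rewrite l0 mul0mx add0r => r0.
  have {}r0 : rsubmx u' = 0 by rewrite -(mulmxKp fJ (rsubmx u')) r0 mul0mx.
  by rewrite -[u](hsubmxK (u' : 'M_(1, 1 + size s))) -/u' l0 r0 row_mx0.
(* Right inverse of the Jacobian at [p], kept constant: the determinant of [J(x) C] is a polynomial
   in [x], equal to 1 at [p], and it is nonzero only where [J(x)] has full row rank. *)
pose C := pinvmx (J s p).
pose T : 'M[{mpoly K[n.+1]}]_(size s) :=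
  \matrix_(i, l) \sum_j (C j l)%:MP * (nth 0 s i)^`M(j).
have TE (x : 'rV[K]_n.+1) : map_mx (meval (x 0)) T = J s x *m C.
  apply/matrixP => i l; rewrite !mxE rmorph_sum; apply: eq_bigr => j _ /=.
  by rewrite mevalM mevalC [J s x i j]mxE mulrC.
exists (\det T).
  by rewrite -det_map_mx TE mulmxVp // det1 oner_neq0.
move=> x m W; rewrite -det_map_mx TE -unitfE -unitmxE => uJC fW WT.
have rJ : \rank (J s x) = size s.
  apply/eqP; rewrite eqn_leq rank_leq_row /=.
  by rewrite -{1}(mxrank_unit uJC) mxrankM_maxl.
have : W *m (J s x)^T = 0.
  apply/row_matrixP => i; rewrite row_mul row0; apply/rowP => l; rewrite !mxE.
  have := WT (delta_mx 0 i) (nth 0 s l) (Xs _ (mem_nth _ (ltn_ord l))).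
  rewrite -rowE => H; rewrite -[RHS]H; apply: eq_bigr => j _.
  by rewrite !mxE mulrC.
move/mulmx0_rank_max; rewrite mxrank_tr rJ (eqP fW) ss; lia.
Qed.

End Semicontinuity.

Section ChangeOfCoordinates.
Variables (K : numClosedFieldType) (n : nat) (M : 'M[K]_n.+1).
Hypothesis uM : M \in unitmx.
Implicit Types (X Y : set 'rV[K]_n.+1) (P : {mpoly K[n.+1]}).

Definition lin_subst P : {mpoly K[n.+1]} :=
  mmap (@mpolyC n.+1 K) (fun j => \sum_i (M i j)%:MP * 'X_i) P.

Lemma lin_substE P (v : 'rV[K]_n.+1) : (lin_subst P).@[v 0] = P.@[(v *m M) 0].
Proof.
rewrite meval_mmap; apply: meval_eq => j; rewrite rmorph_sum mxE.
by apply: eq_bigr => i _ /=; rewrite mevalM mevalC mevalXU mulrC.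
Qed.

Lemma lin_subst_homog k P : P \is k.-homog -> lin_subst P \is k.-homog.
Proof.
move=> /dhomogP hP; rewrite /lin_subst /mmap big_seq; apply: homog_sum => m /hP /= <-.
rewrite mul_mpolyC dhomogZ // /mmap1 mdegE; apply: homog_prod_ord => i.
rewrite -[X in X.-homog]mul1n; apply: dhomogMn; apply: homog_sum => j _.
by rewrite mul_mpolyC dhomogZ // dhomogX /= mdeg1.
Qed.

Lemma lin_subst_deriv P (p v : 'rV[K]_n.+1) :
  \sum_i ((lin_subst P)^`M(i)).@[p 0] * v 0 i =
  \sum_j (P^`M(j)).@[(p *m M) 0] * (v *m M) 0 j.
Proof.
elim/mpoly_ring_ind: P => [c|j|A B HA HB|A B HA HB].
- rewrite !big1 // => i _; first by rewrite mderivC meval0 mul0r.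
  by rewrite /lin_subst mmapC mderivC meval0 mul0r.
- have dX (i k : 'I_n.+1) (q : 'I_n.+1 -> K) : (('X_i : {mpoly K[n.+1]})^`M(k)).@[q] = (i == k)%:R.
    rewrite mderivX mnm1E; case: eqP => [->|_]; last by rewrite scale0r meval0.
    have -> : (U_(k) - U_(k) = 0 :> 'X_{1..n.+1})%MM.
      by apply/mnmP => l; rewrite mnmBE mnm0E subnn.
    by rewrite scale1r mpolyX0 meval1.
  rewrite /lin_subst mmapX mmap1U [RHS](bigD1 j) //= dX eqxx mul1r [X in _ = _ + X]big1 ?addr0; last first.
    by move=> k /negbTE kj; rewrite dX eq_sym kj mul0r.
  rewrite mxE; apply: eq_bigr => i _; rewrite (linear_sum (mderiv i)) /= rmorph_sum /= (bigD1 i) //=.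
  rewrite mderiv_mulC mevalM mevalC dX eqxx mulr1 big1 ?addr0 1?mulrC // => k /negbTE ki.
  by rewrite mderiv_mulC mevalM dX ki mulr0.
- under eq_bigr => i _ do rewrite /lin_subst rmorphD /= mderivD mevalD mulrDl.
  under [RHS]eq_bigr => i _ do rewrite mderivD mevalD mulrDl.
  by rewrite big_split [RHS]big_split /=; congr (_ + _).
- under eq_bigr => i _ do rewrite /lin_subst rmorphM /= mderivM mevalD !mevalM -!/(lin_subst _) !lin_substE mulrDl.
  under [RHS]eq_bigr => i _ do rewrite mderivM mevalD !mevalM mulrDl.
  rewrite !big_split /=; congr (_ + _).
    under eq_bigr => i _ do rewrite mulrAC.
    by rewrite -mulr_suml HA mulr_suml; apply: eq_bigr => i _; rewrite mulrAC.
  under eq_bigr => i _ do rewrite -mulrA.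
  by rewrite -mulr_sumr HB mulr_sumr; apply: eq_bigr => i _; rewrite mulrA.
Qed.

Lemma mulmx_unit_neq0 (v : 'rV[K]_n.+1) : v != 0 -> v *m M != 0.
Proof. by apply: contra_neq => vM; rewrite -[v](mulmxK uM) vM mul0mx. Qed.

Lemma lin_subst_hom_ideal X Y P : (forall v, X v -> Y (v *m M)) ->
  hom_ideal Y P -> hom_ideal X (lin_subst P).
Proof.
move=> XY [[k hP] PY]; split; first by exists k; apply: lin_subst_homog.
move=> v nv Xv; rewrite lin_substE; apply: PY; last exact: XY.
exact: mulmx_unit_neq0.
Qed.

Lemma closure_mulmx X Y v : (forall v, X v -> Y (v *m M)) ->
  zariski_closure X v -> zariski_closure Y (v *m M).
Proof.
move=> XY [nv Xv]; split; first exact: mulmx_unit_neq0.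
by move=> P /(lin_subst_hom_ideal XY)/Xv; rewrite lin_substE.
Qed.

Lemma tangent_mulmx X Y p v : (forall v, X v -> Y (v *m M)) ->
  tangent_cone_space X p v -> tangent_cone_space Y (p *m M) (v *m M).
Proof. by move=> XY Tv P /(lin_subst_hom_ideal XY)/Tv; rewrite lin_subst_deriv. Qed.

End ChangeOfCoordinates.

(** * Products of linear forms *)

Section TopCoefficient.
Variable R : comNzRingType.

Lemma coefM_top m n (p q : {poly R}) : (size p <= m.+1)%N -> (size q <= n.+1)%N ->
  (p * q)`_(m + n) = p`_m * q`_n.
Proof.
move=> sp sq; rewrite coefM.
have mn : (m < (m + n).+1)%N by rewrite ltnS leq_addr.
rewrite (bigD1 (Ordinal mn)) //= addKn big1 ?addr0 // => i.
rewrite -val_eqE /= => im; case: (ltnP m i) => mi.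
  by rewrite nth_default ?mul0r // (leq_trans sp).
by rewrite [q`_ _]nth_default ?mulr0 // (leq_trans sq) // ltn_subRL; lia.
Qed.

Lemma size_mul_bound m n (p q : {poly R}) : (size p <= m.+1)%N -> (size q <= n.+1)%N ->
  (size (p * q)%R <= (m + n).+1)%N.
Proof. by move=> sp sq; rewrite (leq_trans (size_polyMleq _ _)) //; lia. Qed.

Lemma size_exp_bound m n (p : {poly R}) : (size p <= m.+1)%N -> (size (p ^+ n)%R <= (m * n).+1)%N.
Proof.
move=> sp; elim: n => [|n IH]; first by rewrite expr0 size_poly1.
by rewrite exprS mulnS; apply: size_mul_bound.
Qed.

Lemma coefX_top m n (p : {poly R}) : (size p <= m.+1)%N -> (p ^+ n)`_(m * n) = p`_m ^+ n.
Proof.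
move=> sp; elim: n => [|n IH]; first by rewrite !expr0 muln0 coef1.
by rewrite !exprS mulnS coefM_top ?IH // size_exp_bound.
Qed.

Lemma prod_top (J : Type) (r : seq J) (P : pred J) (F : J -> {poly R}) (k : J -> nat) :
  (forall j, size (F j) <= (k j).+1)%N ->
  (size (\prod_(j <- r | P j) F j)%R <= (\sum_(j <- r | P j) k j).+1)%N /\
  (\prod_(j <- r | P j) F j)`_(\sum_(j <- r | P j) k j)%N = \prod_(j <- r | P j) (F j)`_(k j).
Proof.
move=> HF; elim: r => [|j r [IHs IHc]]; first by rewrite !big_nil size_poly1 coef1.
rewrite !big_cons; case: (P j) => //; split; first exact: size_mul_bound.
by rewrite coefM_top // IHc.
Qed.

End TopCoefficient.

Definition is_linear_form (K : fieldType) (l : {poly K}) := (l != 0) && (size l <= 2)%N.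

Definition lin_prod (K : fieldType) (m : seq nat) (L : nat -> {poly K}) : {poly K} :=
  \prod_(i < size m) L i ^+ nth 0%N m i.

(* The products [c A prod_i L_i^{m_i}], read as binary forms of degree [d]:
   a constant [L_i] stands for a root at infinity. *)
Definition root_locus (K : fieldType) (d : nat) (m : seq nat) (A : {poly K}) :
    set 'rV[K]_d.+1 :=
  [set v | exists (c : K) (L : nat -> {poly K}),
    [/\ c != 0, forall i, is_linear_form (L i) & rVpoly v = c *: (A * lin_prod m L)]].

Lemma sum_nth (m : seq nat) : (\sum_(i < size m) nth 0 m i)%N = sumn m.
Proof. by rewrite sumnE (big_nth 0%N) big_mkord. Qed.

Lemma nth_leq_sumn (m : seq nat) i : (nth 0 m i <= sumn m)%N.
Proof. by elim: m i => [|x m IH] [|i] //=; [apply: leq_addr | rewrite (leq_trans (IH i)) ?leq_addl]. Qed.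

Section LinProd.
Variable K : fieldType.

Lemma is_linear_formP (l : {poly K}) : is_linear_form l -> (size l <= 2)%N.
Proof. by case/andP. Qed.

Lemma lin_prod_neq0 m (L : nat -> {poly K}) :
  (forall i, is_linear_form (L i)) -> lin_prod m L != 0.
Proof. by move=> HL; apply/prodf_neq0 => i _; rewrite expf_neq0 //; case/andP: (HL i). Qed.

Lemma lin_prod_top m (L : nat -> {poly K}) : (forall i, size (L i) <= 2)%N ->
  (size (lin_prod m L) <= (sumn m).+1)%N /\
  (lin_prod m L)`_(sumn m) = \prod_(i < size m) (L i)`_1 ^+ nth 0%N m i.
Proof.
move=> HL; rewrite -sum_nth.
have [|s c] := @prod_top _ _ (index_enum 'I_(size m)) xpredT (fun i => L i ^+ nth 0%N m i) (fun i => nth 0%N m i).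
  by move=> i; rewrite -[X in (_ <= X.+1)%N]mul1n; apply: size_exp_bound.
split=> //; rewrite c; apply: eq_bigr => i _.
by rewrite -{2}[nth 0%N m i]mul1n coefX_top.
Qed.

Lemma lin_prod_cons r m (L : nat -> {poly K}) :
  lin_prod (r :: m) L = L 0%N ^+ r * lin_prod m (fun i => L i.+1).
Proof. by rewrite /lin_prod /= big_ord_recl. Qed.

Lemma lin_prod_nil (L : nat -> {poly K}) : lin_prod [::] L = 1.
Proof. by rewrite /lin_prod big_ord0. Qed.

Lemma lin_prod_cat m1 m2 (L : nat -> {poly K}) :
  lin_prod (m1 ++ m2) L = lin_prod m1 L * lin_prod m2 (fun i => L (size m1 + i)%N).
Proof.
elim: m1 L => [|r m1 IH] L; first by rewrite lin_prod_nil mul1r.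
by rewrite cat_cons !lin_prod_cons IH mulrA.
Qed.

Lemma eq_lin_prod m (L L' : nat -> {poly K}) :
  (forall i, (i < size m)%N -> L i = L' i) -> lin_prod m L = lin_prod m L'.
Proof. by move=> LL'; apply: eq_bigr => i _; rewrite LL'. Qed.

Lemma root_locus_neq0 d m (A : {poly K}) v : A != 0 -> root_locus m A v -> v != 0 :> 'rV_d.+1.
Proof.
move=> nA [c [L [nc HL vE]]]; apply: contra_eq_neq vE => ->; rewrite linear0 eq_sym.
by rewrite scaler_eq0 negb_or nc mulf_neq0 // lin_prod_neq0.
Qed.

Lemma root_locus_cone d m (A : {poly K}) t v : t != 0 ->
  @root_locus K d m A v -> root_locus m A (t *: v).
Proof.
move=> nt [c [L [nc HL vE]]]; exists (t * c), L; split=> //; first by rewrite mulf_neq0.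
by rewrite linearZ /= vE scalerA.
Qed.

End LinProd.

Lemma prod_regroup (R : comNzRingType) d (lam : seq nat) (F : nat -> R) :
  (forall r, r \in lam -> 0 < r <= d)%N ->
  \prod_(1 <= r < d.+1) (\prod_(i < size lam | nth 0%N lam i == r) F i) ^+ r =
  \prod_(i < size lam) F i ^+ nth 0%N lam i.
Proof.
move=> Hlam.
transitivity (\prod_(1 <= r < d.+1) \prod_(i < size lam) (if nth 0%N lam i == r then F i ^+ r else 1)).
  by apply: eq_bigr => r _; rewrite -prodrXl big_mkcond.
rewrite exchange_big /=; apply: eq_bigr => i _.
have /Hlam /andP[i0 id] := mem_nth 0%N (ltn_ord i).
rewrite (bigD1_seq (nth 0%N lam i)) ?iota_uniq //=; last by rewrite mem_index_iota i0 ltnS.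
rewrite eqxx big1 ?mulr1 // => r nr; rewrite eq_sym (negbTE nr) //.
Qed.

Section BinaryForms.
Variable K : numClosedFieldType.

(** ['X^i] sends the first variable to 1 and the second to [X], so the [i]-th coordinate of a binary
    form is its coefficient of [X^i]. *)
Definition dehom : {mpoly K[2]} -> {poly K} := mmap polyC (fun i : 'I_2 => 'X^i).
HB.instance Definition _ := GRing.RMorphism.on dehom.

Lemma dehomX (i : 'I_2) : dehom 'X_i = 'X^i.
Proof. by rewrite /dehom mmapX mmap1U. Qed.

Lemma dehomZ c P : dehom (c *: P) = c *: dehom P.
Proof. by rewrite /dehom mmapZ mul_polyC. Qed.

Lemma size_dehom k P : P \is k.-homog -> (size (dehom P) <= k.+1)%N.
Proof.
move=> /dhomogP hP; rewrite /dehom /mmap (leq_trans (size_sum _ _ _)) //.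
apply/bigmax_leqP_seq => m /hP /= mk _.
rewrite mul_polyC (leq_trans (size_scale_leq _ _)) // /mmap1 big_ord_recl big_ord1 /=.
rewrite expr0 expr1n mul1r expr1 size_polyXn ltnS -mk mdegE big_ord_recl big_ord1.
exact: leq_addl.
Qed.

Lemma dehom_eq0 k P : P \is k.-homog -> dehom P = 0 -> P = 0.
Proof.
(* Multiplication by the first variable reduces the claim to points where that variable is nonzero,
   and there the dehomogenized form determines the value. *)
move=> hP P0; apply/eqP; move: (mulf_eq0 'X_(0 : 'I_2) P).
have -> : ('X_(0 : 'I_2) == 0 :> {mpoly K[2]}) = false.
  by apply/negbTE; rewrite -msize_poly_eq0 msizeX.
rewrite orFb => <-; apply/eqP/mpoly_all_eq0 => y; rewrite mevalM mevalXU.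
have [->|y0] := eqVneq (y 0) 0; first by rewrite mul0r.
have -> : P.@[y] = y 0 ^+ k * (dehom P).[y 1 / y 0].
  rewrite horner_mmap -(homog_meval _ _ hP); apply: meval_eq => i.
  rewrite hornerXn; case: i => [[|[|//]]] i2 /=.
    by rewrite expr0 mulr1; congr y; apply/val_inj.
  by rewrite expr1 mulrC divfK //; congr y; apply/val_inj.
by rewrite P0 horner0 !mulr0.
Qed.

Lemma binary_form_homog d (v : 'rV[K]_d.+1) : binary_form v \is d.-homog.
Proof.
apply: homog_sum => i _; apply: dhomogZ.
have -> : [in K[2], d.-homog] = [in K[2], (1 * (d - i) + 1 * i).-homog].
  by congr ishomog1; have := ltn_ord i; lia.
by apply: dhomogM; apply: dhomogMn; rewrite dhomogX /= mdeg1.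
Qed.

Lemma dehom_binary_form d (v : 'rV[K]_d.+1) : dehom (binary_form v) = rVpoly v.
Proof.
rewrite rmorph_sum /=; apply/polyP => k; rewrite coef_sum.
have [kd|dk] := ltnP k d.+1; last first.
  rewrite [RHS]nth_default ?(leq_trans (size_poly _ _)) // big1 // => i _.
  rewrite dehomZ rmorphM !rmorphXn /= !dehomX expr0 expr1n mul1r coefZ expr1 coefXn.
  by rewrite gtn_eqF ?mulr0 // (leq_trans (ltn_ord i)).
rewrite (coef_rVpoly_ord v (Ordinal kd)) (bigD1 (Ordinal kd)) //= big1 ?addr0.
  by rewrite dehomZ rmorphM !rmorphXn /= !dehomX expr0 expr1n mul1r coefZ expr1 coefXn eqxx mulr1.
move=> i; rewrite -val_eqE /= => ik.
by rewrite dehomZ rmorphM !rmorphXn /= !dehomX expr0 expr1n mul1r coefZ expr1 coefXn eq_sym (negbTE ik) mulr0.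
Qed.

(** One part [r0] of [lam] is peeled off at a time. When the degree of [g r0] falls short of the
    multiplicity of [r0], that part receives the constant form 1, a root at infinity. *)
Lemma linear_factorization (lam : seq nat) (g : nat -> {poly K}) :
  (forall r, g r != 0 /\ (size (g r) <= (count_mem r lam).+1)%N) ->
  exists2 L : nat -> {poly K}, forall i, is_linear_form (L i) &
    forall r, exists2 c, c != 0 & g r = c *: \prod_(i < size lam | nth 0%N lam i == r) L i.
Proof.
elim: lam g => [|r0 lam IH] g Hg.
  exists (fun=> 1) => [i|r]; first by rewrite /is_linear_form oner_neq0 size_poly1.
  have [nr sr] := Hg r; exists (g r)`_0.
    by apply: contra_neq nr => g0; rewrite (size1_polyC sr) g0.
  by rewrite big_ord0 alg_polyC -(size1_polyC sr).
have [l [g' [Hl Hg' gE]]] : exists (l : {poly K}) (g' : nat -> {poly K}), [/\ is_linear_form l,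
    forall r, g' r != 0 /\ (size (g' r) <= (count_mem r lam).+1)%N &
    forall r, g r = (if r0 == r then l else 1) * g' r].
  have [n0 s0] := Hg r0.
  have [small|big] := leqP (size (g r0)) (count_mem r0 lam).+1.
    exists 1, g; split; first by rewrite /is_linear_form oner_neq0 size_poly1.
      move=> r; have [nr sr] := Hg r; split=> //; have [->//|nr0] := eqVneq r r0.
      by move: sr; rewrite /= eq_sym (negbTE nr0).
    by move=> r; rewrite if_same mul1r.
  have /closed_rootP [z] : size (g r0) != 1%N by rewrite gtn_eqF // (leq_trans _ big).
  move=> /factor_theorem[q qE].
  have nq : q != 0 by apply: contra_neq n0 => q0; rewrite qE q0 mul0r.
  exists ('X - z%:P), (fun r => if r0 == r then q else g r); split.
  - by rewrite /is_linear_form polyXsubC_eq0 size_XsubC.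
  - move=> r; case: (eqVneq r0 r) => [<-|nr]; last first.
      by have [nz sz] := Hg r; split=> //; move: sz; rewrite /= (negbTE nr).
    split=> //; move: s0; rewrite qE size_Mmonic ?monicXsubC // size_XsubC /= eqxx; lia.
  - by move=> r; case: eqP => [<-|]; rewrite ?mul1r // mulrC.
have [L HL LE] := IH g' Hg'.
exists (fun i => if i is i'.+1 then L i' else l) => [[|i]|r] //=.
have [c nc cE] := LE r; exists c => //.
rewrite gE cE -scalerAr; congr (_ *: _).
by rewrite big_mkcond [in RHS]big_mkcond big_ord_recl /= -big_mkcond.
Qed.

Lemma count_ord (lam : seq nat) r :
  (\sum_(i < size lam | nth 0 lam i == r) 1)%N = count_mem r lam.
Proof. by rewrite -sum1_count (big_nth 0%N) big_mkord. Qed.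

(** Each [G_r] splits into linear forms, one for every part of size [r], and conversely the forms of
    these parts multiply to a [G_r]. Points become tuples of roots indexed by the parts. *)
Lemma f_image_root_locus d (lam : seq nat) : 0%N \notin lam -> sumn lam = d ->
  @f_image K d lam = root_locus lam 1.
Proof.
move=> lam0 sd.
have Hlam r : r \in lam -> (0 < r <= d)%N.
  move=> rl; rewrite lt0n; apply/andP; split; first by apply: contraNneq lam0 => <-.
  by rewrite -sd -(nth_index 0%N rl) nth_leq_sumn.
apply/seteqP; split=> v.
  case=> G [c [YG nc vE]].
  pose g r := if (0 < r <= d)%N then dehom (G r) else 1.
  have [|L HL LE] := @linear_factorization lam g.
    move=> r; rewrite /g; case: ifP => rd; last by rewrite oner_neq0 size_poly1.
    have [hG nG] := YG r rd; split; last exact: size_dehom hG.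
    by apply: contra_neq nG; apply: dehom_eq0 hG.
  pose a r := projT1 (cid2 (LE r)).
  have aE r : a r != 0 /\ g r = a r *: \prod_(i < size lam | nth 0%N lam i == r) L i.
    by rewrite /a; case: cid2.
  exists (c * \prod_(1 <= r < d.+1) a r ^+ r), L; split=> //.
    by rewrite mulf_neq0 // prodf_seq_neq0; apply/allP => r _ /=; rewrite expf_neq0 ?(aE r).1.
  rewrite -dehom_binary_form vE dehomZ -scalerA mul1r; congr (_ *: _).
  rewrite rmorph_prod /= /lin_prod -(prod_regroup L Hlam) -scaler_prod.
  rewrite big_nat [in RHS]big_nat; apply: eq_bigr => r rd.
  by rewrite rmorphXn /= -exprZn -(aE r).2 /g -ltnS rd.
case=> c [L [nc HL vE]].
pose l i : {mpoly K[2]} := (L i)`_0 *: 'X_0 + (L i)`_1 *: 'X_1.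
have hl i : l i \is 1.-homog by apply: rpredD; apply: dhomogZ; rewrite dhomogX /= mdeg1.
have lE i : dehom (l i) = L i.
  rewrite rmorphD /= !dehomZ !dehomX expr0 expr1; apply/polyP => k.
  rewrite coefD !coefZ coef1 coefX.
  case: k => [|[|k]]; rewrite ?mulr1 ?mulr0 ?addr0 ?add0r //.
  by rewrite nth_default // (leq_trans (is_linear_formP (HL i))).
have nl i : l i != 0.
  by have := HL i; rewrite /is_linear_form -lE => /andP[+ _]; apply: contra_neq => ->; rewrite rmorph0.
exists (fun r => \prod_(i < size lam | nth 0%N lam i == r) l i), c; split=> //.
  move=> r _; split; last by apply/prodf_neq0 => i _.
  rewrite /mult -count_ord.
  elim/big_rec2: _ => [|i y1 y2 _ Hy]; first exact: dhomog1.
  exact: dhomogM.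
rewrite (prod_regroup l Hlam); apply/eqP; rewrite -subr_eq0; apply/eqP.
apply: (@dehom_eq0 d).
  apply: rpredB; first exact: binary_form_homog.
  apply: dhomogZ; rewrite -[X in X.-homog]sd -sum_nth; apply: homog_prod_ord => i.
  by rewrite -[X in X.-homog]mul1n; apply: dhomogMn.
rewrite rmorphB /= dehomZ dehom_binary_form vE mul1r rmorph_prod /=.
by apply/eqP; rewrite subr_eq0; apply/eqP; congr (_ *: _); apply: eq_bigr => i _; rewrite rmorphXn /= lE.
Qed.

Lemma f_image_perm d (m m' : seq nat) : perm_eq m m' -> @f_image K d m = @f_image K d m'.
Proof.
move=> mm'; rewrite /f_image /Y_point /mult.
by under eq_fun => v do under eq_exists => G do under eq_exists => c do
  under eq_forall => r do rewrite (permP mm').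
Qed.

End BinaryForms.

(** * Moving the point at infinity *)

Section Substitution.
Variable K : numClosedFieldType.
Implicit Types A B F : {poly K}.

Lemma poly_eq_nonroot B F G : B != 0 -> (forall x, B.[x] != 0 -> F.[x] = G.[x]) -> F = G.
Proof.
move=> nB FG; apply/eqP; rewrite -subr_eq0; move: (mulf_eq0 B (F - G)).
rewrite (negbTE nB) orFb => <-; apply/eqP/poly_all_eq0 => x.
rewrite hornerM hornerD hornerN; have [->|/FG ->] := eqVneq B.[x] 0; first by rewrite mul0r.
by rewrite subrr mulr0.
Qed.

(* [F(X, Y)] of degree [n] becomes [F(A, B)]. *)
Definition subst n A B F : {poly K} := \sum_(i < n.+1) F`_i *: (A ^+ i * B ^+ (n - i)).

Definition subst_mx d A B : 'M[K]_d.+1 := \matrix_(i, j) (A ^+ i * B ^+ (d - i))`_j.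

Lemma size_subst n A B F : (size A <= 2)%N -> (size B <= 2)%N -> (size (subst n A B F) <= n.+1)%N.
Proof.
move=> sA sB; rewrite (leq_trans (size_sum _ _ _)) //; apply/bigmax_leqP => i _.
rewrite (leq_trans (size_scale_leq _ _)) //.
have e : (1 * i + 1 * (n - i))%N = n by have := ltn_ord i; lia.
by rewrite -[X in (_ <= X.+1)%N]e; apply: size_mul_bound; apply: size_exp_bound.
Qed.

Lemma rVpoly_subst d A B (v : 'rV[K]_d.+1) : (size A <= 2)%N -> (size B <= 2)%N ->
  rVpoly (v *m subst_mx d A B) = subst d A B (rVpoly v).
Proof.
move=> sA sB; apply/polyP => k.
have [kd|dk] := ltnP k d.+1; last first.
  by rewrite !nth_default ?(leq_trans (size_poly _ _)) // (leq_trans (size_subst _ _ _ _)).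
rewrite (coef_rVpoly_ord _ (Ordinal kd)) mxE coef_sum; apply: eq_bigr => i _.
by rewrite coefZ coef_rVpoly_ord mxE.
Qed.

Lemma horner_subst n A B F x : (size F <= n.+1)%N -> B.[x] != 0 ->
  (subst n A B F).[x] = B.[x] ^+ n * F.[A.[x] / B.[x]].
Proof.
move=> sF nB; rewrite (horner_coef_wide _ sF) mulr_sumr horner_sum; apply: eq_bigr => i _.
have iN : (i <= n)%N by rewrite -ltnS.
rewrite hornerZ hornerM !horner_exp expr_div_n -[in B.[x] ^+ n](subnK iN) exprD.
move: (A.[x] ^+ i) (B.[x] ^+ i) (expf_neq0 i nB) (B.[x] ^+ (n - i)) => a b nb b'.
by field.
Qed.

Section InvertibleSubstitution.
Variables A B A' B' : {poly K}.
Hypotheses (sA : (size A <= 2)%N) (sB : (size B <= 2)%N) (nB : B != 0).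
Hypotheses (sA' : (size A' <= 2)%N) (sB' : (size B' <= 2)%N).
Hypothesis substK : forall n F, (size F <= n.+1)%N -> subst n A' B' (subst n A B F) = F.

Lemma subst_neq0 n F : (size F <= n.+1)%N -> F != 0 -> subst n A B F != 0.
Proof.
move=> sF; apply: contra_neq => F0; rewrite -(substK sF) F0.
by rewrite /subst big1 // => i _; rewrite coef0 scale0r.
Qed.

Lemma subst_mxK d : subst_mx d A B *m subst_mx d A' B' = 1%:M.
Proof.
apply/row_matrixP => i; rewrite rowE mulmxA; apply: (can_inj rVpolyK).
by rewrite !rVpoly_subst // substK ?size_poly // rowE mulmx1.
Qed.

Lemma subst_lin_prod a m F (L : nat -> {poly K}) : (size F <= a.+1)%N ->
  (forall i, is_linear_form (L i)) ->
  subst (a + sumn m) A B (F * lin_prod m L) =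
  subst a A B F * lin_prod m (fun i => subst 1 A B (L i)).
Proof.
move=> sF HL; apply: (poly_eq_nonroot nB) => x nBx.
have sL i := is_linear_formP (HL i).
rewrite horner_subst //; last by apply: size_mul_bound => //; exact: (lin_prod_top m sL).1.
rewrite !hornerM horner_subst // exprD -!mulrA; congr (_ * _).
rewrite mulrCA; congr (_ * _).
rewrite /lin_prod !horner_prod -sum_nth -prodrXr -big_split; apply: eq_bigr => i _.
by rewrite /= !horner_exp horner_subst // exprMn expr1.
Qed.

Lemma root_locus_subst d a m F v : (size F <= a.+1)%N -> (a + sumn m)%N = d ->
  root_locus m F v -> root_locus m (subst a A B F) (v *m subst_mx d A B).
Proof.
move=> sF ad [c [L [nc HL vE]]]; exists c, (fun i => subst 1 A B (L i)); split=> // [i|].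
  rewrite /is_linear_form subst_neq0 ?size_subst ?(is_linear_formP (HL i)) //.
  by case/andP: (HL i).
have H := @subst_lin_prod a m F L sF HL; rewrite ad in H.
rewrite rVpoly_subst // -H vE /subst scaler_sumr.
by apply: eq_bigr => i _; rewrite coefZ scalerA.
Qed.

End InvertibleSubstitution.

(* The coordinate change [x = c + 1/y] moves the point [c] to infinity. *)
Definition fwdA (c : K) : {poly K} := c *: 'X + 1.
Definition bwdB (c : K) : {poly K} := 'X - c%:P.

Lemma size_fwdA c : (size (fwdA c) <= 2)%N.
Proof. by rewrite /fwdA -polyC1 -mul_polyC size_MXaddC; case: ifP => // _; rewrite ltnS size_polyC leq_b1. Qed.

Lemma size_bwdB c : (size (bwdB c) <= 2)%N.
Proof. by rewrite size_XsubC. Qed.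

Let sX : (size ('X : {poly K}) <= 2)%N. Proof. by rewrite size_polyX. Qed.
Let s1 : (size (1%R : {poly K}) <= 2)%N. Proof. by rewrite size_poly1. Qed.

Let horner_one x : (1 : {poly K}).[x] = 1. Proof. by rewrite hornerC. Qed.

Lemma fwdK c n F : (size F <= n.+1)%N -> subst n 1 (bwdB c) (subst n (fwdA c) 'X F) = F.
Proof.
move=> sF; apply: (@poly_eq_nonroot (bwdB c)); first by rewrite polyXsubC_eq0.
move=> x; rewrite hornerXsubC => nx.
rewrite horner_subst ?hornerXsubC ?size_subst ?size_fwdA // horner_one div1r.
rewrite horner_subst ?hornerX ?invr_eq0 // hornerD hornerZ hornerX horner_one.
rewrite mulrA -exprMn divff // expr1n mul1r; congr F.[_].
by field.
Qed.

Lemma bwdK c n F : (size F <= n.+1)%N -> subst n (fwdA c) 'X (subst n 1 (bwdB c) F) = F.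
Proof.
move=> sF; apply: (@poly_eq_nonroot 'X); first by rewrite polyX_eq0.
move=> x; rewrite hornerX => nx.
rewrite horner_subst ?hornerX ?size_subst ?size_bwdB // hornerD hornerZ hornerX horner_one.
have e : (bwdB c).[(c * x + 1) / x] = x^-1 by rewrite hornerXsubC; field.
rewrite horner_subst ?e ?invr_eq0 // horner_one mulrA -exprMn divff // expr1n !mul1r.
by rewrite invrK.
Qed.

(** The purpose of the coordinate change: a form that does not vanish at [c] acquires full degree,
    hence has no root at infinity. *)
Lemma fwd_top c n F : (size F <= n.+1)%N -> (subst n (fwdA c) 'X F)`_n = F.[c].
Proof.
move=> sF; rewrite coef_sum (horner_coef_wide _ sF); apply: eq_bigr => i _.
rewrite coefZ; congr (_ * _).
have e : n = (1 * i + 1 * (n - i))%N by have := ltn_ord i; lia.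
rewrite [X in _`_X]e coefM_top ?size_exp_bound ?size_fwdA // !coefX_top ?size_fwdA //.
by rewrite coefX expr1n mulr1 coefD coefZ coefX coef1 mulr1 addr0.
Qed.

Definition fwd_mx d c := subst_mx d (fwdA c) 'X.
Definition bwd_mx d c := subst_mx d 1 (bwdB c).

Lemma fwd_mxK d c : fwd_mx d c *m bwd_mx d c = 1%:M.
Proof. by apply: subst_mxK; rewrite ?size_fwdA ?size_bwdB //; apply: fwdK. Qed.

Lemma bwd_mxK d c : bwd_mx d c *m fwd_mx d c = 1%:M.
Proof. by apply: subst_mxK; rewrite ?size_fwdA ?size_bwdB //; apply: bwdK. Qed.

Lemma fwd_unit d c : fwd_mx d c \in unitmx.
Proof. by case: (mulmx1_unit (fwd_mxK d c)). Qed.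

Lemma root_locus_fwd c d a m F v : (size F <= a.+1)%N -> (a + sumn m)%N = d ->
  root_locus m F v -> root_locus m (subst a (fwdA c) 'X F) (v *m fwd_mx d c).
Proof.
move=> sF ad; apply: (@root_locus_subst (fwdA c) 'X 1 (bwdB c)) => //.
- exact: size_fwdA.
- by rewrite polyX_eq0.
- exact: fwdK.
Qed.

Lemma root_locus_bwd c d a m F v : (size F <= a.+1)%N -> (a + sumn m)%N = d ->
  root_locus m F v -> root_locus m (subst a 1 (bwdB c) F) (v *m bwd_mx d c).
Proof.
move=> sF ad; apply: (@root_locus_subst 1 (bwdB c) (fwdA c) 'X) => //.
- exact: size_bwdB.
- by rewrite polyXsubC_eq0.
- exact: bwdK.
Qed.

End Substitution.

Section MonicParametrization.
Variable K : numClosedFieldType.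

(** A nonzero top coefficient excludes roots at infinity, so each [L_i] can be divided by its
    leading coefficient, which moves into the scalar. *)
Lemma root_locus_monic d a m (A : {poly K}) (v : 'rV_d.+1) : 0%N \notin m ->
  (size A <= a.+1)%N -> (a + sumn m)%N = d -> root_locus m A v -> (rVpoly v)`_d != 0 ->
  A`_a != 0 /\ exists z : nat -> K,
    rVpoly v = (rVpoly v)`_d *: (((A`_a)^-1 *: A) * lin_prod m (fun i => 'X - (z i)%:P)).
Proof.
move=> m0 sA ad [c [L [nc HL vE]]].
have sL i := is_linear_formP (HL i).
have [sP cP] := lin_prod_top m sL.
have top : (rVpoly v)`_d = c * (A`_a * \prod_(i < size m) (L i)`_1 ^+ nth 0%N m i).
  by rewrite vE coefZ -ad coefM_top // cP.
rewrite top !mulf_eq0 !negb_or => /and3P[_ nA pL]; split=> //.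
have nLi i : (i < size m)%N -> (L i)`_1 != 0.
  move=> im; move: pL => /prodf_neq0/(_ (Ordinal im) isT).
  by rewrite expf_eq0 /= negb_and lt0n (contraNneq _ m0) // => <-; apply: mem_nth.
exists (fun i => - (L i)`_0 / (L i)`_1).
have -> : lin_prod m (fun i => 'X - (- (L i)`_0 / (L i)`_1)%:P) =
    (\prod_(i < size m) (L i)`_1 ^+ nth 0%N m i)^-1 *: lin_prod m L.
  rewrite /lin_prod -prodfV -scaler_prod; apply: eq_bigr => i _.
  have nb := nLi i (ltn_ord i); rewrite -exprVn -exprZn; congr (_ ^+ _).
  apply/polyP => k; rewrite coefZ coefB coefX coefC.
  case: k => [|[|k]] /=; first by rewrite sub0r mulNr opprK mulrC.
    by rewrite subr0 mulVf.
  have -> : (L i)`_k.+2 = 0 by apply: nth_default; apply: leq_trans (sL i) _.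
  by rewrite subrr mulr0.
rewrite vE -!scalerAl -!scalerAr !scalerA; congr (_ *: _).
move: (\prod_(i < size m) _) pL A`_a nA => x nx y ny.
by field; rewrite nx ny.
Qed.

End MonicParametrization.

(** * Closedness, irreducibility and chains *)

Section CoefficientMap.
Variables (K : numClosedFieldType) (d n : nat) (Gam : {poly {mpoly K[n]}}).
Hypotheses (monGam : Gam \is monic) (sizeGam : size Gam = d.+1).

Definition coef_map_of (k : 'I_d.+1) : {mpoly K[n]} := Gam`_k.

(** [Gam] itself is the integral equation: its coefficients are by construction the images of the
    variables. *)
Lemma integral_of_root x : root Gam x -> integralOver (pullback coef_map_of) x.
Proof.
move=> rx.
(* The top coefficient is 1 instead of the last variable, which makes [P] monic; both have image 1,
   since [Gam] is monic of degree [d]. *)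
pose P : {poly {mpoly K[d.+1]}} :=
  \poly_(k < d.+1) (if k == d then 1 else 'X_(inord k)).
have Pd : P`_d = 1 by rewrite coef_poly ltnSn eqxx.
have sP : size P = d.+1.
  apply/eqP; rewrite eqn_leq size_poly ltnNge; apply/negP => /leq_sizeP/(_ d (leqnn _)) /eqP.
  by rewrite Pd oner_eq0.
exists P; first by rewrite monicE lead_coefE sP Pd.
suff -> : map_poly (pullback coef_map_of) P = Gam by [].
apply/polyP => k; rewrite coef_map coef_poly; case: ltnP => kd; last first.
  by rewrite raddf0 nth_default ?sizeGam.
case: eqP => [->|_].
  by rewrite /= rmorph1; have := monicP monGam; rewrite lead_coefE sizeGam => ->.
by rewrite /= pullbackX /coef_map_of inordK.
Qed.

Lemma meval_coef_map y k : (coef_map_of k).@[y] = (map_poly (meval y) Gam)`_k.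
Proof. by rewrite coef_map. Qed.

End CoefficientMap.

Section RootLocusClosed.
Variable K : numClosedFieldType.

Lemma monic_prod_XsubC_exp (R : comNzRingType) (m : seq nat) (z : 'I_(size m) -> R) :
  \prod_(i < size m) ('X - (z i)%:P) ^+ nth 0%N m i \is monic /\
  size (\prod_(i < size m) ('X - (z i)%:P) ^+ nth 0%N m i) = (sumn m).+1.
Proof.
have mon : \prod_(i < size m) ('X - (z i)%:P) ^+ nth 0%N m i \is monic.
  by apply: monic_prod => i _; rewrite monic_exp ?monicXsubC.
split=> //; have [|sz cz] := @prod_top _ _ (index_enum 'I_(size m)) xpredT
    (fun i => ('X - (z i)%:P) ^+ nth 0%N m i) (fun i => nth 0%N m i).
  by move=> i; rewrite -[X in (_ <= X.+1)%N]mul1n size_exp_bound // size_XsubC.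
rewrite sum_nth in sz cz; apply/eqP; rewrite eqn_leq sz ltnNge; apply/negP.
move=> /leq_sizeP/(_ _ (leqnn _)); rewrite cz big1 => [/eqP|i _]; first by rewrite oner_eq0.
rewrite -{2}[nth 0%N m i]mul1n coefX_top ?size_XsubC //.
by rewrite coefB coefX coefC subr0 expr1n.
Qed.

Lemma lin_prod_ord (m : seq nat) (z : nat -> K) :
  lin_prod m (fun i => 'X - (z i)%:P) = \prod_(i < size m) ('X - (z i)%:P) ^+ nth 0%N m i.
Proof. by []. Qed.

(** On the chart of nonzero top coefficient the locus is the image of the finite map from root
    tuples to coefficients. By [finite_image_closed] it is enough that every affine relation [h]
    among the coefficients holds at [v]. *)
Lemma root_locus_full_degree_closed d a m (A : {poly K}) (v : 'rV_d.+1) : 0%N \notin m ->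
  (size A <= a.+1)%N -> (a + sumn m)%N = d -> A`_a != 0 -> (rVpoly v)`_d != 0 ->
  zariski_closure (root_locus m A) v -> root_locus m A v.
Proof.
move=> m0 sA ad nA nv [nv0 Hv].
set x := fun k : 'I_d.+1 => ((rVpoly v)`_d)^-1 * v 0 k.
pose A1 := (A`_a)^-1 *: A.
have A1a : A1`_a = 1 by rewrite coefZ mulVf.
have sA1 : size A1 = a.+1.
  apply/eqP; rewrite eqn_leq (leq_trans (size_scale_leq _ _)) //= ltnNge; apply/negP.
  by move=> /leq_sizeP/(_ a (leqnn _))/eqP; rewrite A1a oner_eq0.
have monA1 : A1 \is monic by rewrite monicE lead_coefE sA1 A1a.
pose n := size m.
pose B : {poly {mpoly K[n]}} := map_poly (@mpolyC n K) A1.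
pose C : {poly {mpoly K[n]}} := \prod_(i < n) ('X - ('X_i)%:P) ^+ nth 0%N m i.
have [monC sC] := monic_prod_XsubC_exp (fun i : 'I_n => 'X_i : {mpoly K[n]}).
have monB : B \is monic by apply: monic_map.
have sB : size B = a.+1 by rewrite size_map_inj_poly // => c1 c2 /eqP; rewrite mpolyC_eq => /eqP.
have monG : B * C \is monic by rewrite monicMl.
have sG : size (B * C) = d.+1.
  by rewrite size_Mmonic ?monic_neq0 // sB [size C]sC -ad; lia.
pose phi := @coef_map_of K d n (B * C).
have evG (z : 'I_n -> K) : map_poly (meval z) (B * C) =
    A1 * \prod_(i < n) ('X - (z i)%:P) ^+ nth 0%N m i.
  rewrite rmorphM /=; congr (_ * _).
    by rewrite -map_poly_comp map_poly_id // => c _ /=; rewrite mevalC.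
  rewrite rmorph_prod; apply: eq_bigr => i _.
  by rewrite rmorphXn /= map_polyXsubC /= mevalXU.
have phi_int j : integralOver (pullback phi) 'X_j.
  apply: integral_of_root => //; rewrite /root hornerM horner_prod (bigD1 j) //=.
  have j0 : (0 < nth 0%N m j)%N.
    by rewrite lt0n; apply: contraNneq m0 => <-; apply: mem_nth.
  by rewrite horner_exp hornerXsubC subrr expr0n eqn0Ngt j0 mul0r mulr0.
have vd : v 0 ord_max = (rVpoly v)`_d by rewrite -coef_rVpoly_ord.
have [h /= ph|z Hz] := finite_image_closed phi_int (x0 := x).
  have [N [H [hH HE]]] := homogenize h.
  (* The extra factor covers the points of the locus with zero top coefficient, about which the
     affine relation says nothing. *)
  have : (H * 'X_ord_max).@[v 0] = 0.
    apply: Hv; split.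
      exists (N + 1)%N; apply: dhomogM => //; by rewrite dhomogX /= mdeg1.
    move=> w _ Aw; rewrite mevalM mevalXU.
    have [->|nw] := eqVneq (w 0 ord_max) 0; first by rewrite mulr0.
    have wd : w 0 ord_max = (rVpoly w)`_d by rewrite -coef_rVpoly_ord.
    rewrite wd in nw; have [_ [z wE]] := root_locus_monic m0 sA ad Aw nw.
    have -> : H.@[w 0] = H.@[fun k => (rVpoly w)`_d * (phi k).@[fun i : 'I_n => z i]].
      apply: meval_eq => k; rewrite -coef_rVpoly_ord {1}wE coefZ.
      by rewrite meval_coef_map evG lin_prod_ord.
    rewrite HE -?meval_pullback ?ph ?meval0 ?mulr0 ?mul0r //.
    rewrite /phi meval_coef_map evG -lin_prod_ord /= .
    have := congr1 (fun p : {poly K} => p`_d) wE; rewrite coefZ -{1}[LHS]mulr1.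
    by move/(mulfI nw) => <-.
  have -> : (H * 'X_ord_max).@[v 0] = (rVpoly v)`_d ^+ N * h.@[x] * (rVpoly v)`_d.
    rewrite mevalM mevalXU vd -HE /x ?vd ?mulVf //; congr (_ * _).
    by apply: meval_eq => k; rewrite mulrA divff // mul1r.
  by move/eqP; rewrite !mulf_eq0 expf_eq0 (negbTE nv) andbF orbF orFb => /eqP.
exists ((rVpoly v)`_d / A`_a), (fun i => 'X - (if insub i is Some j then z j else 0)%:P); split.
- by rewrite mulf_neq0 // invr_eq0.
- by move=> i; rewrite /is_linear_form polyXsubC_eq0 size_XsubC.
rewrite -scalerA scalerAl -/A1.
have -> : lin_prod m (fun i => 'X - (if insub i is Some j then z j else 0)%:P) =
    \prod_(i < n) ('X - (z i)%:P) ^+ nth 0%N m i.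
  by apply: eq_bigr => i _; rewrite valK.
rewrite -evG; apply/polyP => k.
have [kd|dk] := ltnP k d.+1; last first.
  rewrite nth_default ?(leq_trans (size_poly _ _)) // nth_default //.
  by rewrite (leq_trans (size_scale_leq _ _)) // (leq_trans (size_poly _ _)) // sG.
rewrite (coef_rVpoly_ord v (Ordinal kd)) coefZ.
have := Hz (Ordinal kd); rewrite meval_coef_map /= => ->.
by rewrite /x mulrA divff // mul1r.
Qed.

Lemma poly_pair_nonroot (F G : {poly K}) : F != 0 -> G != 0 ->
  exists c, F.[c] != 0 /\ G.[c] != 0.
Proof.
move=> nF nG; have [|c] := @poly_neq0_nonroot _ (F * G); first by rewrite mulf_neq0.
by rewrite hornerM mulf_eq0 negb_or => /andP[]; exists c.
Qed.

(** A value [c] that is a root neither of the point nor of [A] is moved to infinity; membership is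
    then decided in the chart of full degree and carried back. *)
Lemma root_locus_closureE d a m (A : {poly K}) : 0%N \notin m -> A != 0 ->
  (size A <= a.+1)%N -> (a + sumn m)%N = d ->
  zariski_closure (@root_locus K d m A) = root_locus m A.
Proof.
move=> m0 nA sA ad; apply/seteqP; split=> v; last first.
  by move=> Av; apply: sub_closure => //; apply: root_locus_neq0 Av.
move=> Cv; have [nv _] := Cv.
have nF : rVpoly v != 0 by apply: contra_neq nv => v0; apply: (can_inj rVpolyK); rewrite v0 linear0.
have [c [Fc Ac]] := poly_pair_nonroot nF nA.
set A' := subst a (fwdA c) 'X A.
have sA' : (size A' <= a.+1)%N by apply: size_subst; rewrite ?size_fwdA ?size_polyX.
have fwdP w : root_locus m A w -> root_locus m A' (w *m fwd_mx d c).
  exact: root_locus_fwd.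
have Cv' := closure_mulmx (fwd_unit d c) fwdP Cv.
have A'v' : root_locus m A' (v *m fwd_mx d c).
  apply: root_locus_full_degree_closed ad _ _ Cv' => //.
    by rewrite /A' fwd_top.
  by rewrite rVpoly_subst ?size_fwdA ?size_polyX // fwd_top // size_poly.
have := root_locus_bwd c sA' ad A'v'.
by rewrite /A' fwdK // -mulmxA fwd_mxK mulmx1.
Qed.

Lemma root_locus_closed d a m (A : {poly K}) : 0%N \notin m -> A != 0 ->
  (size A <= a.+1)%N -> (a + sumn m)%N = d -> zariski_closed (@root_locus K d m A).
Proof. by move=> m0 nA sA ad; rewrite -(root_locus_closureE m0 nA sA ad); apply: closure_closed. Qed.

Section Pencil.
Variables (d a : nat) (m : seq nat) (A : {poly K}).
Hypotheses (nA : A != 0) (sA : (size A <= a.+1)%N) (ad : (a + sumn m)%N = d).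
Variables (c c1 : K) (L M : nat -> {poly K}).
Hypotheses (nc : c != 0) (HL : forall i, is_linear_form (L i)).
Hypothesis sM : forall i, (size (M i) <= 2)%N.

(** A line in the space of parameters [(c, L)], whose image in [P^d] is in general not a line. With
    [M = L' - L] it joins two points of the locus; with a fixed family [M] it moves a point into
    general position. *)
Definition pencil s : 'rV[K]_d.+1 :=
  poly_rV ((c + s * c1) *: (A * lin_prod m (fun i => L i + s *: M i))).

Let sLM i s : (size (L i + s *: M i)%R <= 2)%N.
Proof.
rewrite (leq_trans (size_polyD _ _)) // geq_max (is_linear_formP (HL i)) /=.
exact: leq_trans (size_scale_leq _ _) (sM i).
Qed.

Lemma rVpoly_pencil s :
  rVpoly (pencil s) = (c + s * c1) *: (A * lin_prod m (fun i => L i + s *: M i)).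
Proof.
rewrite poly_rV_K // (leq_trans (size_scale_leq _ _)) // -ad size_mul_bound //.
by have [] := lin_prod_top m (fun i => sLM i s).
Qed.

Lemma polyfun_pencil k : polyfun (fun s => pencil s 0 k).
Proof.
have H : polyfun (fun s => ((c + s * c1) *: (A * lin_prod m (fun i => L i + s *: M i)))`_k).
  apply: ppolyfunZ.
    by apply: polyfunD; [apply: polyfunC | apply: polyfunM; [apply: polyfunX | apply: polyfunC]].
  apply: ppolyfunM; first exact: ppolyfunC.
  apply: ppolyfun_prod => i; apply: ppolyfun_exp; apply: ppolyfunD; first exact: ppolyfunC.
  by apply: ppolyfunZ; [apply: polyfunX | apply: ppolyfunC].
by apply: polyfun_ext H => s; rewrite mxE.
Qed.

Lemma polyfun_meval_pencil P : polyfun (fun s => P.@[pencil s 0]).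
Proof. by apply: polyfun_meval => k; apply: polyfun_pencil. Qed.

(** The linear forms of the pencil must stay nonzero: [g] multiplies the scalar by one coefficient
    of each form, chosen nonzero at [s = 0]. *)
Lemma pencil_root_locus : exists g, [/\ polyfun g, g 0 != 0 &
  forall s, g s != 0 -> root_locus m A (pencil s)].
Proof.
have kP i : exists k, (L i)`_k != 0.
  by exists (size (L i)).-1; rewrite -lead_coefE lead_coef_eq0; case/andP: (HL i).
pose k i := projT1 (cid (kP i)).
have kE i : (L i)`_(k i) != 0 by rewrite /k; case: cid.
exists (fun s => (c + s * c1) * \prod_(i < size m) ((L i)`_(k i) + s * (M i)`_(k i))); split.
- apply: polyfunM.
    by apply: polyfunD; [apply: polyfunC | apply: polyfunM; [apply: polyfunX | apply: polyfunC]].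
  apply: polyfun_prod => i; apply: polyfunD; first exact: polyfunC.
  by apply: polyfunM; [apply: polyfunX | apply: polyfunC].
- rewrite mul0r addr0 mulf_neq0 //; apply/prodf_neq0 => i _.
  by rewrite mul0r addr0.
- move=> s; rewrite mulf_eq0 negb_or => /andP[ns /prodf_neq0 nL].
  exists (c + s * c1), (fun i => if (i < size m)%N then L i + s *: M i else 1); split=> //.
    move=> i; case: ifP => im; last by rewrite /is_linear_form oner_neq0 size_poly1.
    rewrite /is_linear_form sLM andbT.
    have := nL (Ordinal im) isT; apply: contra_neq => /= LM0.
    by have := congr1 (fun p : {poly K} => p`_(k i)) LM0; rewrite coefD coefZ coef0.
  rewrite rVpoly_pencil; congr (_ *: (_ * _)); apply: eq_lin_prod => i ->//.
Qed.

End Pencil.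

(** Any two points of the locus are joined by a pencil whose general member lies in it. Two forms
    whose product vanishes along the pencil cannot both be nonzero polynomials in the parameter. *)
Lemma root_locus_irreducible d a m (A : {poly K}) : 0%N \notin m -> A != 0 ->
  (size A <= a.+1)%N -> (a + sumn m)%N = d -> irreducible_closed (@root_locus K d m A).
Proof.
move=> m0 nA sA ad; split; first exact: root_locus_closed sA ad.
  pose v : 'rV[K]_d.+1 := poly_rV (1 *: (A * lin_prod m (fun=> 1))).
  exists v, 1, (fun=> 1); split; first exact: oner_neq0.
    by move=> i; rewrite /is_linear_form oner_neq0 size_poly1.
  rewrite poly_rV_K // scale1r -ad size_mul_bound //.
  by have [] := @lin_prod_top K m (fun=> 1) (fun=> leqW (eq_leq (size_poly1 _))).
move=> X Y cX cY ZXY; apply: contrapT => /not_orP[nX nY].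
have Z0 v : root_locus m A v -> v != 0 :> 'rV_d.+1 by apply: root_locus_neq0.
have [P XP [v Zv Pv]] := closed_separation cX Z0 nX.
have [Q YQ [w Zw Qw]] := closed_separation cY Z0 nY.
have [c [L [nc HL vE]]] := Zv; have [c' [L' [nc' HL' wE]]] := Zw.
pose M i := L' i - L i.
have sM i : (size (M i) <= 2)%N.
  rewrite (leq_trans (size_polyD _ _)) // geq_max size_polyN.
  by rewrite (is_linear_formP (HL i)) (is_linear_formP (HL' i)).
pose gam := pencil d m A c (c' - c) L M.
have [g [pg g0 gZ]] := @pencil_root_locus d a m A sA ad c (c' - c) L M nc HL sM.
have gam0 : gam 0 = v.
  apply: (can_inj rVpolyK); rewrite (rVpoly_pencil sA ad) // vE mul0r addr0.
  by congr (_ *: (_ * _)); apply: eq_lin_prod => i _; rewrite scale0r addr0.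
have gam1 : gam 1 = w.
  apply: (can_inj rVpolyK); rewrite (rVpoly_pencil sA ad) // wE mul1r addrC subrK.
  by congr (_ *: (_ * _)); apply: eq_lin_prod => i _; rewrite scale1r addrC subrK.
have [p pE] := @polyfun_meval_pencil d m A c (c' - c) L M P.
have [q qE] := @polyfun_meval_pencil d m A c (c' - c) L M Q.
have PQ0 s : P.@[gam s 0] * Q.@[gam s 0] = 0.
  move: s; apply: (polyfun_density (f := fun s => P.@[gam s 0] * Q.@[gam s 0]) _ pg g0).
    by apply: polyfunM; apply: polyfun_meval_pencil.
  move=> s /gZ Zs; have ns := Z0 _ Zs.
  case: (ZXY _ Zs) => [Xs|Ys]; first by rewrite XP.2 ?mul0r.
  by rewrite YQ.2 ?mulr0.
have : p * q = 0 by apply: poly_all_eq0 => s; rewrite hornerM -pE -qE PQ0.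
move/eqP; rewrite mulf_eq0 => /orP[]/eqP r0.
  by move: Pv; rewrite -gam0 pE r0 horner0 eqxx.
by move: Qw; rewrite -gam1 qE r0 horner0 eqxx.
Qed.

Lemma nat_nonroots (F : {poly K}) : F != 0 -> exists N, forall n, (N <= n)%N -> F.[n%:R] != 0.
Proof.
move=> nF; have [r rE] := closed_field_poly_normal F.
suff [N HN] : exists N, forall n, (N <= n)%N -> (n%:R : K) \notin r.
  exists N => n Nn; rewrite rE hornerZ mulf_neq0 ?lead_coef_eq0 // horner_prod prodf_seq_neq0.
  by apply/allP => z zr /=; rewrite hornerXsubC subr_eq0; apply: contraNneq (HN n Nn) => ->.
elim: r {rE} => [|z r [N HN]]; first by exists 0%N.
have [[n0 n0z]|nz] := pselect (exists n0, n0%:R = z :> K).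
  exists (maxn N n0.+1) => n; rewrite geq_max => /andP[Nn n0n].
  by rewrite inE negb_or HN // andbT -n0z eqr_nat gtn_eqF.
exists N => n Nn; rewrite inE negb_or HN // andbT.
by apply/eqP => nE; apply: nz; exists n.
Qed.

Lemma lin_prod_linear_root m (L : nat -> {poly K}) x :
  (lin_prod m L).[x] = 0 -> (\prod_(i < size m) L i).[x] = 0.
Proof.
rewrite !horner_prod => /eqP/prodf_eq0[i _]; rewrite horner_exp expf_eq0 => /andP[_ /eqP Li].
by apply/eqP/prodf_eq0; exists i => //; rewrite Li.
Qed.

Lemma lin_prod_root m (L : nat -> {poly K}) x i :
  (i < size m)%N -> nth 0%N m i != 0%N -> (L i).[x] = 0 -> (lin_prod m L).[x] = 0.
Proof.
move=> im mi Li; rewrite horner_prod; apply/eqP/prodf_eq0; exists (Ordinal im) => //=.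
by rewrite horner_exp Li expr0n (negbTE mi).
Qed.

(** In [C j] the first [j] roots are free and the others stay those of [p], so [C 0] is the point
    [p] and the last member is the whole locus. The inclusions are strict because a member of [C j]
    cannot have [j + 1] distinct roots away from the roots of [p]. *)
Lemma local_chain d lam (X : set 'rV[K]_d.+1) p : 0%N \notin lam -> sumn lam = d ->
  root_locus lam 1 `<=` X -> root_locus lam 1 p ->
  exists C, irreducible_chain X p (size lam) C.
Proof.
move=> lam0 sd lamX [c [L [nc HL pE]]].
pose R j := lin_prod (drop j lam) (fun i => L (j + i)%N).
pose C j := @root_locus K d (take j lam) (R j).
have nR j : R j != 0 by apply: lin_prod_neq0.
have sR j : (size (R j) <= (sumn (drop j lam)).+1)%N.
  by have [] := @lin_prod_top K (drop j lam) (fun i => L (j + i)%N) (fun i => is_linear_formP (HL _)).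
have sumj j : (sumn (drop j lam) + sumn (take j lam))%N = d.
  by rewrite addnC -sumn_cat cat_take_drop.
have takeS j : (j < size lam)%N -> take j.+1 lam = take j lam ++ [:: nth 0%N lam j].
  by move=> jl; rewrite (take_nth 0%N jl) cats1.
have RS j : (j < size lam)%N -> R j = L j ^+ nth 0%N lam j * R j.+1.
  move=> jl; rewrite /R (drop_nth 0%N jl) lin_prod_cons addn0; congr (_ * _).
  by apply: eq_lin_prod => i _; rewrite addSnnS.
exists C; split.
- move=> j _; apply: root_locus_irreducible (nR j) (sR j) (sumj j).
  by apply: contra lam0 => /mem_take.
- move=> j jl; split.
    move=> v [c' [L' [nc' HL' vE]]].
    exists c', (fun i => if (i < j)%N then L' i else L i); split=> //.
      by move=> i; case: ifP.
    rewrite vE RS // takeS // lin_prod_cat lin_prod_cons lin_prod_nil mulr1.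
    rewrite size_take jl addn0 ltnn.
    have -> : lin_prod (take j lam) (fun i => if (i < j)%N then L' i else L i) =
        lin_prod (take j lam) L'.
      by apply: eq_lin_prod => i; rewrite size_take jl => ->.
    move: (L j ^+ _) (R _) (lin_prod _ _) => x y z.
    by rewrite [x * y]mulrC -mulrA [x * z]mulrC.
  move=> CC.
  have [N HN] := nat_nonroots (lin_prod_neq0 lam HL).
  (* Consecutive integers from [N] on: pairwise distinct, and none of them a root of [p]. *)
  pose w i : K := (N + i)%:R.
  have Rw k i : (R k).[w i] != 0.
    have := HN (N + i)%N (leq_addr _ _).
    have [kl|lk] := leqP k (size lam).
      rewrite -[lam](cat_take_drop k) lin_prod_cat hornerM mulf_eq0 negb_or.
      rewrite size_take; case: ltnP => [_ /andP[]//|lk /andP[_]].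
      by rewrite (_ : size lam = k) //; apply/eqP; rewrite eqn_leq lk.
    by rewrite /R drop_oversize ?(ltnW lk) // lin_prod_nil hornerC oner_neq0.
  pose v : 'rV[K]_d.+1 := poly_rV (R j.+1 * lin_prod (take j.+1 lam) (fun i => 'X - (w i)%:P)).
  have vE : rVpoly v = R j.+1 * lin_prod (take j.+1 lam) (fun i => 'X - (w i)%:P).
    rewrite poly_rV_K // -(sumj j.+1) size_mul_bound //.
    by have [] := @lin_prod_top K (take j.+1 lam) (fun i => 'X - (w i)%:P) (fun i => eq_leq (size_XsubC _)).
  have /CC[c' [L' [nc' HL' vE']]] : C j.+1 v.
    exists 1, (fun i => 'X - (w i)%:P); rewrite oner_neq0 scale1r; split=> //.
    by move=> i; rewrite /is_linear_form polyXsubC_eq0 size_XsubC.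
  pose Q : {poly K} := \prod_(i < j) L' i.
  have nQ : Q != 0 by apply/prodf_neq0 => i _; case/andP: (HL' i).
  have sQ : (size Q <= j.+1)%N.
    have [] := @prod_top _ _ (index_enum 'I_j) xpredT (fun i : 'I_j => L' i) (fun=> 1%N).
      by move=> i; apply: is_linear_formP.
    by rewrite sum1_card card_ord.
  have sT : (size (take j.+1 lam) = j.+1) by rewrite size_take_min (minn_idPl jl).
  have ltj : (nth 0%N (take j.+1 lam)) =1 (fun i => if (i < j.+1)%N then nth 0%N lam i else 0%N).
    move=> i; case: ltnP => ij; first by rewrite nth_take.
    by rewrite nth_default // sT.
  have rQ : all (root Q) [seq w i | i <- iota 0 j.+1].
    apply/allP => _ /mapP[i ii ->]; move: ii; rewrite mem_iota add0n => /andP[_ ij].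
    apply/rootP; have := congr1 (fun p : {poly K} => p.[w i]) vE'.
    have r0 : (lin_prod (take j.+1 lam) (fun i => 'X - (w i)%:P)).[w i] = 0.
      apply: (@lin_prod_root _ _ _ i); first by rewrite sT.
        rewrite ltj ij; apply: contraNneq lam0 => <-; apply: mem_nth.
        exact: leq_trans ij jl.
      by rewrite hornerXsubC subrr.
    rewrite vE !(hornerM, hornerZ) r0.
    rewrite mulr0 => /esym/eqP; rewrite !mulf_eq0 (negbTE nc') (negbTE (Rw _ _)) /=.
    by move/eqP/lin_prod_linear_root; rewrite size_takel // ltnW.
  have := max_poly_roots nQ rQ; rewrite size_map size_iota ltnNge sQ => /(_ _)/negP; apply=> //.
  rewrite map_inj_uniq ?iota_uniq // => i1 i2 /eqP; rewrite eqr_nat eqn_add2l => /eqP //.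
- exists c, (fun=> 1); split=> //.
    by move=> i; rewrite /is_linear_form oner_neq0 size_poly1.
  by rewrite pE take0 lin_prod_nil mulr1 mul1r /R drop0.
- by rewrite /C /R take_size drop_size lin_prod_nil.
Qed.

End RootLocusClosed.

(** * The dimension bound *)

Section IndependentForms.
Variables (K : numClosedFieldType) (n : nat).
Implicit Types (X Z : set 'rV[K]_n.+1) (p v : 'rV[K]_n.+1) (P : {mpoly K[n.+1]}).

(** Independence modulo the ideal of [X]: such a family bounds the Hilbert function of [X] in degree
    [t] from below by [#|I|]. *)
Definition independent_on X (t : nat) (I : finType) (Q : I -> {mpoly K[n.+1]}) : Prop :=
  (forall i, Q i \is t.-homog) /\
  forall c : I -> K, (forall v, v != 0 -> X v -> (\sum_i c i *: Q i).@[v 0] = 0) ->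
    forall i, c i = 0.

Lemma irreducible_prime Z F G (k l : nat) : irreducible_closed Z ->
  F \is k.-homog -> G \is l.-homog ->
  (forall v, v != 0 -> Z v -> F.@[v 0] * G.@[v 0] = 0) ->
  (forall v, v != 0 -> Z v -> F.@[v 0] = 0) \/ (forall v, v != 0 -> Z v -> G.@[v 0] = 0).
Proof.
move=> [[S [_ ZE]] _ irr] hF hG FG.
pose A (H : {mpoly K[n.+1]}) : set 'rV[K]_n.+1 := zero_locus [set H].
have cA H j : H \is j.-homog -> zariski_closed (A H).
  by move=> hH; exists [set H]; split=> // _ ->; exists j.
have Z0 v : Z v -> v != 0 by rewrite ZE => -[].
have [v Zv|ZA|ZA] := irr _ _ (cA F k hF) (cA G l hG).
- have nv := Z0 v Zv; have /eqP := FG v nv Zv; rewrite mulf_eq0 => /orP[]/eqP H0.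
    by left; split=> // _ ->.
  by right; split=> // _ ->.
- by left=> v _ /ZA[_]; apply.
- by right=> v _ /ZA[_]; apply.
Qed.

(** A form [P] of degree [e] that vanishes on [Z] but not on [Z'], and a coordinate [x] nonzero at
    [p], give the forms [P^j x^(e(J-j)) Q_i], all of one degree. In a relation on [Z'], restriction
    to [Z] leaves the terms with [j = 0], whose coefficients vanish because [x] is not zero on [Z];
    the rest is divisible by [P], which can be cancelled on the irreducible [Z']. *)
Lemma independent_step Z Z' p : irreducible_closed Z -> irreducible_closed Z' ->
  Z `<` Z' -> Z p ->
  exists e, forall J t (I : finType) (Q : I -> {mpoly K[n.+1]}), independent_on Z t Q ->
    exists Q' : 'I_J.+1 * I -> {mpoly K[n.+1]}, independent_on Z' (J * e + t) Q'.
Proof.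
move=> irrZ irrZ' [ZZ' nZ'Z] Zp.
have [[S [hS Z'E]] _ _] := irrZ'.
have Z'0 v : Z' v -> v != 0 by rewrite Z'E => -[].
have [P [[e hP] PZ] [w Z'w Pw]] := closed_separation (let: And3 a _ _ := irrZ in a) Z'0 nZ'Z.
have np : p != 0 by apply/Z'0/ZZ'.
have [k pk] : exists k, p 0 k != 0.
  apply: contrapT => none; case/eqP: np; apply/rowP => k; rewrite mxE.
  by apply: contrapT => /eqP pk; apply: none; exists k.
pose x : {mpoly K[n.+1]} := 'X_k.
have hx j : x ^+ j \is j.-homog.
  by rewrite -[X in X.-homog]mul1n; apply: dhomogMn; rewrite dhomogX /= mdeg1.
exists e => J t I Q [hQ indQ].
pose R (c : nat -> I -> K) j : {mpoly K[n.+1]} := \sum_i c j i *: Q i.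
pose T c J := \sum_(j < J.+1) P ^+ j * x ^+ (e * (J - j)) * R c j.
have hR c j : R c j \is t.-homog by apply: homog_sum => i _; apply: dhomogZ.
have hT c l : T c l \is (l * e + t).-homog.
  apply: homog_sum => j _; apply: dhomogM => //.
  have -> : (l * e = e * j + e * (l - j))%N.
    by rewrite -mulnDr subnKC ?(mulnC e) // -ltnS.
  by apply: dhomogM => //; apply: dhomogMn.
have key l c : (forall v, v != 0 -> Z' v -> (T c l).@[v 0] = 0) ->
    forall j i, (j <= l)%N -> c j i = 0.
  elim: l c => [|l IH] c Tc.
    move=> j i; rewrite leqn0 => /eqP ->; apply: indQ => v nv /ZZ' Z'v.
    by rewrite -[RHS](Tc v nv Z'v) /T big_ord1 expr0 mul1r muln0 expr0 mul1r.
  have c0 i : c 0%N i = 0.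
    have [|xZ|RZ] := irreducible_prime irrZ (hx (e * l.+1)%N) (hR c 0%N).
    - move=> v nv Zv; rewrite -[RHS](Tc v nv (ZZ' v Zv)) /T big_ord_recl rmorphD /=.
      rewrite expr0 mul1r subn0 mevalM [X in _ = _ + X](_ : _ = 0) ?addr0 //.
      rewrite rmorph_sum /= big1 // => j _.
      by rewrite !mevalM rmorphXn /= PZ // expr0n /= !mul0r.
    - by have /eqP := xZ p np Zp; rewrite rmorphXn /= mevalXU expf_eq0 (negbTE pk) andbF.
    - exact: indQ RZ i.
  have R0 : R c 0%N = 0 by rewrite /R big1 // => i _; rewrite c0 scale0r.
  have TS : T c l.+1 = P * T (fun j => c j.+1) l.
    rewrite /T big_ord_recl R0 mulr0 add0r mulr_sumr; apply: eq_bigr => j _.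
    by rewrite /= /bump /= add1n exprS subSS !mulrA.
  have [v nv Z'v|PZ'|TZ'] := irreducible_prime irrZ' hP (hT (fun j => c j.+1) l).
  - by rewrite -mevalM -TS Tc.
  - by move: Pw; rewrite (PZ' w (Z'0 w Z'w) Z'w) eqxx.
  - by move=> [|j] i; [rewrite c0 | rewrite ltnS; apply: IH TZ' _ _].
exists (fun ji : 'I_J.+1 * I => P ^+ ji.1 * x ^+ (e * (J - ji.1)) * Q ji.2); split.
  move=> [j i] /=; apply: dhomogM => //.
  have -> : (J * e = e * j + e * (J - j))%N.
    by rewrite -mulnDr subnKC ?(mulnC e) // -ltnS.
  by apply: dhomogM => //; apply: dhomogMn.
move=> c Hc [j i].
pose c' (j : nat) i := c (inord j, i).
have -> : c (j, i) = c' j i by rewrite /c' inord_val.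
apply: (key J) => [v nv Z'v|]; last by rewrite -ltnS.
rewrite -[RHS](Hc v nv Z'v); congr (_.@[_]).
rewrite (eq_bigr (fun ji : 'I_J.+1 * I => c (ji.1, ji.2) *:
  (P ^+ ji.1 * x ^+ (e * (J - ji.1)) * Q ji.2))); last by case.
rewrite -(pair_bigA _ (fun (j : 'I_J.+1) i => c (j, i) *: (P ^+ j * x ^+ (e * (J - j)) * Q i))) /=.
apply: eq_bigr => l _; rewrite mulr_sumr; apply: eq_bigr => i' _.
by rewrite /c' inord_val -scalerAr.
Qed.

Lemma chain_independent X p k C : irreducible_chain X p k C ->
  exists E, forall J, exists (I : finType) (Q : I -> {mpoly K[n.+1]}),
    #|I| = (J.+1 ^ k)%N /\ independent_on X (J * E) Q.
Proof.
move=> [irrC CS C0p CkX].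
have CiS i : (i <= k)%N -> C i p.
  by elim: i => // i IH ik; apply: (CS i ik).1; apply: IH; apply: ltnW.
have [E HE] : exists E, forall J, exists (I : finType) (Q : I -> {mpoly K[n.+1]}),
    #|I| = (J.+1 ^ k)%N /\ independent_on (C k) (J * E) Q.
  have : (k <= k)%N by [].
  elim: {1 3 4}k => [_|i IH ik].
    exists 0%N => J; exists unit, (fun=> 1); rewrite card_unit; split=> //; split.
      by move=> _; rewrite muln0 dhomog1.
    move=> c Hc []; have := Hc p.
    rewrite (big_pred1 tt) => [|[]] //; rewrite mevalZ meval1 mulr1; apply=> //.
    by have [[S [_ SE]] _ _] := irrC 0%N (leq0n k); move: C0p; rewrite SE => -[].
  have [E HE] := IH (ltnW ik).
  have [e He] := independent_step (irrC i (ltnW ik)) (irrC i.+1 ik) (CS i ik) (CiS i (ltnW ik)).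
  exists (e + E)%N => J; have [I [Q [cI indQ]]] := HE J.
  have [Q' indQ'] := He J _ _ _ indQ.
  exists ('I_J.+1 * I)%type, Q'; rewrite card_prod card_ord cI expnS mulnDr; split=> //.
exists E => J; have [I [Q [cI [hQ indQ]]]] := HE J; exists I, Q; split=> //; split=> // c Hc.
by apply: indQ => v nv Cv; apply: Hc => //; apply: CkX.
Qed.

End IndependentForms.

Section DegreeBound.
Variables (R : idomainType) (n : nat).
Implicit Types p q : {mpoly R[n]}.

Lemma msizeM_bound a b p q : (msize p <= a.+1)%N -> (msize q <= b.+1)%N ->
  (msize (p * q)%R <= (a + b).+1)%N.
Proof.
move=> sp sq; have [->|np] := eqVneq p 0; first by rewrite mul0r msize0.
have [->|nq] := eqVneq q 0; first by rewrite mulr0 msize0.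
by rewrite msizeM //; lia.
Qed.

Lemma msize_sum_bound a (J : Type) (r : seq J) (P : pred J) (F : J -> {mpoly R[n]}) :
  (forall j, P j -> msize (F j) <= a)%N -> (msize (\sum_(j <- r | P j) F j)%R <= a)%N.
Proof.
move=> HF; apply: (big_ind (fun p => msize p <= a)%N) => //; first by rewrite msize0.
by move=> p q sp sq; rewrite (leq_trans (msizeD_le _ _)) // geq_max sp.
Qed.

Lemma msize_prod_bound (J : Type) (r : seq J) (P : pred J) (F : J -> {mpoly R[n]}) (a : J -> nat) :
  (forall j, msize (F j) <= (a j).+1)%N ->
  (msize (\prod_(j <- r | P j) F j)%R <= (\sum_(j <- r | P j) a j).+1)%N.
Proof.
move=> HF; elim/big_rec2: _ => [|j y1 y2 _ Hy]; first by rewrite msize1.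
exact: msizeM_bound.
Qed.

Lemma msize_exp_bound a k p : (msize p <= a.+1)%N -> (msize (p ^+ k)%R <= (a * k).+1)%N.
Proof.
move=> sp; elim: k => [|k IH]; first by rewrite expr0 msize1.
by rewrite exprS mulnS; apply: msizeM_bound.
Qed.

Definition coef_bound a (F : {poly {mpoly R[n]}}) := forall k, (msize F`_k <= a.+1)%N.

Lemma coef_boundM a b F G : coef_bound a F -> coef_bound b G -> coef_bound (a + b) (F * G).
Proof.
by move=> HF HG k; rewrite coefM; apply: msize_sum_bound => i _; apply: msizeM_bound.
Qed.

Lemma coef_bound1 : coef_bound 0 1.
Proof. by move=> k; rewrite coef1; case: k => [|k]; rewrite ?msize1 ?msize0. Qed.

Lemma coef_bound_exp a k F : coef_bound a F -> coef_bound (a * k) (F ^+ k).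
Proof.
move=> HF; elim: k => [|k IH]; first by rewrite expr0 muln0; apply: coef_bound1.
by rewrite exprS mulnS; apply: coef_boundM.
Qed.

Lemma coef_bound_prod (J : Type) (r : seq J) (F : J -> {poly {mpoly R[n]}}) (a : J -> nat) :
  (forall j, coef_bound (a j) (F j)) -> coef_bound (\sum_(j <- r) a j) (\prod_(j <- r) F j).
Proof.
move=> HF; elim/big_rec2: _ => [|j y1 y2 _ Hy]; first exact: coef_bound1.
exact: coef_boundM.
Qed.

Lemma card_bmultinom_leq b : (#|{: 'X_{1..n < b}}| <= b ^ n)%N.
Proof.
have mb (m : 'X_{1..n < b}) (i : 'I_n) : (m i < b)%N.
  rewrite (leq_ltn_trans _ (bmdeg m)) // mdegE (bigD1 i) //= leq_addr //.
pose f (m : 'X_{1..n < b}) : {ffun 'I_n -> 'I_b} := [ffun i => Ordinal (mb m i)].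
have injf : injective f.
  move=> m1 m2 /ffunP fm; apply/eqP; rewrite bmeqP; apply/eqP/mnmP => i.
  by have := fm i; rewrite !ffunE => -[].
by have := leq_card f injf; rewrite card_ffun !card_ord.
Qed.

End DegreeBound.

Section DimensionBound.
Variables (K : numClosedFieldType) (d : nat) (lam : seq nat).
Hypotheses (lam0 : 0%N \notin lam) (sd : sumn lam = d).

(** Adding [s X] to every linear form makes all leading coefficients nonzero for general [s], so a
    point with roots at infinity lies on a pencil whose general member has none. *)
Lemma root_locus_full_degree_dense (P : {mpoly K[d.+1]}) :
  (forall c (z : nat -> K), c != 0 -> P.@[(poly_rV (c *: lin_prod lam (fun i => 'X - (z i)%:P)) : 'rV_d.+1) 0] = 0) ->
  forall v, root_locus lam 1 v -> P.@[v 0] = 0.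
Proof.
move=> H v [c [L [nc HL vE]]].
pose M (i : nat) : {poly K} := 'X.
have sM i : (size (M i) <= 2)%N by rewrite size_polyX.
have s1 : (size (1%R : {poly K}) <= 1)%N by rewrite size_poly1.
pose g s := \prod_(i < size lam) ((L i)`_1 + s * 1).
pose f s := P.@[pencil d lam 1 c 0 L M s 0].
have pf : polyfun f by apply: polyfun_meval_pencil.
have pg : polyfun g.
  apply: polyfun_prod => i; apply: polyfunD; first exact: polyfunC.
  by apply: polyfunM; [apply: polyfunX | apply: polyfunC].
have [s0 gs0] : exists s0, g s0 != 0.
  have [||s Hs] := @polyfun_seq_neq0 K _ (index_enum 'I_(size lam)) (fun i s => (L i)`_1 + s * 1).
  - move=> i _; apply: polyfunD; first exact: polyfunC.
    by apply: polyfunM; [apply: polyfunX | apply: polyfunC].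
  - by move=> i _; exists (1 - (L i)`_1); rewrite mulr1 addrC subrK oner_eq0.
  by exists s; apply/prodf_neq0 => i _; apply: Hs; rewrite mem_index_enum.
have rV s := @rVpoly_pencil _ d 0 lam 1 s1 sd c 0 L M HL sM s.
have fg s : g s != 0 -> f s = 0.
  move=> gs; have gi i : (i < size lam)%N -> (L i)`_1 + s != 0.
    move=> il; move: gs => /prodf_neq0/(_ (Ordinal il) isT) /=; by rewrite mulr1.
  rewrite -(H (c * \prod_(i < size lam) ((L i)`_1 + s) ^+ nth 0%N lam i)
    (fun i => - ((L i)`_0 / ((L i)`_1 + s)))); last first.
    by rewrite mulf_neq0 //; apply/prodf_neq0 => i _; rewrite expf_neq0 ?gi.
  rewrite /f; congr (_.@[fun_of_matrix _ 0]); apply: (can_inj rVpolyK); rewrite rV mulr0 addr0 mul1r.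
  rewrite -scalerA /lin_prod -scaler_prod.
  have e (i : 'I_(size lam)) : ((L i)`_1 + s) ^+ nth 0%N lam i *:
      ('X - (- ((L i)`_0 / ((L i)`_1 + s)))%:P) ^+ nth 0%N lam i = (L i + s *: M i) ^+ nth 0%N lam i.
    rewrite -exprZn; congr (_ ^+ _); have nb := gi i (ltn_ord i).
    apply/polyP => k; rewrite coefZ coefB coefD coefZ /M coefX coefC.
    case: k => [|[|k]] /=.
    - by rewrite sub0r opprK mulrC divfK // mulr0 addr0.
    - by rewrite subr0 mulr1 mulr1.
    - have -> : (L i)`_k.+2 = 0 by apply: nth_default; apply: leq_trans (is_linear_formP (HL i)) _.
      by rewrite subrr !mulr0 addr0.
  under [in RHS]eq_bigr => i _ do rewrite e.
  rewrite poly_rV_K // (leq_trans (size_scale_leq _ _)) //.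
  rewrite -sd; have [] // := @lin_prod_top K lam (fun i => L i + s *: M i).
  move=> i; rewrite (leq_trans (size_polyD _ _)) // geq_max (is_linear_formP (HL i)) /=.
  exact: leq_trans (size_scale_leq _ _) (sM i).
have := polyfun_density pf pg gs0 fg 0; rewrite /f => <-.
congr (_.@[fun_of_matrix _ 0]); apply: (can_inj rVpolyK); rewrite rV vE mul0r addr0.
by congr (_ *: (_ * _)); apply: eq_lin_prod => i _; rewrite scale0r addr0.
Qed.

(** A form that pulls back to 0 in the root coordinates vanishes on the locus, so pullback is
    injective on the span of the family. A form of degree [t] becomes a polynomial of degree at most
    [t d] in [size lam] variables, and the bound is a crude count of monomials. *)
Lemma independent_card (t : nat) (I : finType) (Q : I -> {mpoly K[d.+1]}) :
  independent_on (zariski_closure (root_locus lam 1)) t Q ->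
  (#|I| <= (t * d).+1 ^ size lam)%N.
Proof.
move=> [hQ indQ].
pose n := size lam.
pose Gam : {poly {mpoly K[n]}} := \prod_(i < n) ('X - ('X_i)%:P) ^+ nth 0%N lam i.
pose phi := @coef_map_of K d n Gam.
have evG (z : 'I_n -> K) :
    map_poly (meval z) Gam = \prod_(i < n) ('X - (z i)%:P) ^+ nth 0%N lam i.
  rewrite rmorph_prod; apply: eq_bigr => i _.
  by rewrite rmorphXn /= map_polyXsubC /= mevalXU.
have Gb : coef_bound d Gam.
  have := @coef_bound_prod _ n _ (index_enum 'I_n)
    (fun i => ('X - ('X_i)%:P) ^+ nth 0%N lam i) (fun i => nth 0%N lam i).
  rewrite sum_nth sd; apply=> i; rewrite -[X in coef_bound X]mul1n.
  apply: coef_bound_exp => k; rewrite coefB coefX coefC.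
  rewrite (leq_trans (msizeD_le _ _)) // msizeN geq_max; apply/andP; split.
    by case: eqP => _; rewrite ?msize1 ?msize0.
  by case: eqP => _; rewrite ?msizeX ?mdeg1 ?msize0.
have sQ i : (msize (pullback phi (Q i)) <= (t * d).+1)%N.
  rewrite /pullback /mmap big_seq; apply: msize_sum_bound => m mQ.
  rewrite mul_mpolyC (leq_trans (msizeZ_le _ _)) //.
  have /dhomogP/(_ m mQ) /= <- := hQ i.
  rewrite mdegE big_distrl /=; apply: msize_prod_bound => k.
  by rewrite mulnC; apply: msize_exp_bound; apply: Gb.
pose W : 'M[K]_(#|I|, #|{: 'X_{1..n < (t * d).+1}}|) :=
  \matrix_(i, m) (pullback phi (Q (enum_val i)))@_(enum_val m : 'X_{1..n < (t * d).+1}).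
apply: leq_trans (card_bmultinom_leq n (t * d).+1).
suff : row_free W by rewrite /row_free => /eqP <-; apply: rank_leq_col.
apply: row_free_inj => u uW.
pose c i := u 0 (enum_rank i).
pose G := \sum_i c i *: Q i.
have hG : G \is t.-homog by apply: homog_sum => i _; apply: dhomogZ.
have G0 : pullback phi G = 0.
  have GE : pullback phi G = \sum_i c i *: pullback phi (Q i).
    rewrite rmorph_sum; apply: eq_bigr => i _ /=.
    by rewrite -mul_mpolyC rmorphM /= pullbackC mul_mpolyC.
  apply/mpolyP => m; rewrite mcoeff0.
  have [mb|bm] := ltnP (mdeg m) (t * d).+1; last first.
    rewrite GE raddf_sum big1 // => i _ /=; rewrite mcoeffZ.
    by rewrite memN_msupp_eq0 ?mulr0 //; apply: msize_mdeg_ge; apply: leq_trans (sQ i) bm.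
  have /rowP/(_ (enum_rank (BMultinom mb))) := uW; rewrite !mxE => uWm.
  rewrite GE raddf_sum -[RHS]uWm (reindex _ (onW_bij _ (enum_val_bij I))) /=.
  by apply: eq_bigr => i _; rewrite mcoeffZ /c enum_valK !mxE enum_rankK.
apply/rowP => i; rewrite mxE -(enum_valK i); apply: (indQ c) => v nv [_ Xv].
apply: Xv; split; first by exists t.
move=> w _; apply: root_locus_full_degree_dense => a z na.
have -> : G.@[(poly_rV (a *: lin_prod lam (fun i => 'X - (z i)%:P)) : 'rV_d.+1) 0] =
    a ^+ t * G.@[fun k => (phi k).@[fun i : 'I_n => z i]].
  rewrite -(homog_meval _ _ hG); apply: meval_eq => k; rewrite mxE coefZ meval_coef_map.
  by rewrite evG.
by rewrite -meval_pullback G0 meval0 mulr0.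
Qed.

(* A chain of length [k] gives [(J + 1) ^ k] independent forms of degree linear in
   [J]; in the [size lam] root coordinates they span a space of dimension
   O([J ^ size lam]). *)
Lemma chain_length_leq p k C :
  irreducible_chain (zariski_closure (@root_locus K d lam 1)) p k C -> (k <= size lam)%N.
Proof.
move=> /chain_independent[E HE]; rewrite leqNgt; apply/negP => lk.
(* With [l] for [size lam] and [J = D^l], one has [(J E d + 1)^l <= (J + 1)^l D^l < (J + 1)^(l + 1)
   <= (J + 1)^k], which contradicts [independent_card]. *)
pose D := (E * d).+1.
pose J := (D ^ size lam)%N.
have [I [Q [cI /independent_card]]] := HE J; rewrite cI; apply/negP; rewrite -ltnNge.
have b1 : ((J * E * d).+1 <= J.+1 * D)%N by rewrite /D; nia.
have b2 : ((J * E * d).+1 ^ size lam <= (J.+1 * D) ^ size lam)%N.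
  by case: (posnP (size lam)) => [->//|l0]; rewrite leq_exp2r.
apply: (leq_ltn_trans b2); rewrite expnMn -/J.
have J0 : (0 < J)%N by rewrite expn_gt0.
apply: (@leq_trans (J.+1 ^ (size lam).+1)); last by rewrite leq_exp2l.
by rewrite expnSr ltn_mul2l expn_gt0 /=.
Qed.

End DimensionBound.

(** * Tangent vectors to root loci *)

Lemma dvd_Xn (K : fieldType) k (q : {poly K}) :
  (forall j, (j < k)%N -> q`_j = 0) -> 'X^k %| q.
Proof.
move=> q0; rewrite -(poly_take_drop k q) [take_poly k q](_ : _ = 0) ?add0r ?dvdp_mulIr //.
by apply/polyP => j; rewrite coef_take_poly coef0; case: ifP => // /q0.
Qed.

Section TangentArcs.
Variables (K : numClosedFieldType) (d : nat).
Implicit Types (Z : set 'rV[K]_d.+1) (p v : 'rV[K]_d.+1).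

Lemma tangentD Z p v w : tangent_cone_space Z p v -> tangent_cone_space Z p w ->
  tangent_cone_space Z p (v + w).
Proof.
move=> Tv Tw P ZP; under eq_bigr => i _ do rewrite mxE mulrDr.
by rewrite big_split /= Tv // Tw // addr0.
Qed.

Lemma tangentZ Z p v c : tangent_cone_space Z p v -> tangent_cone_space Z p (c *: v).
Proof.
move=> Tv P ZP; under eq_bigr => i _ do rewrite mxE mulrCA.
by rewrite -mulr_sumr Tv // mulr0.
Qed.

Lemma tangent_closure Z p v :
  tangent_cone_space (zariski_closure Z) p v <-> tangent_cone_space Z p v.
Proof. by split=> Tv P /hom_ideal_closure; apply: Tv. Qed.

(* The outer variable of [F] is the parameter of the arc. *)
Lemma arc_tangent_poly Z p (F : {poly {poly K}}) k (g : K -> K) s0 :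
  polyfun g -> g s0 != 0 -> (forall v, Z v -> v != 0) ->
  (forall j, (size (F`_j)%R <= d.+1)%N) -> F`_0 = rVpoly p ->
  (forall j, (0 < j < k)%N -> F`_j = 0) ->
  (forall s, g s != 0 -> Z (poly_rV F.[s%:P])) ->
  forall j, (0 < j < k + k)%N -> tangent_cone_space Z p (poly_rV F`_j).
Proof.
move=> pg gs0 Z0 sF F0 Fk ZF j jk.
pose gam (i : 'I_d.+1) : {poly K} := \poly_(j < size F) (F`_j)`_i.
have gamE i l : (gam i)`_l = (F`_l)`_i.
  by rewrite coef_poly; case: ltnP => // /(nth_default 0) ->; rewrite coef0.
have gams s : \row_i (gam i).[s] = poly_rV F.[s%:P].
  apply/rowP => i; rewrite !mxE /gam horner_poly [F.[_]]horner_coef coef_sum; apply: eq_bigr => l _.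
  by rewrite -rmorphXn /= coefMC.
have -> : poly_rV F`_j = \row_i (gam i)`_j by apply/rowP => i; rewrite !mxE gamE.
apply: arc_tangent pg gs0 _ _ _ jk => [s /ZF Zs|i].
  by rewrite gams; split=> //; apply: Z0.
apply: dvd_Xn => l lk; rewrite coefB coefC gamE; case: l lk => [|l] lk.
  by rewrite F0 coef_rVpoly_ord subrr.
by rewrite Fk // coef0 subrr.
Qed.

(** Euler's relation, read off the arc [(1 + s) p]. *)
Lemma tangent_self Z p : is_cone Z -> (forall v, Z v -> v != 0) -> Z p ->
  tangent_cone_space Z p p.
Proof.
move=> coneZ Z0 Zp; pose F : {poly {poly K}} := (rVpoly p)%:P * (1 + 'X).
have FE j : F`_j = ((j == 0) + (j == 1))%:R *: rVpoly p.
  rewrite coefCM coefD coef1 coefX natrD scalerDl !scaler_nat mulrDr.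
  by congr (_ + _); case: (_ == _); rewrite ?mulr1 ?mulr0.
have sF j : (size (F`_j)%R <= d.+1)%N.
  by rewrite FE (leq_trans (size_scale_leq _ _)) // size_poly.
have pg : polyfun (fun s : K => 1 + s) by exists (1 + 'X) => s; rewrite !hornerE.
have g0 : 1 + 0 != 0 :> K by rewrite addr0 oner_neq0.
have Fk j : (0 < j < 1)%N -> F`_j = 0 by case: j.
have F0 : F`_0 = rVpoly p by rewrite FE addn0 scale1r.
have ZF s : 1 + s != 0 -> Z (poly_rV F.[s%:P]).
  move=> ns; have -> : F.[s%:P] = (1 + s) *: rVpoly p.
    by rewrite !hornerE -polyC1 -rmorphD /= mulrC mul_polyC.
  by rewrite linearZ /= rVpolyK; apply: coneZ.
have := arc_tangent_poly pg g0 Z0 sF F0 Fk ZF (j := 1%N) isT.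
by rewrite FE add0n scale1r rVpolyK.
Qed.

Lemma coef_lin_exp (R : comNzRingType) (a b : R) r j :
  ((a%:P + b%:P * 'X) ^+ r)`_j = (a ^+ (r - j) * b ^+ j) *+ 'C(r, j).
Proof.
rewrite exprDn coef_sum.
have [rj|jr] := ltnP r j.
  rewrite bin_small // mulr0n big1 // => i _.
  rewrite coefMn exprMn mulrA -!rmorphXn -rmorphM /= coefCM coefXn.
  by rewrite gtn_eqF ?mulr0 ?mul0rn // (leq_ltn_trans _ rj) // -ltnS.
have jr' : (j < r.+1)%N by [].
rewrite (bigD1 (Ordinal jr')) //= big1 ?addr0 => [|i].
  by rewrite coefMn exprMn mulrA -!rmorphXn -rmorphM /= coefCM coefXn eqxx mulr1.
rewrite -val_eqE /= => ij; rewrite coefMn exprMn mulrA -!rmorphXn -rmorphM /= coefCM coefXn.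
by rewrite eq_sym (negbTE ij) mulr0 mul0rn.
Qed.

End TangentArcs.

Section PartialFractions.
Variables (K : fieldType) (z : nat -> K).

(** Lagrange interpolation: for distinct nodes the products that omit one node span the lower
    degrees, and the full product supplies the top one. The cofactor [H] of degree at most 1 is the
    freedom that moving a single root provides. *)
Lemma partial_fractions (s : seq nat) (V : {poly K} -> Prop) :
  uniq (map z s) -> (forall A B, V A -> V B -> V (A + B)) ->
  (forall c, V (c%:P * \prod_(j <- s) ('X - (z j)%:P))) ->
  (forall i (H : {poly K}), i \in s -> (size H <= 2)%N -> V (H * \prod_(j <- rem i s) ('X - (z j)%:P))) ->
  forall A : {poly K}, (size A <= (size s).+1)%N -> V A.
Proof.
elim: s V => [|i s IH] V us VD Vc VH A sA.
  by rewrite (size1_polyC sA); have := Vc A`_0; rewrite big_nil mulr1.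
have {us}/andP[zi us] : (z i \notin map z s) && uniq (map z s) by [].
pose Q := \prod_(j <- s) ('X - (z j)%:P).
have Qi : Q.[z i] != 0.
  rewrite horner_prod prodf_seq_neq0; apply/allP => j js /=.
  rewrite hornerXsubC subr_eq0; apply: contraNneq zi => ->; exact: map_f.
pose c := A.[z i] / Q.[z i].
have /factor_theorem[A' A'E] : root (A - c%:P * Q) (z i).
  by rewrite /root hornerD hornerN hornerM hornerC divfK // subrr.
have AE : A = c%:P * Q + ('X - (z i)%:P) * A'.
  by rewrite [_ * A']mulrC -A'E addrC subrK.
have sQ : size Q = (size s).+1 by rewrite size_prod_XsubC.
rewrite AE; apply: (VD).
  have := VH i c%:P (mem_head _ _) (leqW (size_polyC_leq1 _)).
  by rewrite /= eqxx.
apply: (IH (fun B => V (('X - (z i)%:P) * B))) => //.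
- by move=> B1 B2 V1 V2; rewrite mulrDr; apply: (VD).
- by move=> a; have := Vc a; rewrite big_cons mulrCA.
- move=> j H js sH; rewrite mulrCA.
  have js' : j \in i :: s by rewrite inE js orbT.
  have := VH j H js' sH.
  have ij : i != j by apply: contraNneq zi => ->; apply: map_f.
  by rewrite /= (negbTE ij) big_cons.
- have [->|nA'] := eqVneq A' 0; first by rewrite size_poly0.
  have : (size (A - c%:P * Q)%R <= (size s).+2)%N.
    rewrite (leq_trans (size_polyD _ _)) // geq_max size_polyN; apply/andP; split => //.
    by rewrite mul_polyC (leq_trans (size_scale_leq _ _)) // sQ.
  by rewrite A'E size_Mmonic ?monicXsubC // size_XsubC addn2.
Qed.

End PartialFractions.

Lemma sumn_predn m : 0%N \notin m -> (sumn (map predn m) + size m)%N = sumn m.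
Proof.
elim: m => //= -[|r] m IH; rewrite inE //= => m0.
by rewrite -(IH m0); lia.
Qed.

Section TangentSpaces.
Variables (K : numClosedFieldType) (d : nat) (lam : seq nat).
Hypotheses (lam0 : 0%N \notin lam) (sd : sumn lam = d).
Notation Z := (@root_locus K d lam 1).
Notation l := (size lam).

Lemma lin_prod_iota m (L : nat -> {poly K}) :
  lin_prod m L = \prod_(i <- iota 0 (size m)) L i ^+ nth 0%N m i.
Proof. by rewrite /lin_prod -(big_mkord xpredT (fun i => L i ^+ nth 0%N m i)) /index_iota subn0. Qed.

Lemma lin_prodZ m (b : nat -> K) (L : nat -> {poly K}) :
  lin_prod m (fun i => b i *: L i) = (\prod_(i < size m) b i ^+ nth 0%N m i) *: lin_prod m L.
Proof. by rewrite /lin_prod -scaler_prod; apply: eq_bigr => i _; rewrite exprZn. Qed.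

Lemma size_lin_prod_pred (L : nat -> {poly K}) : (forall i, size (L i) <= 2)%N ->
  (size (lin_prod (map predn lam) L) + l <= d.+1)%N.
Proof.
move=> sL; have [+ _] := lin_prod_top (map predn lam) sL.
have <- : (sumn (map predn lam) + l)%N = d.
  by rewrite sumn_predn.
lia.
Qed.

Lemma size_lin_prod_predM (L : nat -> {poly K}) (A : {poly K}) : (forall i, size (L i) <= 2)%N ->
  (size A <= l.+1)%N -> (size (A * lin_prod (map predn lam) L)%R <= d.+1)%N.
Proof.
move=> sL sA; rewrite (leq_trans (size_polyMleq _ _)) //.
move: (size_lin_prod_pred sL) sA.
by move: (size A) (size (lin_prod _ _)) l => a b c; lia.
Qed.

Let Z0 v : Z v -> v != 0.
Proof. by apply: root_locus_neq0; apply: oner_neq0. Qed.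

(** Moving the [i]-th root along [H] changes the product to first order by a nonzero constant times
    [H L_i^(r_i - 1)] and the other factors, that is by the multiple [H prod_(j != i) L_j] of
    [prod_j L_j^(r_j - 1)]. For distinct roots these span all multiples, by [partial_fractions]. *)
Lemma tangent_distinct_roots c (z : nat -> K) (A : {poly K}) : c != 0 -> uniq (map z (iota 0 l)) ->
  (size A <= l.+1)%N ->
  let L i := 'X - (z i)%:P in
  tangent_cone_space Z (poly_rV (c *: lin_prod lam L))
    (poly_rV (A * lin_prod (map predn lam) L)).
Proof.
move=> nc uz sA L.
have sL i : (size (L i) <= 2)%N by rewrite size_XsubC.
have sP : (size (c *: lin_prod lam L)%R <= d.+1)%N.
  by rewrite (leq_trans (size_scale_leq _ _)) // -sd; case: (lin_prod_top lam sL).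
pose V B := tangent_cone_space Z (poly_rV (c *: lin_prod lam L))
    (poly_rV (B * lin_prod (map predn lam) L)).
have lamp i : (i < l)%N -> (0 < nth 0%N lam i)%N.
  by move=> il; rewrite lt0n; apply: contraNneq lam0 => <-; apply: mem_nth.
have VH i (H : {poly K}) : i \in iota 0 l -> (size H <= 2)%N -> V (H * \prod_(j <- rem i (iota 0 l)) L j).
  move=> ii sH; have il : (i < l)%N by move: ii; rewrite mem_iota.
  pose r := nth 0%N lam i.
  pose R := \prod_(j <- rem i (iota 0 l)) L j ^+ nth 0%N lam j.
  have iR (L' : nat -> {poly K}) : (forall j, j != i -> L' j = L j) -> lin_prod lam L' = L' i ^+ r * R.
    move=> L'E; rewrite lin_prod_iota (big_rem _ ii) /=; congr (_ * _).
    apply: eq_big_seq => j; rewrite mem_rem_uniq ?iota_uniq // !inE => /andP[ji _].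
    by rewrite L'E.
  have VE : H * \prod_(j <- rem i (iota 0 l)) L j * lin_prod (map predn lam) L =
      H * L i ^+ r.-1 * R.
    rewrite lin_prod_iota size_map (big_rem _ ii) /= (nth_map 0%N) //.
    rewrite mulrACA -/r; congr (_ * _); rewrite -big_split; apply: eq_big_seq => j /=.
    move=> /mem_rem; rewrite mem_iota => /andP[_ jl]; rewrite (nth_map 0%N) //.
    by rewrite -exprS prednK // lamp.
  pose F : {poly {poly K}} := (c *: R)%:P * ((L i)%:P + H%:P * 'X) ^+ r.
  have FE j : F`_j = (c *: R) * ((L i ^+ (r - j) * H ^+ j) *+ 'C(r, j)).
    by rewrite coefCM coef_lin_exp.
  have Fs s : F.[s%:P] = c *: ((L i + s *: H) ^+ r * R).
    by rewrite !(hornerM, hornerC, hornerD, horner_exp, hornerX) -scalerAl mulrC [H * _]mulrC mul_polyC.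
  pose L' s j := if j == i then L i + s *: H else L j.
  have sL' s j : (size (L' s j) <= 2)%N.
    rewrite /L'; case: eqP => // _; rewrite (leq_trans (size_polyD _ _)) // geq_max sL /=.
    exact: leq_trans (size_scale_leq _ _) sH.
  have FL s : F.[s%:P] = c *: lin_prod lam (L' s).
    rewrite Fs (iR (L' s)) ?[L' s i]/L' ?eqxx // => j ji.
    by rewrite /L' (negbTE ji).
  have sF j : (size (F`_j)%R <= d.+1)%N.
    have [jr|rj] := leqP j r; last by rewrite FE bin_small // mulr0n mulr0 size_poly0.
    have sR : (size R + r <= d.+1)%N.
      have mR : R \is monic by apply: monic_prod => j' _; rewrite monic_exp ?monicXsubC.
      have := sP; rewrite size_scale // (iR L) // size_Mmonic ?expf_neq0 ?polyXsubC_eq0 //.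
      by rewrite /L size_exp_XsubC addSn addnC.
    rewrite FE mulrnAr -scaler_nat (leq_trans (size_scale_leq _ _)) //.
    rewrite -scalerAl (leq_trans (size_scale_leq _ _)) //.
    have s1 := @size_exp_bound _ 1 (r - j) (L i) (sL i).
    have s2 := @size_exp_bound _ 1 j H sH.
    have s3 := size_mul_bound s1 s2.
    rewrite !mul1n subnK // in s3; rewrite (leq_trans (size_polyMleq _ _)) //.
    have aux (a b : nat) : (a <= r.+1 -> b + r <= d.+1 -> (b + a).-1 <= d.+1)%N by lia.
    exact: aux s3 sR.
  have pg : polyfun (fun s => 1 + s * H`_1).
    apply: polyfunD; first exact: polyfunC.
    by apply: polyfunM; [apply: polyfunX | apply: polyfunC].
  have g0 : 1 + 0 * H`_1 != 0 by rewrite mul0r addr0 oner_neq0.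
  have F0 : F`_0 = rVpoly (poly_rV (c *: lin_prod lam L) : 'rV_d.+1).
    rewrite poly_rV_K // FE subn0 expr0 mulr1 bin0 mulr1n (iR L) // -scalerAl.
    by rewrite mulrC.
  have F1 : F`_1 = (c * r%:R) *: (H * \prod_(j <- rem i (iota 0 l)) L j * lin_prod (map predn lam) L).
    rewrite VE FE bin1 expr1 subn1 -mulr_natr -scalerAl -scalerA; congr (_ *: _).
    by rewrite scaler_nat -mulr_natr; ring.
  have nr : c * r%:R != 0 by rewrite mulf_neq0 // pnatr_eq0 -lt0n lamp.
  have ZF s : 1 + s * H`_1 != 0 -> Z (poly_rV F.[s%:P]).
    move=> gs; exists c, (L' s); split=> //.
      move=> j; rewrite /is_linear_form sL' andbT /L'; case: (eqVneq j i) => _; last by rewrite /L polyXsubC_eq0.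
      apply: contraNneq gs => L0; have := congr1 (fun q : {poly K} => q`_1) L0.
      by rewrite coefD coefZ coefB coefX coefC subr0 coef0 => ->.
    rewrite mul1r poly_rV_K ?FL // (leq_trans (size_scale_leq _ _)) // -sd.
    by case: (lin_prod_top lam (sL' s)).
  have Fk j : (0 < j < 1)%N -> F`_j = 0 by case: j.
  have := arc_tangent_poly pg g0 Z0 sF F0 Fk ZF (j := 1%N) isT.
  have -> : poly_rV F`_1 = (c * r%:R) *: (poly_rV (H * \prod_(j <- rem i (iota 0 l)) L j *
      lin_prod (map predn lam) L) : 'rV_d.+1) by rewrite F1 linearZ.
  move=> T1; rewrite /V -[X in tangent_cone_space _ _ X](scalerK nr).
  exact: tangentZ.
apply: (@partial_fractions K z (iota 0 l) V) => //.
- by move=> B1 B2 V1 V2; rewrite /V mulrDl linearD; apply: tangentD.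
(* For a nonempty partition the full product is a product omitting the index 0, with [H] a multiple
   of [L 0]. For the empty one there is no root to move, and the vector is a multiple of the
   point. *)
- move=> a; have [l0|l0] := posnP l; last first.
    have i0 : 0%N \in iota 0 l by rewrite mem_iota.
    rewrite (big_rem _ i0) /= mulrA; apply: VH => //.
    by rewrite mul_polyC (leq_trans (size_scale_leq _ _)) // size_XsubC.
  rewrite l0 /= big_nil mulr1 /V.
  have -> : lin_prod (map predn lam) L = 1.
    by rewrite lin_prod_iota size_map l0 big_nil.
  have -> : lin_prod lam L = 1 by rewrite lin_prod_iota l0 big_nil.
  rewrite mulr1; have -> : poly_rV a%:P = (a / c) *: (poly_rV (c *: 1) : 'rV_d.+1).
    by rewrite -linearZ /= scalerA divfK // alg_polyC.
  apply: tangentZ; apply: tangent_self => //; first exact: root_locus_cone.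
  exists c, (fun=> 1); split=> //; first by move=> i; rewrite /is_linear_form oner_neq0 size_poly1.
  rewrite poly_rV_K; last by rewrite (leq_trans (size_scale_leq _ _)) // size_poly1.
  by rewrite lin_prod_iota l0 big_nil mulr1.
- by rewrite size_iota.
Qed.

End TangentSpaces.

(** * Reduction to points with distinct roots *)

Section GenericPencil.
Variables (K : numClosedFieldType).

(** Perturbation directions with pairwise distinct roots: for general [s] they separate the roots of
    any finite family. *)
Definition spread (i : nat) : {poly K} := 'X - (i%:R)%:P.

Lemma size_spread i : (size (spread i) <= 2)%N.
Proof. by rewrite size_XsubC. Qed.

Lemma generic_pencil N (L : nat -> {poly K}) : (forall i, (size (L i) <= 2)%N) ->
  exists2 g : K -> K, polyfun g /\ (exists s, g s != 0) &
  forall s, g s != 0 -> exists b z : nat -> K, uniq (map z (iota 0 N)) /\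
    forall i, (i < N)%N -> b i != 0 /\ L i + s *: spread i = b i *: ('X - (z i)%:P).
Proof.
move=> sL.
pose b i (s : K) : K := (L i)`_1 + s.
pose a i (s : K) : K := (L i)`_0 - s * i%:R.
have pb i : polyfun (b i).
  by exists (((L i)`_1)%:P + 'X) => s; rewrite !hornerE.
have pa i : polyfun (a i).
  by exists (((L i)`_0)%:P - 'X * (i%:R)%:P) => s; rewrite !hornerE.
(* Off the diagonal this is the resultant of two perturbed forms, with coefficient [j - i] at [s^2];
   on the diagonal it is a leading coefficient. One finite product thus excludes both coinciding
   roots and roots at infinity. *)
pose cr (ij : nat * nat) s := if ij.1 == ij.2 then b ij.1 s else a ij.1 s * b ij.2 s - a ij.2 s * b ij.1 s.
have pcr ij : polyfun (cr ij).
  rewrite /cr; case: eqP => _ //.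
  apply: polyfunD; first exact: polyfunM.
  have H := polyfunM (polyfunC (-1)) (polyfunM (pa ij.2) (pb ij.1)).
  by apply: polyfun_ext H => s; rewrite mulN1r.
have ncr ij : exists s, cr ij s != 0.
  rewrite /cr; case: eqVneq => [_|ne].
    by exists (1 - (L ij.1)`_1); rewrite /b addrC subrK oner_neq0.
  case: ij ne => i j /= ne.
  pose q : {poly K} := (((L i)`_0)%:P - 'X * (i%:R)%:P) * (((L j)`_1)%:P + 'X)
     - (((L j)`_0)%:P - 'X * (j%:R)%:P) * (((L i)`_1)%:P + 'X).
  have nq : q != 0.
    have qE : q = (j%:R - i%:R) *: 'X^2 + ((L i)`_0 - (L j)`_0 - i%:R * (L j)`_1 + j%:R * (L i)`_1) *: 'X
       + ((L i)`_0 * (L j)`_1 - (L j)`_0 * (L i)`_1)%:P.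
      by rewrite /q -!mul_polyC !(rmorphD, rmorphB, rmorphM) /=; ring.
    apply: contra_neq ne => q0; have := congr1 (fun p : {poly K} => p`_2) q0.
    rewrite qE !coefD !coefZ coefXn coefX coefC coef0 /= mulr1 mulr0 !addr0 => /eqP.
    by rewrite subr_eq0 eqr_nat => /eqP.
  have [s qs] := poly_neq0_nonroot nq; exists s; move: qs.
  by rewrite /q !hornerE.
pose prs := [seq (i, j) | i <- iota 0 N, j <- iota 0 N].
have [s1 Hs1] := @polyfun_seq_neq0 K _ prs cr (fun ij _ => pcr ij) (fun ij _ => ncr ij).
exists (fun s => \prod_(ij <- prs) cr ij s).
  split; first exact: polyfun_prod.
  by exists s1; rewrite prodf_seq_neq0; apply/allP => ij /Hs1.
move=> s; rewrite prodf_seq_neq0 => /allP Hs.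
have {}Hs i j : (i < N)%N -> (j < N)%N -> cr (i, j) s != 0.
  by move=> iN jN; apply: Hs; apply/allpairsP; exists (i, j); rewrite !mem_iota.
have nb i : (i < N)%N -> b i s != 0.
  by move=> iN; have := Hs i i iN iN; rewrite /cr eqxx.
exists (fun i => b i s), (fun i => - (a i s / b i s)); split.
  rewrite map_inj_in_uniq ?iota_uniq // => i j; rewrite !mem_iota !add0n => /= iN jN.
  move/oppr_inj/eqP; rewrite eqr_div ?nb // => e; apply/eqP.
  by have := Hs i j iN jN; rewrite /cr /=; apply: contraNT => /negbTE ->; rewrite subr_eq0.
move=> i iN; split; first exact: nb.
apply/polyP => k; rewrite coefD !coefZ !coefB !coefX !coefC.
case: k => [|[|k]] /=.
- by rewrite !sub0r opprK mulrN [RHS]mulrC divfK ?nb.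
- by rewrite !subr0 !mulr1.
- have -> : (L i)`_k.+2 = 0 by apply: nth_default; apply: leq_trans (sL i) _.
  by rewrite !subrr !mulr0 addr0.
Qed.

End GenericPencil.

Section SingularCriterion.
Variables (K : numClosedFieldType) (d : nat).

Lemma pencil_generic_point m (L : nat -> {poly K}) c s b z : sumn m = d ->
  (forall i, (i < size m)%N -> L i + s *: spread K i = b i *: ('X - (z i)%:P)) ->
  pencil d m 1 c 0 L (spread K) s =
  poly_rV ((c * \prod_(i < size m) b i ^+ nth 0%N m i) *: lin_prod m (fun i => 'X - (z i)%:P)).
Proof.
move=> sd Lb; rewrite /pencil mulr0 addr0 mul1r -scalerA -lin_prodZ.
by congr (poly_rV (_ *: _)); apply: eq_lin_prod => i /Lb.
Qed.

Section Fixed.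
Variable lam : seq nat.
Hypotheses (lam0 : 0%N \notin lam) (sd : sumn lam = d).
Notation Z := (@root_locus K d lam 1).
Notation l := (size lam).

(** Coinciding roots and roots at infinity are reached from distinct ones by a pencil: point and
    vector are polynomial in [s], so the value of a differential is too, and it vanishes for general
    [s]. *)
Lemma tangent_root_locus c (L : nat -> {poly K}) (A : {poly K}) : c != 0 ->
  (forall i, is_linear_form (L i)) -> (size A <= l.+1)%N ->
  tangent_cone_space Z (poly_rV (c *: lin_prod lam L)) (poly_rV (A * lin_prod (map predn lam) L)).
Proof.
move=> nc HL sA P ZP.
have sL i := is_linear_formP (HL i).
have [g [pg [s0 gs0]] gP] := generic_pencil l sL.
pose p s := pencil d lam 1 c 0 L (spread K) s.
pose w s : 'rV[K]_d.+1 := poly_rV (A * lin_prod (map predn lam) (fun i => L i + s *: spread K i)).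
pose f s := \sum_(k < d.+1) (P^`M(k)).@[p s 0] * w s 0 k.
have pw k : polyfun (fun s => w s 0 k).
  have H : ppolyfun (fun s => A * lin_prod (map predn lam) (fun i => L i + s *: spread K i)).
    apply: ppolyfunM; first exact: ppolyfunC.
    apply: ppolyfun_prod => i; apply: ppolyfun_exp; apply: ppolyfunD; first exact: ppolyfunC.
    by apply: ppolyfunZ; [apply: polyfunX | apply: ppolyfunC].
  by apply: polyfun_ext (H k) => s; rewrite mxE.
have pf : polyfun f.
  by apply: polyfun_sum => k; apply: polyfunM => //; apply: polyfun_meval_pencil.
have fg s : g s != 0 -> f s = 0.
  move=> gs; have [b [z [uz bz]]] := gP s gs.
  have := @tangent_distinct_roots K d lam lam0 sd
    (c * \prod_(i < l) b i ^+ nth 0%N lam i) z ((\prod_(i < l) b i ^+ (nth 0%N lam i).-1) *: A).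
  rewrite mulf_neq0 //; last by apply/prodf_neq0 => i _; rewrite expf_neq0 // (bz i _).1.
  move=> /(_ isT uz); rewrite (leq_trans (size_scale_leq _ _)) // => /(_ isT P ZP) <-.
  apply: eq_bigr => k _; rewrite /p (pencil_generic_point c sd (fun i il => (bz i il).2)).
  congr (_ * fun_of_matrix (poly_rV _) 0 k).
  rewrite (eq_lin_prod (L' := fun i => b i *: ('X - (z i)%:P))); last first.
    by move=> i; rewrite size_map => il; rewrite (bz i il).2.
  rewrite lin_prodZ -scalerAr -scalerAl; congr (_ *: _).
  rewrite size_map; apply: eq_bigr => i _; rewrite (nth_map 0%N) //.
have p0 : p 0 = poly_rV (c *: lin_prod lam L).
  rewrite /p /pencil mul0r addr0 mul1r.
  by congr (poly_rV (_ *: _)); apply: eq_lin_prod => i _; rewrite scale0r addr0.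
have w0 : w 0 = poly_rV (A * lin_prod (map predn lam) L).
  by congr (poly_rV (_ * _)); apply: eq_lin_prod => i _; rewrite scale0r addr0.
by have := polyfun_density pf pg gs0 fg 0; rewrite /f p0 w0.
Qed.

(** The multiples of [D] fill dimension [l + 1], and a tangent vector that [D] does not divide is
    independent of them. The matrix [W] packages the resulting [l + 2] vectors in the form that
    semicontinuity consumes. *)
Lemma excess_tangent p (D E : {poly K}) : D != 0 -> (size D + l <= d.+1)%N -> (size E <= d.+1)%N ->
  (forall A : {poly K}, (size A <= l.+1)%N -> tangent_cone_space Z p (poly_rV (A * D))) ->
  tangent_cone_space Z p (poly_rV E) -> ~~ (D %| E) ->
  exists2 W : 'M[K]_(l.+1 + 1, d.+1), row_free W &
    forall u, tangent_cone_space Z p (u *m W).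
Proof.
move=> nD sD sE TD TE nDE.
pose W1 : 'M[K]_(l.+1, d.+1) := \matrix_(i, j) ('X^i * D)`_j.
have sDA (A : {poly K}) : (size A <= l.+1)%N -> (size (A * D)%R <= d.+1)%N.
  move=> sA; rewrite (leq_trans (size_polyMleq _ _)) //.
  by move: sA sD; move: (size A) (size D) l => a b c; lia.
have W1E (a : 'rV_l.+1) : a *m W1 = poly_rV (rVpoly a * D).
  apply/rowP => j; rewrite !mxE; under eq_bigr => i _ do rewrite mxE.
  have -> : rVpoly a = \sum_(i < l.+1) a 0 i *: 'X^i.
    apply/polyP => k; rewrite coef_sum; have [kl|lk] := ltnP k l.+1; last first.
      rewrite nth_default ?(leq_trans (size_poly _ _)) // big1 // => i _.
      by rewrite coefZ coefXn gtn_eqF ?mulr0 // (leq_trans (ltn_ord i)).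
    rewrite (coef_rVpoly_ord a (Ordinal kl)) (bigD1 (Ordinal kl)) //= coefZ coefXn eqxx mulr1.
    by rewrite big1 ?addr0 // => i; rewrite -val_eqE coefZ coefXn eq_sym => /negbTE /= ->; rewrite mulr0.
  rewrite mulr_suml coef_sum; apply: eq_bigr => i _.
  by rewrite -scalerAl coefZ.
exists (col_mx W1 (poly_rV E)).
  apply: row_free_inj => u; rewrite -[u]hsubmxK mul_row_col.
  set a := lsubmx u; set b := rsubmx u.
  have -> : b *m (poly_rV E : 'rV_d.+1) = b 0 0 *: poly_rV E.
    by rewrite {1}[b]mx11_scalar mul_scalar_mx.
  rewrite W1E => /(congr1 rVpoly); rewrite linearD linearZ /= !poly_rV_K ?sDA ?size_poly // linear0 => e.
  have b0 : b 0 0 = 0.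
    apply: contraNeq nDE => nb.
    have -> : E = - ((b 0 0)^-1 *: rVpoly a) * D.
      move/eqP: e; rewrite addr_eq0 => /eqP e.
      by rewrite mulNr -scalerAl e scalerN opprK scalerA mulVf // scale1r.
    exact: dvdp_mull.
  move/eqP: e; rewrite b0 scale0r addr0 mulf_eq0 (negbTE nD) orbF => /eqP a0.
  have -> : a = 0 by apply: (can_inj rVpolyK); rewrite a0 linear0.
  have -> : b = 0 by apply/matrixP => i j; rewrite !ord1 b0 mxE.
  exact: row_mx0.
move=> u; rewrite -[u]hsubmxK mul_row_col; apply: tangentD.
  by rewrite W1E; apply: TD; apply: size_poly.
by rewrite [rsubmx u]mx11_scalar mul_scalar_mx; apply: tangentZ.
Qed.

(* By semicontinuity it is enough to exhibit an excess tangent vector at the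
   points with distinct roots, which are dense. *)
Lemma tangent_dim_jump mu : 0%N \notin mu -> sumn mu = d ->
  (forall c (z : nat -> K), c != 0 -> uniq (map z (iota 0 (size mu))) ->
    exists (c' : K) (L : nat -> {poly K}) (E : {poly K}), [/\ c' != 0, forall i, is_linear_form (L i),
      c *: lin_prod mu (fun i => 'X - (z i)%:P) = c' *: lin_prod lam L,
      (size E <= d.+1)%N & tangent_cone_space Z (poly_rV (c' *: lin_prod lam L)) (poly_rV E) /\
      ~~ (lin_prod (map predn lam) L %| E)]) ->
  forall p k, zariski_closure (root_locus mu 1) p -> tangent_dim (zariski_closure Z) p k -> (l < k)%N.
Proof.
move=> mu0 sdm gen p k Cp /tangent_semicontinuous[M Mp HM].
have [v Zv Mv] : exists2 v, @root_locus K d mu 1 v & M.@[v 0] != 0.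
  apply: contrapT => none; case/eqP: Mp.
  apply: (cone_vanish_closure (X := root_locus mu 1)) Cp; first by move=> t w; apply: root_locus_cone.
  by move=> w _ Zw; apply: contrapT => /eqP Mw; apply: none; exists w.
have [c [L [nc HL vE]]] := Zv.
have sL i := is_linear_formP (HL i).
have [g [pg [s0 gs0]] gP] := generic_pencil (size mu) sL.
pose p' s := pencil d mu 1 c 0 L (spread K) s.
have p'0 : p' 0 = v.
  apply: (can_inj rVpolyK); rewrite /p' (@rVpoly_pencil _ d 0 mu 1 _ sdm _ _ _ _ HL (@size_spread K)) ?size_poly1 //.
  rewrite vE mul0r addr0.
  by congr (_ *: (_ * _)); apply: eq_lin_prod => i _; rewrite scale0r addr0.
have [s [gs Ms]] : exists s, g s != 0 /\ M.@[p' s 0] != 0.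
  apply: contrapT => none; case/eqP: Mv; rewrite -p'0.
  apply: (polyfun_density (f := fun s => M.@[p' s 0]) _ pg gs0).
    exact: polyfun_meval_pencil.
  by move=> s gs; apply: contrapT => /eqP Ms; apply: none; exists s.
have [b [z [uz bz]]] := gP s gs.
move: Ms; rewrite /p' (pencil_generic_point c sdm (fun i il => (bz i il).2)).
set c1 := c * _ => Ms.
have nc1 : c1 != 0.
  by rewrite mulf_neq0 //; apply/prodf_neq0 => i _; rewrite expf_neq0 // (bz i _).1.
have [c' [L' [E [nc' HL' e sE [TE nDE]]]]] := gen c1 z nc1 uz.
have [|||W fW TW] := excess_tangent (p := poly_rV (c' *: lin_prod lam L')) _ _ sE _ TE nDE.
- exact: lin_prod_neq0.
- by apply: size_lin_prod_pred => // i; apply: is_linear_formP.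
- by move=> A sA; apply: tangent_root_locus.
rewrite e in Ms.
suff : (l.+1 + 1 <= k.+1)%N by rewrite addn1 ltnS.
by apply: HM Ms fW _ => u; apply/tangent_closure; apply: TW.
Qed.

End Fixed.

Lemma root_multiplicity_ndvd (x : K) a b (D' N : {poly K}) : (b < a)%N -> N.[x] != 0 ->
  ~~ (('X - x%:P) ^+ a * D' %| ('X - x%:P) ^+ b * N).
Proof.
move=> ba Nx; apply/negP => dv.
have nx : ('X - x%:P) ^+ b != 0 by rewrite expf_neq0 // polyXsubC_eq0.
have : ('X - x%:P) ^+ b * ('X - x%:P) %| ('X - x%:P) ^+ b * N.
  apply: dvdp_trans dv; apply: dvdp_mulr; rewrite -exprSr.
  by rewrite -(subnKC ba) exprD dvdp_mulIl.
by rewrite dvdp_mul2l // dvdp_XsubCl /root (negbTE Nx).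
Qed.

Lemma lin_prod_nseq t r (L : nat -> {poly K}) l0 : (forall i, (i < t)%N -> L i = l0) ->
  lin_prod (nseq t r) L = (l0 ^+ r) ^+ t.
Proof.
move=> HL; rewrite /lin_prod size_nseq -[in RHS](card_ord t) -prodr_const.
by apply: eq_bigr => i _; rewrite HL // nth_nseq ltn_ord.
Qed.

End SingularCriterion.

(** * Excess tangent vectors *)

Section ExcessCases.
Variables (K : numClosedFieldType) (d : nat).

Lemma bin2_natr n : 'C(n, 2)%:R * 2 = n%:R * (n%:R - 1) :> K.
Proof.
have : ('C(n, 2) * 2`! = n ^_ 2)%N by rewrite bin_ffact.
move/(congr1 (fun k : nat => k%:R : K)); rewrite natrM => ->.
by case: n => [|n]; rewrite ?ffact0n ?mul0r // ffactnS ffactn1 /= natrM -natr1; ring.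
Qed.

Lemma bin3_natr n : 'C(n, 3)%:R * 6 = n%:R * (n%:R - 1) * (n%:R - 2) :> K.
Proof.
have : ('C(n, 3) * 3`! = n ^_ 3)%N by rewrite bin_ffact.
move/(congr1 (fun k : nat => k%:R : K)); rewrite natrM => ->.
case: n => [|[|n]]; rewrite ?ffact0n ?mul0r //.
  by rewrite !ffactnS /= ffact0n mul0n muln0 subrr mulr0 mul0r.
by rewrite !ffactnS ffactn0 /= muln1 !natrM -!natr1; ring.
Qed.

(* Six times the third weighted power sum: the first nonzero odd term of the
   arc [(x + r2 s)^r1 (x - r1 s)^r2]. *)
Lemma cusp_coefficient r1 r2 : (0 < r1)%N -> (0 < r2)%N -> r1 != r2 ->
  \sum_(i < 4) 'C(r1, i)%:R * r2%:R ^+ i * ('C(r2, 3 - i)%:R * (- r1%:R) ^+ (3 - i)) != 0 :> K.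
Proof.
move=> r1p r2p r12; set S := \sum_(i < 4) _.
have S6 : S * 6 = 2 * r1%:R * r2%:R * (r2%:R - r1%:R) * (r2%:R + r1%:R).
  rewrite /S !big_ord_recl big_ord0 /= /bump /= !bin0 !bin1.
  have e2 := bin2_natr r2; have e1 := bin2_natr r1.
  have f2 := bin3_natr r2; have f1 := bin3_natr r1.
  transitivity (- ('C(r2, 3)%:R * 6) * r1%:R ^+ 3 + 3 * ('C(r2, 2)%:R * 2) * r1%:R ^+ 3 * r2%:R
    - 3 * ('C(r1, 2)%:R * 2) * r2%:R ^+ 3 * r1%:R + ('C(r1, 3)%:R * 6) * r2%:R ^+ 3 : K).
    by ring.
  by rewrite e1 e2 f1 f2; ring.
apply: contraNneq r12 => S0; move/eqP: S6; rewrite S0 mul0r eq_sym !mulf_eq0 !pnatr_eq0.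
rewrite (gtn_eqF r1p) (gtn_eqF r2p) /= -natrD pnatr_eq0 addn_eq0 (gtn_eqF r1p) andbF orbF.
by rewrite subr_eq0 eqr_nat eq_sym.
Qed.

Lemma mulrn_polyC (a b : {poly K}) (p q : K) m n :
  (a * p%:P) *+ m * ((b * q%:P) *+ n) = (m%:R * p * (n%:R * q)) *: (a * b).
Proof.
by rewrite -mul_polyC !rmorphM /= -(mulr_natr _ m) -(mulr_natr _ n) !polyC_natr; ring.
Qed.

Section Merge.
Variables (r1 r2 : nat) (nu : seq nat).
Hypotheses (r1p : (0 < r1)%N) (r2p : (0 < r2)%N) (r12 : r1 != r2) (nu0 : 0%N \notin nu).
Hypothesis sd : (r1 + (r2 + sumn nu))%N = d.
Let lam := [:: r1, r2 & nu].
Let mu := (r1 + r2)%N :: nu.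

(** The weights [r2] and [-r1] cancel the linear term of the arc, which is therefore flat to order
    2, so that its third coefficient is tangent. At the merged root this coefficient has
    multiplicity [r1 + r2 - 3], one less than [prod L_i^(r_i - 1)], and its constant is nonzero
    because [r1] and [r2] differ. *)
Lemma merge_tangent_dim p k :
  zariski_closure (@root_locus K d mu 1) p ->
  tangent_dim (zariski_closure (root_locus lam 1)) p k -> (size lam < k)%N.
Proof.
have lam0 : 0%N \notin lam by rewrite !inE !negb_or !neq_ltn r1p r2p.
have mu0 : 0%N \notin mu by rewrite inE negb_or nu0 neq_ltn addn_gt0 r1p.
have sm : sumn mu = d by rewrite /= -addnA.
apply: tangent_dim_jump => // c z nc uz.
pose x : {poly K} := 'X - (z 0%N)%:P.
pose zn i := z i.+1.
pose N := lin_prod nu (fun i => 'X - (zn i)%:P).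
pose N' := lin_prod (map predn nu) (fun i => 'X - (zn i)%:P).
pose L i : {poly K} := if i is j.+2 then 'X - (zn j)%:P else x.
have sL i : (size (L i) <= 2)%N by case: i => [|[|i]]; rewrite size_XsubC.
have HL i : is_linear_form (L i).
  by rewrite /is_linear_form sL andbT; case: i => [|[|i]]; rewrite polyXsubC_eq0.
have lamL : lin_prod lam L = x ^+ (r1 + r2) * N by rewrite !lin_prod_cons exprD mulrA.
have sN : (size N <= (sumn nu).+1)%N by case: (@lin_prod_top K nu (fun i => 'X - (zn i)%:P) (fun i => eq_leq (size_XsubC _))).
pose b1 : {poly K} := (r2%:R)%:P.
pose b2 : {poly K} := (- r1%:R)%:P.
pose F : {poly {poly K}} := (c *: N)%:P * ((x%:P + b1%:P * 'X) ^+ r1 * (x%:P + b2%:P * 'X) ^+ r2).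
have FE j : F`_j = (c *: N) * \sum_(i < j.+1)
    (x ^+ (r1 - i) * b1 ^+ i) *+ 'C(r1, i) * ((x ^+ (r2 - (j - i)) * b2 ^+ (j - i)) *+ 'C(r2, j - i)).
  rewrite coefCM coefM; congr (_ * _); apply: eq_bigr => i _.
  by rewrite !coef_lin_exp.
pose kap j := \sum_(i < j.+1) 'C(r1, i)%:R * r2%:R ^+ i * ('C(r2, j - i)%:R * (- r1%:R) ^+ (j - i)) : K.
have FE' j : F`_j = (c * kap j) *: (x ^+ (r1 + r2 - j) * N).
  rewrite FE /kap -!scalerAl -scalerA; congr (_ *: _); rewrite mulrC scalerAl; congr (_ * _).
  rewrite scaler_suml; apply: eq_bigr => i _.
  have [r1i|ir1] := ltnP r1 i; first by rewrite (bin_small r1i) mulr0n !mul0r scale0r.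
  have [r2i|ir2] := ltnP r2 (j - i); first by rewrite (bin_small r2i) mulr0n mul0r !mulr0 scale0r.
  have -> : (r1 + r2 - j = (r1 - i) + (r2 - (j - i)))%N by have := ltn_ord i; lia.
  by rewrite exprD /b1 /b2 -!rmorphXn /= mulrn_polyC.
have sF j : (size (F`_j)%R <= d.+1)%N.
  have [jr|rj] := leqP j (r1 + r2); last first.
    have -> : F`_j = 0.
      rewrite FE' /kap big1 ?mulr0 ?scale0r // => i _.
      have [r1i|ir1] := ltnP r1 i; first by rewrite bin_small // !mul0r.
      by rewrite ['C(r2, _)]bin_small ?mul0r ?mulr0 //; lia.
    by rewrite size_poly0.
  rewrite FE' (leq_trans (size_scale_leq _ _)) //.
  have s1 := @size_exp_bound _ 1 (r1 + r2 - j) x (sL 0%N).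
  rewrite (leq_trans (size_mul_bound s1 sN)) //.
  by move: sd; move: (sumn nu) => a; lia.
exists c, L, F`_3; split=> //.
  by rewrite lamL lin_prod_cons.
split.
  have pg : polyfun (fun _ : K => 1 : K) by apply: polyfunC.
  apply: (arc_tangent_poly (k := 2) (s0 := 0) pg) => //.
  - exact: oner_neq0.
  - by move=> v; apply: root_locus_neq0; apply: oner_neq0.
  - rewrite poly_rV_K; last first.
      rewrite (leq_trans (size_scale_leq _ _)) //; have [s _] := lin_prod_top lam sL.
      by rewrite (leq_trans s) //= sd.
    by rewrite FE' /kap big_ord1 !bin0 !expr0 !mulr1 subn0 lamL.
  - case=> [|[|j]] // _; rewrite FE' /kap big_ord_recl big_ord1 /= !bin0 !bin1 !expr0 !expr1.
    by rewrite !mulr1 !mul1r (_ : _ + _ = 0) ?mulr0 ?scale0r //; ring.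
  - move=> s _.
    pose L' i := if i is j.+2 then L j.+2 else x + s *: (if i == 0%N then b1 else b2).
    have sL' i : (size (L' i) <= 2)%N.
      have aux a : (size (x + s *: a%:P)%R <= 2)%N.
        rewrite (leq_trans (size_polyD _ _)) // geq_max (sL 0%N) /=.
        by rewrite (leq_trans (size_scale_leq _ _)) // (leq_trans (size_polyC_leq1 _)).
      by case: i => [|[|i]] /=; [apply: aux | apply: aux | apply: (sL i.+2)].
    have FL : F.[s%:P] = c *: lin_prod lam L'.
      rewrite !lin_prod_cons !(hornerM, hornerC, hornerD, horner_exp, hornerX) /=.
      by rewrite -/N ![_ * s%:P]mulrC !mul_polyC -scalerAl; congr (_ *: _); rewrite mulrC mulrA.
    exists c, L'; split=> //.
      move=> i; rewrite /is_linear_form sL' andbT.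
      case: i => [|[|i]]; last by rewrite polyXsubC_eq0.
        apply/eqP => /(congr1 (fun q : {poly K} => q`_1)); rewrite coefD coefZ coefB coefX !coefC mulr0.
        by rewrite subr0 addr0 => /eqP; rewrite oner_eq0.
      apply/eqP => /(congr1 (fun q : {poly K} => q`_1)); rewrite coefD coefZ coefB coefX !coefC mulr0.
      by rewrite subr0 addr0 => /eqP; rewrite oner_eq0.
    rewrite mul1r poly_rV_K ?FL // (leq_trans (size_scale_leq _ _)) //.
    by have [s' _] := lin_prod_top lam sL'; rewrite (leq_trans s') //= sd.
have nkap : c * kap 3 != 0 by rewrite mulf_neq0 // cusp_coefficient.
rewrite FE' dvdpZr //.
have -> : lin_prod (map predn lam) L = x ^+ (r1.-1 + r2.-1) * N'.
  by rewrite /= !lin_prod_cons exprD mulrA.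
apply: root_multiplicity_ndvd; first by lia.
rewrite horner_prod; apply/prodf_neq0 => i _; rewrite horner_exp expf_neq0 // hornerXsubC.
rewrite subr_eq0; move: uz => /= /andP[z0 _]; apply: contraNneq z0 => ->.
apply: map_f; rewrite mem_iota /=; have := ltn_ord i; lia.
Qed.

End Merge.

Section TwoPreimages.
Variables (r1 r2 r3 t1 t2 : nat) (nu : seq nat).
Hypotheses (r1p : (0 < r1)%N) (r2p : (0 < r2)%N) (nu0 : 0%N \notin nu).
Hypotheses (t1p : (0 < t1)%N) (t12 : (t1 < t2)%N).
Hypotheses (e1 : r3 = (t1 * r1)%N) (e2 : r3 = (t2 * r2)%N).
Hypothesis sd : (r3 + (r3 + sumn nu))%N = d.
Let lam := nseq t1 r1 ++ nseq t2 r2 ++ nu.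
Let mu := [:: r3, r3 & nu].

(* Interchanging the two roots of multiplicity [r3] gives a second preimage, whose
   tangent directions supply the excess vector. *)
Lemma two_preimages_tangent_dim p k :
  zariski_closure (@root_locus K d mu 1) p ->
  tangent_dim (zariski_closure (root_locus lam 1)) p k -> (size lam < k)%N.
Proof.
have r3p : (0 < r3)%N by rewrite e1 muln_gt0 t1p.
have lam0 : 0%N \notin lam.
  by rewrite !mem_cat !mem_nseq !negb_or nu0 ![0%N == _]eq_sym (gtn_eqF r1p) (gtn_eqF r2p) !andbF.
have mu0 : 0%N \notin mu by rewrite !inE !negb_or ![0%N == _]eq_sym (gtn_eqF r3p).
have sm : sumn mu = d by [].
have sl : sumn lam = d.
  by rewrite !sumn_cat !sumn_nseq ![(_ * t1)%N]mulnC ![(_ * t2)%N]mulnC -e1 -e2.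
apply: tangent_dim_jump => // c z nc uz.
pose zn i := z i.+2.
pose N (m : seq nat) := lin_prod m (fun i => 'X - (zn i)%:P).
pose L (x y : K) i : {poly K} :=
  if (i < t1)%N then 'X - x%:P else if (i < t1 + t2)%N then 'X - y%:P
  else 'X - (zn (i - (t1 + t2))%N)%:P.
have HL x y i : is_linear_form (L x y i).
  by rewrite /is_linear_form /L; case: ifP => _; [|case: ifP => _]; rewrite polyXsubC_eq0 size_XsubC.
have LE x y s1 s2 m : lin_prod (nseq t1 s1 ++ nseq t2 s2 ++ m) (L x y) =
    ('X - x%:P) ^+ (t1 * s1) * (('X - y%:P) ^+ (t2 * s2) * N m).
  rewrite !lin_prod_cat !size_nseq (@lin_prod_nseq K _ _ _ ('X - x%:P)) => [|i it]; last by rewrite /L it.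
  rewrite (@lin_prod_nseq K _ _ _ ('X - y%:P)) => [|i it]; last first.
    by rewrite /L ltn_add2l it ltnNge leq_addr.
  rewrite -!exprM ![(_ * t1)%N]mulnC ![(_ * t2)%N]mulnC; congr (_ * (_ * _)).
  apply: eq_lin_prod => i _; rewrite /L ltnNge leq_addr /= ltnNge leq_add2l leq_addr /=.
  by rewrite addnA addKn.
have predE : map predn lam = nseq t1 r1.-1 ++ nseq t2 r2.-1 ++ map predn nu.
  by rewrite !map_cat !map_nseq.
have ptE : c *: lin_prod lam (L (z 1%N) (z 0%N)) = c *: lin_prod lam (L (z 0%N) (z 1%N)).
  by rewrite !LE -e1 -e2; congr (_ *: _); rewrite mulrCA.
have z01 : z 0%N != z 1%N.
  by move: uz => /= /andP[+ _]; rewrite inE negb_or => /andP[].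
(* The excess vector is [prod L_i^(r_i - 1)] of the other preimage. At the root [z 0] it has
   multiplicity [t2 (r2 - 1) = r3 - t2], which is below the multiplicity [r3 - t1] of the present
   one since [t1 < t2]. *)
exists c, (L (z 0%N) (z 1%N)), (1 * lin_prod (map predn lam) (L (z 1%N) (z 0%N))); split=> //.
- by rewrite LE -e1 -e2 !lin_prod_cons.
- by apply: size_lin_prod_predM => // [i|]; [apply: is_linear_formP | rewrite size_poly1].
split; first by rewrite -ptE; apply: tangent_root_locus; rewrite ?size_poly1.
rewrite mul1r predE !LE [X in _ %| X]mulrCA; apply: root_multiplicity_ndvd.
  have : (t1 * r1.-1 + t1 = t2 * r2.-1 + t2)%N by rewrite -!mulnSr !prednK // -e1 -e2.
  by move: t12; lia.
rewrite hornerM mulf_neq0 //.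
  by rewrite horner_exp expf_neq0 // hornerXsubC subr_eq0.
rewrite horner_prod; apply/prodf_neq0 => i _; rewrite horner_exp expf_neq0 // hornerXsubC.
rewrite subr_eq0; move: uz => /= /andP[z0 _]; apply: contraNneq z0 => ->.
rewrite inE; apply/orP; right; apply/mapP; exists i.+2 => //.
by rewrite mem_iota /= add2n !ltnS -(size_map predn nu) ltn_ord.
Qed.

End TwoPreimages.
End ExcessCases.

(** * Preimages and the strata of S *)

Section Lists.
Variable T : eqType.
Implicit Types s t : seq T.

Lemma perm_eq_count s t : (forall x, count_mem x s = count_mem x t) -> perm_eq s t.
Proof. by move=> H; apply/allP => x _ /=; apply/eqP. Qed.

Lemma count_mem_nseq n (x y : T) : count_mem y (nseq n x) = ((x == y) * n)%N.
Proof. by rewrite count_nseq. Qed.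

Lemma perm_nseq_split n (x : T) s : (n <= count_mem x s)%N -> exists t, perm_eq s (nseq n x ++ t).
Proof.
move=> ns; exists (nseq (count_mem x s - n) x ++ filter (predC1 x) s).
apply: perm_eq_count => y; rewrite !count_cat !count_mem_nseq count_filter.
have [<-|xy] := eqVneq x y.
  rewrite !mul1n addnA subnKC // -[LHS]addn0; congr (_ + _)%N.
  by apply/esym/eqP; rewrite eqn0Ngt -has_count; apply/hasPn => z _ /=; case: eqP.
rewrite !mul0n !add0n; apply: eq_count => z /=.
by case: eqP => [->|] //=; rewrite eq_sym (negbTE xy).
Qed.

End Lists.

Lemma count_sort_geq mu x : count_mem x (sort geq mu) = count_mem x mu.
Proof. by apply/permP; rewrite perm_sort. Qed.

Lemma sort_geq_partition d mu : 0%N \notin mu -> sumn mu = d -> is_partition d (sort geq mu).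
Proof.
move=> mu0 smu; apply/and3P; split.
- by apply: sort_sorted => a b; apply: leq_total.
- by rewrite mem_sort.
- by rewrite -smu; apply/eqP/perm_sumn; rewrite perm_sort.
Qed.

Lemma addn_eql a b : (0 < b)%N -> (a + b == a)%N = false.
Proof. by lia. Qed.

Lemma addn_eqr a b : (0 < a)%N -> (a + b == b)%N = false.
Proof. by lia. Qed.

Section SingularStrata.
Variables (d : nat) (lam : seq nat).
Hypothesis hlam : is_partition d lam.

Let lam0 : 0%N \notin lam. Proof. by case/and3P: hlam. Qed.
Let sd : sumn lam = d. Proof. by case/and3P: hlam => _ _ /eqP. Qed.

(** Only two shapes remain. Case (b) has the shape of (c) with [r3 = r1] and [t1 = 1]: the part [r1]
    already present in [lam] plays the role of the first group. In case (c) the two groups are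
    interchanged if necessary to obtain [t1 < t2]. *)
Lemma S_set_lists mu : S_set d lam mu ->
  (exists r1 r2 nu, [/\ (0 < r1)%N, (0 < r2)%N, r1 != r2 &
     perm_eq lam [:: r1, r2 & nu] /\ perm_eq mu ((r1 + r2)%N :: nu)]) \/
  (exists r1 r2 r3 t1 t2 nu, [/\ (0 < r1)%N, (0 < r2)%N, (0 < t1)%N & (t1 < t2)%N] /\
     [/\ r3 = (t1 * r1)%N, r3 = (t2 * r2)%N,
         perm_eq lam (nseq t1 r1 ++ nseq t2 r2 ++ nu) & perm_eq mu [:: r3, r3 & nu]]).
Proof.
case=> [[[pmu [r1 [r2 [[r1p r2p r12] [e1 e2 e3 e4]]]]]|[pmu [r1 [r2 [t [[r1p r2p tp r12] [e0 e1 e2 e3]]]]]]]|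
  [pmu [r1 [r2 [r3 [t1 [t2 [[r1p r2p r3p t1p t2p] [[ur f1 f2] [e1 e2 e3 e4]]]]]]]]]].
- left; exists r1, r2; move/eqP in r12.
  have [nu nuP] : exists nu, perm_eq lam (nseq 1 r1 ++ nu).
    by apply: perm_nseq_split; rewrite -/(mult lam r1) e1 addn1.
  have [nu' nuP'] : exists nu', perm_eq nu (nseq 1 r2 ++ nu').
    apply: perm_nseq_split; have := permP nuP (pred1 r2).
    by rewrite count_cat count_mem_nseq ?(negbTE r12) -/(mult lam r2) e2 mul0n add0n addn1 => <-.
  have lamP : perm_eq lam [:: r1, r2 & nu'].
    by apply: (perm_trans nuP); rewrite /= perm_cons.
  exists nu'; split=> //; split=> //; apply: perm_eq_count => x.
  have := permP lamP (pred1 x); rewrite /= -/(mult lam x) -/(mult mu x).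
  have r31 : (r1 + r2 == r1)%N = false by apply/negbTE; rewrite -{2}[r1]addn0 eqn_add2l; lia.
  have r32 : (r1 + r2 == r2)%N = false by apply/negbTE; rewrite -{2}[r2]add0n eqn_add2r; lia.
  have := e4 x; rewrite !inE !negb_or.
  case: (eqVneq x r1) => [->|x1 /=].
    by rewrite r31 e1 ?eqxx ?(eq_sym r2 r1) ?(negbTE r12) /=; lia.
  case: (eqVneq x r2) => [->|x2 /=]; first by rewrite r32 e2 ?eqxx ?(negbTE r12) /=; lia.
  case: (eqVneq x (r1 + r2)%N) => [->|x3 /= ->] //.
    by rewrite e3 /=; lia.
- right; move/eqP in r12.
  have [nu nuP] : exists nu, perm_eq lam (nseq t r2 ++ nu).
    by apply: perm_nseq_split; rewrite -/(mult lam r2) e2 leq_addl.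
  have [nu' nuP'] : exists nu', perm_eq nu (nseq 1 r1 ++ nu').
    apply: perm_nseq_split; have := permP nuP (pred1 r1).
    rewrite count_cat count_mem_nseq eq_sym ?(negbTE r12) -/(mult lam r1) mul0n add0n => <-.
    exact: e0.
  have lamP : perm_eq lam (nseq 1 r1 ++ nseq t r2 ++ nu').
    apply: (perm_trans nuP); rewrite perm_sym perm_catCA perm_cat2l perm_sym //.
  have muP : perm_eq mu [:: r1, r1 & nu'].
    apply: perm_eq_count => x; have := permP lamP (pred1 x).
    rewrite !count_cat !count_mem_nseq /= -/(mult lam x) -/(mult mu x).
    have := e3 x; rewrite !inE !negb_or.
    case: (eqVneq x r1) => [->|x1 /=].
      by rewrite e1 ?eqxx ?(eq_sym r2 r1) ?(negbTE r12) /=; lia.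
    case: (eqVneq x r2) => [->|x2 /= ->] //.
      by rewrite e2 ?eqxx ?(negbTE r12) /=; lia.
  have r1E : r1 = (t * r2)%N.
    have := perm_sumn lamP; have := perm_sumn muP; case/and3P: pmu => _ _ /eqP ->.
    rewrite sd !sumn_cat !sumn_nseq muln1 /= [(r2 * t)%N]mulnC; move: (t * r2)%N => w; lia.
  exists r1, r2, r1, 1%N, t, nu'; split; split=> //; last by rewrite mul1n.
  by move: r12; rewrite r1E; case: t tp {e2 nuP lamP r1E} => [|[|t]] //; rewrite mul1n eqxx.
- right; move: ur; rewrite /= !inE !negb_or andbT => /andP[/andP[r12 r13] r23].
  have [nu nuP] : exists nu, perm_eq lam (nseq t1 r1 ++ nu).
    by apply: perm_nseq_split; rewrite -/(mult lam r1) e1 leq_addl.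
  have [nu' nuP'] : exists nu', perm_eq nu (nseq t2 r2 ++ nu').
    apply: perm_nseq_split; have := permP nuP (pred1 r2).
    rewrite count_cat count_mem_nseq ?(negbTE r12) -/(mult lam r2) e2 mul0n add0n => <-.
    exact: leq_addl.
  have lamP : perm_eq lam (nseq t1 r1 ++ nseq t2 r2 ++ nu').
    by apply: (perm_trans nuP); rewrite perm_cat2l.
  have muP : perm_eq mu [:: r3, r3 & nu'].
    apply: perm_eq_count => x; have := permP lamP (pred1 x).
    rewrite !count_cat !count_mem_nseq /= -/(mult lam x) -/(mult mu x).
    have := e4 x; rewrite !inE !negb_or.
    case: (eqVneq x r1) => [->|x1 /=].
      by rewrite e1 ?eqxx ?(eq_sym r2 r1) ?(negbTE r12) ?(eq_sym r3 r1) ?(negbTE r13) /=; lia.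
    case: (eqVneq x r2) => [->|x2 /=].
      by rewrite e2 ?eqxx ?(negbTE r12) ?(eq_sym r3 r2) ?(negbTE r23) /=; lia.
    case: (eqVneq x r3) => [->|x3 /= ->] //.
      by rewrite e3 ?eqxx ?(negbTE r13) ?(negbTE r23) /=; lia.
  have t12 : t1 != t2.
    apply: contraNneq r12 => t12; move: f1; rewrite f2 t12 => /eqP.
    by rewrite eqn_pmul2l // eq_sym.
  case: (ltngtP t1 t2) t12 => // t12 _.
    by exists r1, r2, r3, t1, t2, nu'; split; split.
  exists r2, r1, r3, t2, t1, nu'; split; split=> //.
  by apply: (perm_trans lamP); rewrite perm_catCA.
Qed.

End SingularStrata.

Section RootLists.
Variable K : fieldType.
Implicit Types s : seq (nat * K).

(** Pairs are (part, root): a list whose first components permute [lam] encodes a preimage of the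
    monic polynomial [pair_prod s] in [Y_lam]. *)
Definition pair_prod s : {poly K} := \prod_(x <- s) ('X - (x.2)%:P) ^+ x.1.

Definition root_mult s (z : K) : nat := (\sum_(x <- s | x.2 == z) x.1)%N.

Lemma perm_pair_prod s s' : perm_eq s s' -> pair_prod s = pair_prod s'.
Proof. by move=> ss'; apply: perm_big. Qed.

Lemma pair_prod_cat s s' : pair_prod (s ++ s') = pair_prod s * pair_prod s'.
Proof. exact: big_cat. Qed.

Lemma pair_prod_nseq n r z : pair_prod (nseq n (r, z)) = ('X - z%:P) ^+ (r * n).
Proof. by rewrite /pair_prod big_nseq /= exprM; elim: n => /= [|n ->]; rewrite ?expr0 ?exprS. Qed.

(** Unique factorization, once each pair is expanded into its root repeated as often as its part
    says. *)
Lemma pair_prod_root_mult s s' : pair_prod s = pair_prod s' -> root_mult s =1 root_mult s'.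
Proof.
pose fl s := flatten [seq nseq x.1 x.2 | x <- s].
have flE t : pair_prod t = \prod_(z <- fl t) ('X - z%:P).
  elim: t => [|x t IH]; first by rewrite /pair_prod !big_nil.
  rewrite /fl /= big_cat /= -/(fl t) -IH /pair_prod big_cons; congr (_ * _).
  by rewrite big_nseq -Monoid.iteropE.
have flc t z : count_mem z (fl t) = root_mult t z.
  elim: t => [|x t IH]; first by rewrite /root_mult big_nil.
  rewrite /fl /= count_cat -/(fl t) IH /root_mult big_cons count_nseq /=.
  by case: eqP => _; rewrite ?mul1n ?mul0n.
by rewrite !flE => /prod_XsubC_eq/permP ss' z; rewrite -!flc ss'.
Qed.

Definition pairs_coprime s := forall r r' z, (r, z) \in s -> (r', z) \in s -> r = r'.

Lemma root_mult_coprime s r z : pairs_coprime s -> (r, z) \in s ->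
  root_mult s z = (r * count_mem (r, z) s)%N.
Proof.
move=> cs rz; rewrite /root_mult -sum1_count big_distrr /= big_seq_cond [RHS]big_seq_cond.
apply: eq_big => [[r' z']|[r' z']] /=; last by move=> /andP[xs /eqP zz]; rewrite ?muln1; move: xs; rewrite zz => xs; exact: cs xs rz.
case: (boolP ((r', z') \in s)) => //= xs; rewrite xpair_eqE; case: eqP => [zz|]; last by rewrite andbF.
by move: xs; rewrite zz => /cs/(_ rz) ->; rewrite eqxx.
Qed.

Variables (d : nat) (lam : seq nat).
Hypothesis hlam : is_partition d lam.
Let lam0 : 0%N \notin lam. Proof. by case/and3P: hlam. Qed.
Let sd : sumn lam = d. Proof. by case/and3P: hlam => _ _ /eqP. Qed.

Variable F : {poly K}.
Hypothesis HF : forall mu, S_set d lam mu -> forall s, perm_eq (unzip1 s) mu -> pair_prod s <> F.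

Let fst_pos s r z : perm_eq (unzip1 s) lam -> (r, z) \in s -> (0 < r)%N.
Proof.
move=> sl rz; have : r \in lam by rewrite -(perm_mem sl); apply/mapP; exists (r, z).
by case: r {rz} => //; rewrite (negbTE lam0).
Qed.

(** Two different parts at one root could be merged into a single part, which would exhibit [F] as a
    point of a stratum of type (a). *)
Lemma preimage_coprime s : perm_eq (unzip1 s) lam -> pair_prod s = F -> pairs_coprime s.
Proof.
move=> sl sF r1 r2 z r1z r2z; apply/eqP/negPn/negP => r12.
have r1p := fst_pos sl r1z; have r2p := fst_pos sl r2z.
have sP := perm_to_rem r1z.
have r2z' : (r2, z) \in rem (r1, z) s.
  by move: r2z; rewrite (perm_mem sP) inE xpair_eqE eq_sym (negbTE r12).
set t := rem (r2, z) (rem (r1, z) s).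
have sP' : perm_eq s [:: (r1, z), (r2, z) & t].
  by apply: (perm_trans sP); rewrite perm_cons; apply: perm_to_rem.
have lP : perm_eq lam [:: r1, r2 & unzip1 t].
  by rewrite perm_sym in sl; apply: (perm_trans sl); apply: (perm_map fst) sP'.
have l0 : 0%N \notin [:: r1, r2 & unzip1 t] by rewrite -(perm_mem lP).
pose mu := (r1 + r2)%N :: unzip1 t.
apply: (HF (mu := sort geq mu) _ (s := (r1 + r2, z)%N :: t)).
- left; left; split.
    apply: sort_geq_partition; last by rewrite -sd (perm_sumn lP) /= addnA.
    by move: l0; rewrite !inE !negb_or => /and3P[_ _ ->]; rewrite andbT; lia.
  exists r1, r2; split; first by split=> //; apply/eqP.
  rewrite /mult; split; rewrite ?count_sort_geq ?(permP lP) /=.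
  + by rewrite eqxx [r2 == r1]eq_sym (negbTE r12) addn_eql // add0n add1n addn1.
  + by rewrite eqxx (negbTE r12) addn_eqr // add0n add1n addn1.
  + by rewrite eqxx ![_ == (r1 + r2)%N]eq_sym addn_eql // addn_eqr // !add0n add1n addn1.
  + move=> r; rewrite !inE !negb_or ![r == _]eq_sym => /and3P[/negbTE n1 /negbTE n2 /negbTE n3].
    by rewrite count_sort_geq (permP lP) /= n1 n2 n3.
- by rewrite perm_sym perm_sort.
- by rewrite -sF (perm_pair_prod sP') /pair_prod !big_cons /= exprD mulrA.
Qed.

(** By coprimality [z] carries [t] copies of the one part [r], so [m = t r]. If [m] were also a part
    of [lam], fusing the copies would place [F] in a stratum of type (b); the presence of [m] is the
    positivity condition of that type. *)
Let no_stratum_b s r z m : perm_eq (unzip1 s) lam -> pair_prod s = F -> (r, z) \in s ->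
  root_mult s z = m -> r != m -> m \notin lam.
Proof.
move=> sl sF rz mz rm; apply/negP => ml.
have cs := preimage_coprime sl sF.
pose t := count_mem (r, z) s.
have mE : m = (r * t)%N by rewrite -mz (root_mult_coprime cs rz).
have [s' sP] := perm_nseq_split (leqnn t).
have rp := fst_pos sl rz.
have tp : (0 < t)%N by rewrite -has_count has_pred1.
have lP : perm_eq lam (nseq t r ++ unzip1 s').
  rewrite perm_sym in sl; apply: (perm_trans sl).
  by have := perm_map fst sP; rewrite map_cat map_nseq.
have l0 : 0%N \notin nseq t r ++ unzip1 s' by rewrite -(perm_mem lP).
have mp : (0 < m)%N by rewrite mE muln_gt0 rp.
apply: (HF (mu := sort geq (m :: unzip1 s')) _ (s := (m, z) :: s')).
- left; right; split.
    apply: sort_geq_partition; last by rewrite -sd (perm_sumn lP) sumn_cat sumn_nseq /= mE.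
    by move: l0; rewrite mem_cat !inE !negb_or => /andP[_ ->]; rewrite andbT; lia.
  exists m, r, t; split; first by split=> //; apply/eqP; rewrite eq_sym.
  rewrite /mult; split; rewrite ?count_sort_geq.
  + by rewrite -has_count has_pred1.
  + by rewrite (permP lP) count_cat count_mem_nseq (negbTE rm) /= eqxx; lia.
  + by rewrite (permP lP) count_cat count_mem_nseq eqxx /= eq_sym (negbTE rm); lia.
  + move=> x; rewrite !inE !negb_or ![x == _]eq_sym => /andP[/negbTE n1 /negbTE n2].
    by rewrite count_sort_geq (permP lP) count_cat count_mem_nseq /= n1 n2.
- by rewrite perm_sym perm_sort.
- by rewrite -sF (perm_pair_prod sP) pair_prod_cat pair_prod_nseq -mE /pair_prod big_cons.
Qed.

(** The parts at [z] all equal [r] and add up to [m], while [z'] carries enough copies of [r'] to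
    form another [m]. Fusing both groups places [F] in a stratum of type (c). *)
Let no_stratum_c s r z r' z' m : perm_eq (unzip1 s) lam -> pair_prod s = F ->
  (r, z) \in s -> (r', z') \in s -> r != r' -> r != m -> r' != m ->
  root_mult s z = m -> (m <= root_mult s z')%N -> (r' %| m)%N -> False.
Proof.
move=> sl sF rz rz' rr' rm rm' mz mz' /dvdnP[t' mE'].
have cs := preimage_coprime sl sF.
pose t := count_mem (r, z) s.
have mE : m = (t * r)%N by rewrite -mz (root_mult_coprime cs rz) mulnC.
have rp := fst_pos sl rz; have rp' := fst_pos sl rz'.
have tp : (0 < t)%N by rewrite -has_count has_pred1.
have mp : (0 < m)%N by rewrite mE muln_gt0 tp.
have tp' : (0 < t')%N by move: mp; rewrite mE' muln_gt0 => /andP[].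
have [s' sP] := perm_nseq_split (leqnn t).
have [s'' sP'] : exists s'', perm_eq s' (nseq t' (r', z') ++ s'').
  apply: perm_nseq_split.
  have := permP sP (pred1 (r', z')); rewrite count_cat count_mem_nseq xpair_eqE (negbTE rr') mul0n add0n => <-.
  rewrite -(leq_pmul2l rp') -(root_mult_coprime cs rz') (leq_trans _ mz') // mE' mulnC //.
have {}sP : perm_eq s (nseq t (r, z) ++ nseq t' (r', z') ++ s'').
  by apply: (perm_trans sP); rewrite perm_cat2l.
have lP : perm_eq lam (nseq t r ++ nseq t' r' ++ unzip1 s'').
  rewrite perm_sym in sl; apply: (perm_trans sl).
  by have := perm_map fst sP; rewrite !map_cat !map_nseq.
have l0 : 0%N \notin nseq t r ++ nseq t' r' ++ unzip1 s'' by rewrite -(perm_mem lP).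
apply: (HF (mu := sort geq [:: m, m & unzip1 s'']) _ (s := [:: (m, z), (m, z') & s''])).
- right; split.
    apply: sort_geq_partition; last first.
      by rewrite -sd (perm_sumn lP) !sumn_cat !sumn_nseq /= [(r * t)%N]mulnC -mE [(r' * t')%N]mulnC -mE'.
    by move: l0; rewrite !mem_cat !inE !negb_or => /and3P[_ _ ->]; rewrite andbT; lia.
  exists r, r', m, t, t'; split; first by split.
  split; first by split=> //; rewrite /= !inE !negb_or rr' rm rm'.
  rewrite /mult; split; rewrite ?count_sort_geq.
  + rewrite (permP lP) !count_cat !count_mem_nseq eqxx [r' == r]eq_sym (negbTE rr') /=.
    by rewrite eq_sym (negbTE rm); lia.
  + rewrite (permP lP) !count_cat !count_mem_nseq eqxx (negbTE rr') /=.
    by rewrite eq_sym (negbTE rm'); lia.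
  + by rewrite (permP lP) !count_cat !count_mem_nseq (negbTE rm) (negbTE rm') /= eqxx; lia.
  + move=> x; rewrite !inE !negb_or ![x == _]eq_sym => /and3P[/negbTE n1 /negbTE n2 /negbTE n3].
    by rewrite count_sort_geq (permP lP) !count_cat !count_mem_nseq /= n1 n2 n3.
- by rewrite perm_sym perm_sort.
- rewrite -sF (perm_pair_prod sP) !pair_prod_cat !pair_prod_nseq [(r * t)%N]mulnC -mE.
  by rewrite [(r' * t')%N]mulnC -mE' /pair_prod !big_cons.
Qed.

(* Among the roots where two preimages disagree take one of minimal multiplicity
   [m]: merging its parts into a single [m], possibly together with parts at a
   second such root, leads to a stratum (b) or (c). *)
Lemma preimage_unique s s' : perm_eq (unzip1 s) lam -> perm_eq (unzip1 s') lam ->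
  pair_prod s = F -> pair_prod s' = F -> perm_eq s s'.
Proof.
move=> sl sl' sF sF'.
have cs := preimage_coprime sl sF; have cs' := preimage_coprime sl' sF'.
have MM : root_mult s =1 root_mult s' by apply: pair_prod_root_mult; rewrite sF sF'.
have mult_pos t r z : perm_eq (unzip1 t) lam -> (r, z) \in t -> (0 < root_mult t z)%N.
  move=> tl rz; rewrite /root_mult (big_rem _ rz) /= eqxx addn_gt0.
  by rewrite (fst_pos tl rz).
have mult_mem t z : (0 < root_mult t z)%N -> exists r, (r, z) \in t.
  move=> tz; apply: contrapT => none; move: tz; rewrite /root_mult big_seq_cond big1 //.
  by move=> [r z'] /= /andP[rz /eqP zz]; case: none; exists r; rewrite -zz.
pose bad z := exists r r', [/\ (r, z) \in s, (r', z) \in s' & r != r'].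
have good z : ~ bad z -> forall r, count_mem (r, z) s = count_mem (r, z) s'.
  move=> nb r.
  have [rz|nrz] := boolP ((r, z) \in s).
    have [r' rz'] : exists r', (r', z) \in s'.
      by apply: mult_mem; rewrite -MM; apply: mult_pos rz.
    have e : r = r' by apply/eqP/negPn/negP => ne; apply: nb; exists r, r'.
    rewrite -e in rz'; have := MM z; rewrite (root_mult_coprime cs rz) (root_mult_coprime cs' rz').
    by move/eqP; rewrite eqn_pmul2l ?(fst_pos sl rz) // => /eqP.
  have [rz'|nrz'] := boolP ((r, z) \in s'); last by rewrite (count_memPn nrz) (count_memPn nrz').
  have [r' rz] : exists r', (r', z) \in s.
    by apply: mult_mem; rewrite MM; apply: mult_pos rz'.
  have e : r' = r by apply/eqP/negPn/negP => ne; apply: nb; exists r', r.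
  by rewrite -e rz in nrz.
have [[z0 bz0]|nobad] := pselect (exists z, bad z); last first.
  by apply: perm_eq_count => -[r z]; apply: good => bz; apply: nobad; exists z.
exfalso.
have ex : exists m, `[< exists z, bad z /\ root_mult s z = m >].
  by exists (root_mult s z0); apply/asboolP; exists z0.
case: (ex_minnP ex) => m /asboolP[z1 [[r [r' [rz rz' rr']]] mz]] mmin.
have r'm : (r' %| m)%N.
  by rewrite -mz MM (root_mult_coprime cs' rz') dvdn_mulr.
have memlam (t : seq (nat * K)) (x : nat) (z : K) : perm_eq (unzip1 t) lam -> (x, z) \in t -> x \in lam.
  by move=> tl xz; rewrite -(perm_mem tl); apply/mapP; exists (x, z).
(* If one preimage carries the undivided part [m] at [z1], then [m] is a part of [lam] and the other
   preimage falls under type (b). *)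
have [rm|rm] := eqVneq r m.
  have := no_stratum_b sl' sF' rz' (esym (MM z1)); rewrite mz -rm eq_sym rr' => /(_ isT).
  by rewrite (memlam s r z1 sl rz).
have [rm'|rm'] := eqVneq r' m.
  have := no_stratum_b sl sF rz mz rm.
  by rewrite -rm' (memlam s' r' z1 sl' rz').
(* Otherwise [r'] would occur at every root at most as often in [s] as in [s']. The totals agree, so
   the occurrences would agree too, whereas at [z1] only [s'] has [r']. Minimality of [m] then makes
   the multiplicity at [z2] large enough for type (c). *)
have [z2 [rz2 bz2]] : exists z2, (r', z2) \in s /\ bad z2.
  apply: contrapT => none.
  pose col (t : seq (nat * K)) := [seq x.2 | x <- t & x.1 == r'].
  have ccol t z : count_mem z (col t) = count_mem (r', z) t.
    rewrite count_map count_filter; apply: eq_count => -[a b] /=.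
    by rewrite xpair_eqE andbC.
  have scol t : perm_eq (unzip1 t) lam -> size (col t) = count_mem r' lam.
    move=> tl; rewrite size_map size_filter -(permP tl) count_map; exact: eq_count.
  have /count_subseqP[u su pu] : forall z, (count_mem z (col s) <= count_mem z (col s'))%N.
    move=> z; rewrite !ccol; have [rzs|nrzs] := boolP ((r', z) \in s); last by rewrite (count_memPn nrzs).
    by rewrite good // => bz; apply: none; exists z.
  have uE : u = col s'.
    apply/eqP; rewrite -(geq_leqif (size_subseq_leqif su)).
    by rewrite -(perm_size pu) !scol.
  have : z1 \in col s by rewrite (perm_mem pu) uE; apply/mapP; exists (r', z1); rewrite ?mem_filter ?eqxx.
  case/mapP => -[a b]; rewrite mem_filter => /andP[/eqP /= -> bs] zb.
  by rewrite zb in rz; move: rr'; rewrite (cs _ _ _ rz bs) eqxx.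
apply: (no_stratum_c sl sF rz rz2 rr' rm rm' mz _ r'm).
by apply: mmin; apply/asboolP; exists z2.
Qed.

End RootLists.

(** * Unramifiedness *)

Section Derivation.
Variables (K : fieldType) (S : comNzRingType) (ev dl : {poly S} -> {poly K}).
Hypotheses (ev1 : ev 1 = 1) (evM : forall P Q, ev (P * Q) = ev P * ev Q).
Hypotheses (dl1 : dl 1 = 0) (dlM : forall P Q, dl (P * Q) = dl P * ev Q + ev P * dl Q).

Lemma derivation_exp P m : dl (P ^+ m) = (dl P * ev P ^+ m.-1) *+ m.
Proof.
have evX k : ev (P ^+ k) = ev P ^+ k by elim: k => [|k IH]; rewrite ?ev1 // !exprS evM IH.
elim: m => [|m IH]; first by rewrite expr0 dl1 mulr0n.
rewrite exprS dlM IH evX mulrS /= -mulrnAr -mulrnAr; congr (_ + _).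
case: m {IH} => [|m]; first by rewrite !mulr0n !mulr0.
by rewrite /= !mulrnAr exprS; congr (_ *+ _); ring.
Qed.

(* [dl (\prod_i P i ^+ i)] divided by [\prod_i P i ^+ i.-1]. *)
Fixpoint log_deriv (P : nat -> {poly S}) (r : seq nat) : {poly K} :=
  if r is i :: r' then
    (dl (P i) * \prod_(j <- r') ev (P j)) *+ i + ev (P i) * log_deriv P r'
  else 0.

Lemma log_derivE P r : 0%N \notin r -> dl (\prod_(i <- r) P i ^+ i) =
  (\prod_(i <- r) ev (P i) ^+ i.-1) * log_deriv P r.
Proof.
elim: r => [|i r IH]; first by rewrite !big_nil dl1 mulr0.
rewrite inE negb_or => /andP[i0 r0]; rewrite !big_cons dlM IH // derivation_exp /=.
have evX Q k : ev (Q ^+ k) = ev Q ^+ k by elim: k => [|k IHk]; rewrite ?ev1 // !exprS evM IHk.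
have eX k (x : {poly K}) : 0%N != k -> x ^+ k = x * x ^+ k.-1 by case: k => // k _; rewrite exprS.
have -> : ev (\prod_(j <- r) P j ^+ j) =
    \prod_(j <- r) ev (P j) ^+ j.-1 * \prod_(j <- r) ev (P j).
  elim: r r0 {IH} => [|j r IH]; first by rewrite !big_nil ev1 mulr1.
  rewrite inE negb_or => /andP[j0 r0]; rewrite !big_cons evM IH // evX.
  by rewrite (eX j) //; ring.
rewrite evX (eX i) //.
move: (\prod_(j <- r) ev (P j) ^+ j.-1) (\prod_(j <- r) ev (P j)) => a b.

rewrite mulrnAl mulrDr mulrnAr.
by congr (_ *+ _ + _); ring.
Qed.

Hypothesis char0 : forall m : nat, m%:R = 0 :> K -> m = 0%N.

(** Modulo [ev (P i)] a single term survives, so [ev (P i)] divides [dl (P i)] times a coprime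
    factor, hence [dl (P i)] itself, which has smaller degree. This is the injectivity of the
    differential at pairwise coprime factors; characteristic 0 makes the exponent [i] invertible. *)
Lemma log_deriv_eq0 (P : nat -> {poly S}) (r : seq nat) : 0%N \notin r -> uniq r ->
  {in r &, forall i j, i != j -> coprimep (ev (P i)) (ev (P j))} ->
  {in r, forall i, ev (P i) != 0 /\ (size (dl (P i)) < size (ev (P i)))%N} ->
  log_deriv P r = 0 -> {in r, forall i, dl (P i) = 0}.
Proof.
elim: r => // i r IH; rewrite inE negb_or => /andP[i0 r0] /= /andP[ir ur] cop sz W0.
have [nPi sPi] : ev (P i) != 0 /\ (size (dl (P i)) < size (ev (P i)))%N.
  by apply: sz; rewrite mem_head.
have copr : coprimep (ev (P i)) (\prod_(j <- r) ev (P j)).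
  rewrite big_seq; apply: (big_ind (fun q => coprimep (ev (P i)) q)).
  - exact: coprimep1.
  - by move=> a b ca cb; rewrite coprimepMr ca.
  - move=> j jr; apply: cop; rewrite ?inE ?eqxx ?jr ?orbT //.
    by apply: contraNneq ir => ->.
have dPi : dl (P i) = 0.
  apply/eqP; apply: contraTT sPi => nd; rewrite -leqNgt dvdp_leq //.
  rewrite -(Gauss_dvdpl _ copr).
  have : ev (P i) %| (dl (P i) * \prod_(j <- r) ev (P j)) *+ i.
    by rewrite -[_ *+ i](addrK (ev (P i) * log_deriv P r)) W0 sub0r dvdpNr dvdp_mulr.
  rewrite -scaler_nat dvdpZr //; apply: contraNneq i0 => /char0 ->; exact: eqxx.
move: W0; rewrite dPi mul0r mul0rn add0r => /eqP; rewrite mulf_eq0 (negbTE nPi) /= => /eqP W0.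
have Hr : {in r, forall i, dl (P i) = 0}.
  apply: IH => //; first by move=> a b ar br; apply: cop; rewrite inE ?ar ?br orbT.
  by move=> a ar; apply: sz; rewrite inE ar orbT.
by move=> j; rewrite inE => /orP[/eqP ->|/Hr].
Qed.

End Derivation.

Lemma monic_prod_size (R : comNzRingType) (s : seq nat) (G : nat -> {poly R}) (e m : nat -> nat) :
  {in s, forall r, G r \is monic /\ size (G r) = (e r).+1} ->
  \prod_(r <- s) G r ^+ m r \is monic /\
  size (\prod_(r <- s) G r ^+ m r) = (\sum_(r <- s) m r * e r).+1.
Proof.
move=> HG; rewrite big_seq [X in (_ = X.+1)%N]big_seq.
apply: (big_rec2 (fun (p : {poly R}) k => p \is monic /\ size p = k.+1)).
  by rewrite monic1 size_poly1.
move=> r k p rs' [mp sp]; have [mG sG] := HG r rs'.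
have [mX sX] : G r ^+ m r \is monic /\ size (G r ^+ m r) = (m r * e r).+1.
  elim: (m r) => [|j [mj sj]]; first by rewrite expr0 monic1 size_poly1.
  by rewrite exprS monicMl // size_Mmonic ?monic_neq0 // sG sj; split=> //; rewrite mulSn; lia.
by rewrite monicMl // size_Mmonic ?monic_neq0 // sX sp; split=> //; lia.
Qed.

(** * Coefficients and roots of the factors as coordinates *)

Section PartIndices.
Variable lam : seq nat.

(* Pairs [(r, k)] with [k < e_r]: the parts of [lam], numbered within each size. *)
Definition part_index : seq (nat * nat) :=
  [seq (r, k) | r <- undup lam, k <- iota 0 (count_mem r lam)].
Let n := size part_index.
Let idx (i : nat) := nth (0, 0)%N part_index i.

Lemma part_index_uniq : uniq part_index.
Proof.
apply: allpairs_uniq_dep; [exact: undup_uniq | by move=> r _; apply: iota_uniq |].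
by move=> [r k] [r' k'] _ _ /= [-> ->].
Qed.

Lemma mem_part_index r k : ((r, k) \in part_index) = (k < count_mem r lam)%N.
Proof.
apply/allpairsPdep/idP => [[r' [k' [_ kr [-> ->]]]]|kr].
  by move: kr; rewrite mem_iota.
exists r, k; rewrite mem_iota kr mem_undup; split=> //.
by rewrite -has_pred1 has_count (leq_ltn_trans _ kr).
Qed.

Lemma part_index_mem (i : 'I_n) : (idx i).1 \in lam.
Proof.
have : idx i \in part_index by exact: mem_nth.
rewrite [idx i]surjective_pairing mem_part_index => ik.
by rewrite -has_pred1 has_count (leq_ltn_trans _ ik).
Qed.

Lemma big_part_index (R : Type) (x0 : R) (op : Monoid.com_law x0) (f : nat * nat -> R) r :
  r \in lam ->
  \big[op/x0]_(i < n | (idx i).1 == r) f (idx i) =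
  \big[op/x0]_(0 <= k < count_mem r lam) f (r, k).
Proof.
move=> rl; transitivity (\big[op/x0]_(x <- part_index | x.1 == r) f x).
  by rewrite (big_nth (0, 0)%N) big_mkord.
rewrite big_mkcond big_allpairs_dep (big_rem r) /= ?mem_undup // eqxx.
rewrite [X in op _ X]big_seq_cond [X in op _ X]big1 ?Monoid.mulm1 ?/index_iota ?subn0 //.
move=> r'; rewrite andbT mem_rem_uniq ?undup_uniq // inE => /andP[/negbTE r'r _].
by rewrite r'r big1.
Qed.

Lemma perm_unzip1_part_index : perm_eq (unzip1 part_index) lam.
Proof.
apply: perm_eq_count => r.
rewrite count_map -sum1_count big_mkcond big_allpairs_dep /=.
have [rl|rl] := boolP (r \in lam); last first.
  rewrite (count_memPn rl) big_seq big1 // => r'; rewrite mem_undup => r'l.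
  by rewrite big1 // => k _; case: eqP => // rr; rewrite -rr r'l in rl.
rewrite (big_rem r) /= ?mem_undup // eqxx sum1_size size_iota.
rewrite big_seq_cond big1 ?addn0 //.
move=> r'; rewrite andbT mem_rem_uniq ?undup_uniq // inE => /andP[/negbTE r'r _].
by rewrite r'r big1.
Qed.

Section Polynomials.
Variable R : comNzRingType.

(** Affine chart of [Y_lam] by the lower coefficients of monic [G_r]. A repeated root within one
    [G_r] causes no ramification here, unlike in the coordinates of [root_factor]. *)
Definition coef_factor (y : 'I_n -> R) (r : nat) : {poly R} :=
  'X^(count_mem r lam) + \sum_(i < n | (idx i).1 == r) y i *: 'X^((idx i).2).

Definition root_factor (z : 'I_n -> R) (r : nat) : {poly R} :=
  \prod_(i < n | (idx i).1 == r) ('X - (z i)%:P).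

Definition factor_prod (G : nat -> {poly R}) : {poly R} := \prod_(r <- undup lam) G r ^+ r.

Definition monic_factors (G : nat -> {poly R}) :=
  {in lam, forall r, G r \is monic /\ size (G r) = (count_mem r lam).+1}.

Lemma coef_factor_small (y : 'I_n -> R) r :
  (size (\sum_(i < n | (idx i).1 == r) y i *: 'X^((idx i).2) : {poly R})%R <= count_mem r lam)%N.
Proof.
apply: (leq_trans (size_sum _ _ _)); apply/bigmax_leqP => i /eqP ir.
apply: (leq_trans (size_scale_leq _ _)); rewrite size_polyXn.
by rewrite -mem_part_index -ir -surjective_pairing mem_nth.
Qed.

Lemma coef_factor_monic y : monic_factors (coef_factor y).
Proof.
move=> r _; have sy := coef_factor_small y r.
have sG : size (coef_factor y r) = (count_mem r lam).+1.
  by rewrite size_polyDl size_polyXn.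
split=> //; rewrite monicE lead_coefE sG /= coefD coefXn eqxx.
by rewrite [X in _ + X]nth_default ?addr0.
Qed.

Lemma root_factor_monic z : monic_factors (root_factor z).
Proof.
move=> r rl; split; first exact: monic_prod_XsubC.
rewrite /root_factor -big_filter size_prod_XsubC; congr _.+1.
rewrite size_filter -sum1_count.
by rewrite (big_part_index _ (fun=> 1%N)) // sum1_size size_iota subn0.
Qed.

Lemma coef_factor_coef (y : 'I_n -> R) (i : 'I_n) : (coef_factor y (idx i).1)`_(idx i).2 = y i.
Proof.
have im : idx i \in part_index by exact: mem_nth.
have ki : ((idx i).2 < count_mem (idx i).1 lam)%N by rewrite -mem_part_index -surjective_pairing.
rewrite coefD coefXn ltn_eqF // add0r coef_sum (bigD1 i) //= coefZ coefXn eqxx mulr1.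
rewrite big1 ?addr0 // => j /andP[/eqP ji nji]; rewrite coefZ coefXn.
case: eqP => [ij|]; last by rewrite mulr0.
case/negP: nji; apply/eqP/val_inj/eqP; rewrite -(nth_uniq (0, 0)%N (ltn_ord j) (ltn_ord i) part_index_uniq).
by rewrite -/(idx j) -/(idx i) [idx j]surjective_pairing ji -ij -surjective_pairing.
Qed.

Lemma coef_factor_inj (y y' : 'I_n -> R) :
  {in lam, coef_factor y =1 coef_factor y'} -> y =1 y'.
Proof.
move=> yy' i; rewrite -!coef_factor_coef yy' //.
exact: part_index_mem.
Qed.

Lemma coef_factor_surj (G : nat -> {poly R}) : monic_factors G ->
  exists y : 'I_n -> R, {in lam, coef_factor y =1 G}.
Proof.
move=> HG; exists (fun i => (G (idx i).1)`_(idx i).2) => r rl.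
have [mG sG] := HG r rl; rewrite /coef_factor.
rewrite (big_part_index _ (fun x : nat * nat => (G x.1)`_x.2 *: 'X^(x.2))) //=.
rewrite -[RHS]coefK sG poly_def big_mkord big_ord_recr /= addrC; congr (_ + _).
by have := monicP mG; rewrite lead_coefE sG /= => ->; rewrite scale1r.
Qed.

Lemma sum_undup_count (f : nat -> nat) :
  (\sum_(r <- undup lam) f r * count_mem r lam = \sum_(r <- lam) f r)%N.
Proof.
rewrite -(perm_big _ perm_unzip1_part_index) big_map big_allpairs_dep /=.
by apply: eq_bigr => r _; rewrite big_const_seq count_predT size_iota iter_addn_0.
Qed.

Lemma factor_prod_monic (G : nat -> {poly R}) : monic_factors G ->
  factor_prod G \is monic /\ size (factor_prod G) = (sumn lam).+1.
Proof.
move=> HG; have [] := @monic_prod_size R (undup lam) G (fun r => count_mem r lam) id.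
  by move=> r; rewrite mem_undup; apply: HG.
by rewrite (sum_undup_count id) sumnE.
Qed.

Lemma root_factor_prod (z : 'I_n -> R) (i : 'I_n) : 0%N \notin lam ->
  (factor_prod (root_factor z)).[z i] = 0.
Proof.
move=> lam0; have il := part_index_mem i; rewrite -mem_undup in il.
rewrite /factor_prod horner_prod (big_rem _ il) /= horner_exp.
rewrite [X in X ^+ _](_ : _ = 0); last first.
  by rewrite /root_factor horner_prod (bigD1 i) //= hornerXsubC subrr mul0r.
rewrite expr0n; case: (idx i).1 (part_index_mem i) => [r0|r _]; last by rewrite mul0r.
by rewrite r0 in lam0.
Qed.

Lemma prod_group (s : seq (nat * R)) (m : nat -> nat) : perm_eq (unzip1 s) lam ->
  \prod_(x <- s) ('X - (x.2)%:P) ^+ m x.1 =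
  \prod_(r <- undup lam) (\prod_(x <- s | x.1 == r) ('X - (x.2)%:P)) ^+ m r.
Proof.
move=> sl; under [RHS]eq_bigr => r _ do rewrite -prodrXl big_mkcond.
rewrite exchange_big /= big_seq [RHS]big_seq; apply: eq_bigr => x xs.
have xl : x.1 \in undup lam by rewrite mem_undup -(perm_mem sl) map_f.
rewrite (big_rem x.1 xl) /= eqxx big_seq big1 ?mulr1 // => r.
rewrite mem_rem_uniq ?undup_uniq // inE.
by case: (eqVneq x.1 r) => // ->; rewrite eqxx.
Qed.

End Polynomials.

Lemma map_coef_factor (R S : comNzRingType) (f : {rmorphism R -> S}) (y : 'I_n -> R) r :
  map_poly f (coef_factor y r) = coef_factor (f \o y) r.
Proof.
rewrite rmorphD /= map_polyXn rmorph_sum; congr (_ + _).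
by apply: eq_bigr => i _; rewrite /= map_polyZ map_polyXn.
Qed.

Lemma map_root_factor (R S : comNzRingType) (f : {rmorphism R -> S}) (z : 'I_n -> R) r :
  map_poly f (root_factor z r) = root_factor (f \o z) r.
Proof. by rewrite rmorph_prod; apply: eq_bigr => i _; rewrite /= map_polyXsubC. Qed.

Lemma map_factor_prod (R S : comNzRingType) (f : {rmorphism R -> S}) (G : nat -> {poly R}) :
  map_poly f (factor_prod G) = factor_prod (fun r => map_poly f (G r)).
Proof. by rewrite rmorph_prod; apply: eq_bigr => r _; rewrite rmorphXn. Qed.

Lemma eq_factor_prod (R : comNzRingType) (G G' : nat -> {poly R}) :
  {in lam, G =1 G'} -> factor_prod G = factor_prod G'.
Proof.
move=> GG; rewrite /factor_prod big_seq [RHS]big_seq; apply: eq_bigr => r.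
by rewrite mem_undup => /GG ->.
Qed.

Section Roots.
Variable K : closedFieldType.
Implicit Types (G : nat -> {poly K}) (z : 'I_n -> K) (s : seq (nat * K)).

Lemma root_factor_surj G : monic_factors G ->
  exists z, {in lam, root_factor z =1 G}.
Proof.
move=> HG; pose zs r := sval (closed_field_poly_normal (G r)).
exists (fun i => (zs (idx i).1)`_(idx i).2) => r rl; have [mG sG] := HG r rl.
have GE : G r = \prod_(z <- zs r) ('X - z%:P).
  have E : G r = lead_coef (G r) *: \prod_(z <- zs r) ('X - z%:P).
    exact: (svalP (closed_field_poly_normal (G r))).
  by rewrite [LHS]E (monicP mG) scale1r.
rewrite GE /root_factor (big_part_index _ (fun x : nat * nat => 'X - ((zs x.1)`_x.2)%:P)) //=.
have -> : count_mem r lam = size (zs r).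
  by apply/eqP; rewrite -eqSS -sG GE size_prod_XsubC.
by rewrite [RHS](big_nth 0).
Qed.

Definition root_pairs z : seq (nat * K) := [seq ((idx i).1, z i) | i : 'I_n <- enum 'I_n].

Lemma root_pairs_lam z : perm_eq (unzip1 (root_pairs z)) lam.
Proof.
suff -> : unzip1 (root_pairs z) = unzip1 part_index by exact: perm_unzip1_part_index.
rewrite /root_pairs /unzip1 -map_comp -[in RHS](mkseq_nth (0, 0)%N part_index).
by rewrite -[RHS]map_comp -val_enum_ord -map_comp; apply: eq_map.
Qed.

Lemma root_pairs_factor z r :
  \prod_(x <- root_pairs z | x.1 == r) ('X - (x.2)%:P) = root_factor z r.
Proof. by rewrite big_map big_enum_cond. Qed.

Lemma prod_root_pairs z (m : nat -> nat) :
  \prod_(x <- root_pairs z) ('X - (x.2)%:P) ^+ m x.1 =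
  \prod_(r <- undup lam) root_factor z r ^+ m r.
Proof.
rewrite (prod_group _ (root_pairs_lam z)).
by apply: eq_bigr => r _; rewrite root_pairs_factor.
Qed.

Lemma root_pairsP s : perm_eq (unzip1 s) lam -> exists z,
  {in lam, forall r, root_factor z r = \prod_(x <- s | x.1 == r) ('X - (x.2)%:P)}.
Proof.
move=> sl; apply: root_factor_surj => r _; rewrite monic_prod_XsubC -big_filter; split=> //.
rewrite size_prod_XsubC -(permP sl) count_map size_filter; congr _.+1; exact: eq_count.
Qed.

End Roots.
End PartIndices.

(** * Tangent vectors in an affine chart and directional derivatives *)

Section AffineChart.
Variable K : numClosedFieldType.

Lemma line_derivative n (P : {mpoly K[n]}) (p w : 'I_n -> K) :
  (mmap polyC (fun i => (p i)%:P + w i *: 'X) P)`_1 = \sum_i (P^`M(i)).@[p] * w i.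
Proof.
pose Q (q : {poly K}) : Prop := 'X^2 %| q.
have idQ : is_ideal Q.
  by split=> [|a b|a b]; rewrite /Q ?dvdp0 //; [apply: dvdp_add | apply: dvdp_mull].
pose u i := ((p i)%:P + w i *: 'X) - (p i)%:P.
have uE i : u i = w i *: 'X by rewrite /u addrC addKr.
have Quu i j : Q (u i * u j).
  by rewrite !uE /Q expr2 -!mul_polyC mulrACA dvdp_mull.
have /dvdpP[q] := mpoly_taylor P idQ Quu.
move/(congr1 (fun r : {poly K} => r`_1)); rewrite coefMXn /= !coefB coefC /= subr0.
move/eqP; rewrite subr_eq0 => /eqP ->; rewrite coef_sum; apply: eq_bigr => i _.
by rewrite -/(u i) uE coefCM coefZ coefX mulr1.
Qed.

(* Tangent vectors to the hyperplane [x_n = 1] only see the equations of the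
   affine cone over [X] in that hyperplane. *)
Lemma tangent_dehomogenize n (X : set 'rV[K]_n.+1) (p w : 'rV[K]_n.+1) (e : {mpoly K[n.+1]}) :
  is_cone X -> (forall x, X x -> x 0 ord_max = 1 -> e.@[x 0] = 0) ->
  X p -> p 0 ord_max = 1 -> w 0 ord_max = 0 -> tangent_cone_space X p w ->
  \sum_k (e^`M(k)).@[p 0] * w 0 k = 0.
Proof.
move=> coneX eX Xp p1 w0 Tw; have [N [H [hH HE]]] := homogenize e.
have HE1 x : x ord_max = 1 -> H.@[x] = e.@[x].
  move=> x1; have := HE 1 x x1; rewrite expr1n mul1r => <-.
  by apply: meval_eq => i; rewrite mul1r.
(* The last coordinate makes the form vanish also at the points of [X] outside the chart. At [p]
   this coordinate is 1 and [H] is 0, so the differential of the product is that of [H]. *)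
have HX : hom_ideal X (H * 'X_ord_max).
  split; first by exists (N + 1)%N; apply: dhomogM => //; rewrite dhomogX /= mdeg1.
  move=> x _ Xx; rewrite mevalM mevalXU.
  have [->|nx] := eqVneq (x 0 ord_max) 0; first by rewrite mulr0.
  have y1 : ((x 0 ord_max)^-1 *: x) 0 ord_max = 1 by rewrite mxE mulVf.
  have := HE (x 0 ord_max) (((x 0 ord_max)^-1 *: x) 0) y1.
  rewrite (eX _ _ y1) ?mulr0; last by apply: coneX => //; rewrite invr_eq0.
  have -> : H.@[fun i => x 0 ord_max * ((x 0 ord_max)^-1 *: x) 0 i] = H.@[x 0].
    by apply: meval_eq => i; rewrite mxE mulrA mulfV // mul1r.
  by move=> ->; rewrite mul0r.
have Hp : H.@[p 0] = 0 by rewrite HE1 // eX.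
rewrite -(line_derivative e (p 0) (w 0)) -[RHS](Tw _ HX).
have -> : \sum_i ((H * 'X_ord_max)^`M(i)).@[p 0] * w 0 i = \sum_i (H^`M(i)).@[p 0] * w 0 i.
  apply: eq_bigr => i _; rewrite mderivM mevalD !mevalM mevalXU p1 mulr1 Hp mul0r.
  by rewrite addr0.
rewrite -(line_derivative H (p 0) (w 0)).
(* The line through [p] in the direction [w] stays in the chart, because the last coordinate of [w]
   is 0, and there [e] and [H] agree. *)
suff -> : mmap polyC (fun i => (p 0 i)%:P + w 0 i *: 'X) e =
  mmap polyC (fun i => (p 0 i)%:P + w 0 i *: 'X) H by [].
apply/eqP; rewrite -subr_eq0; apply/eqP; apply: poly_all_eq0 => s.
rewrite hornerD hornerN !horner_mmap HE1 ?subrr //.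
by rewrite p1 w0 scale0r addr0 hornerC.
Qed.

End AffineChart.

Section DirectionalDerivative.
Variables (K : fieldType) (n : nat) (q u : 'I_n -> K).

Let f (c : {mpoly K[n]}) := \sum_j u j * (c^`M(j)).@[q].

(** Derivative at [q] along [u], coefficient by coefficient, of a polynomial whose coefficients vary
    with the coordinates. It is a derivation over evaluation at [q], as [log_derivE] requires. *)
Definition directional (P : {poly {mpoly K[n]}}) : {poly K} := map_poly f P.

Lemma coef_directional P k : (directional P)`_k = \sum_j u j * (P`_k^`M(j)).@[q].
Proof.
rewrite coef_map_id0 // /f big1 // => j _.
by rewrite raddf0 meval0 mulr0.
Qed.

Let f_sum I (r : seq I) (F : I -> {mpoly K[n]}) : f (\sum_(i <- r) F i) = \sum_(i <- r) f (F i).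
Proof.
rewrite /f exchange_big /=; apply: eq_bigr => j _.
by rewrite (linear_sum (mderiv j)) rmorph_sum mulr_sumr.
Qed.

Lemma directionalM P Q : directional (P * Q) =
  directional P * map_poly (meval q) Q + map_poly (meval q) P * directional Q.
Proof.
apply/polyP => k; rewrite coef_directional coefD !coefM -/(f _) f_sum -big_split.
apply: eq_bigr => i _; rewrite !coef_map /= !coef_directional mulr_suml mulr_sumr -big_split.
apply: eq_bigr => j _ /=; rewrite mderivM mevalD !mevalM mulrDr; congr (_ + _); ring.
Qed.

Lemma directional1 : directional 1 = 0.
Proof.
apply/polyP => k; rewrite coef_directional coef0 big1 // => j _.
by rewrite coef1 -mpolyC_nat mderivC meval0 mulr0.
Qed.

Lemma directional_affine m (P : pred 'I_n) (g : 'I_n -> nat) :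
  directional ('X^m + \sum_(i | P i) 'X_i *: 'X^(g i)) = \sum_(i | P i) u i *: 'X^(g i).
Proof.
have fX i : f 'X_i = u i.
  rewrite /f (bigD1 i) //= mderivX mnm1E eqxx big1 ?addr0 => [|j ji].
    have -> : (U_(i) - U_(i))%MM = 0%MM by apply/mnmP => l; rewrite mnmBE mnm0E subnn.
    by rewrite mpolyX0 scale1r meval1 mulr1.
  by rewrite mderivX mnm1E eq_sym (negbTE ji) mulr0n scale0r meval0 mulr0.
have f0 (b : bool) : f b%:R = 0.
  by rewrite /f big1 // => j _; rewrite -mpolyC_nat mderivC meval0 mulr0.
have fD a b : f (a + b) = f a + f b.
  rewrite /f -big_split; apply: eq_bigr => j _.
  by rewrite mderivD mevalD mulrDr.
apply/polyP => k; rewrite coef_directional -/(f _) coefD fD coefXn f0 add0r.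
rewrite !coef_sum big_mkcond f_sum [RHS]big_mkcond; apply: eq_bigr => i _.
case: (P i); last exact: (f0 false).
rewrite !coefZ !coefXn; case: eqP => _; first by rewrite !mulr1 fX.
by rewrite !mulr0 (f0 false).
Qed.

End DirectionalDerivative.

(** * Tangent spaces at points with a unique preimage *)

(** One numbering of the roots serves all exponents at once: [id] gives the polynomial itself,
    [predn] the common factor of its tangent vectors. *)
Lemma pairs_lin_prod (K : fieldType) (t : seq (nat * K)) (lam : seq nat) :
  perm_eq (unzip1 t) lam -> exists z : nat -> K, forall m : nat -> nat,
  \prod_(x <- t) ('X - (x.2)%:P) ^+ m x.1 = lin_prod (map m lam) (fun i => 'X - (z i)%:P).
Proof.
rewrite perm_sym => /(perm_iotaP 0%N)[I pI lE].
pose t' := [seq nth (0%N, 0) t i | i <- I].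
have tt' : perm_eq t' t.
  by apply/(perm_iotaP (0%N, 0)); exists I; rewrite // -(size_map fst).
have lE' : lam = unzip1 t'.
  rewrite lE /unzip1 -map_comp; apply/eq_in_map => i; rewrite (perm_mem pI) mem_iota => /= it.
  by rewrite (nth_map (0%N, 0)) // -(size_map fst).
exists (fun i => (nth (0%N, 0) t' i).2) => m.
rewrite -[LHS](perm_big _ (F := fun x => ('X - (x.2)%:P) ^+ m x.1) tt').
rewrite (big_nth (0%N, 0)) big_mkord lE' /lin_prod !size_map.
apply: eq_bigr => i _; rewrite -map_comp (nth_map (0%N, 0)) //.
by rewrite size_map.
Qed.

Lemma root_locus_pairs (K : numClosedFieldType) d lam (x : 'rV[K]_d.+1) : 0%N \notin lam ->
  sumn lam = d -> root_locus lam 1 x -> (rVpoly x)`_d = 1 ->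
  exists t, perm_eq (unzip1 t) lam /\ rVpoly x = pair_prod t.
Proof.
move=> lam0 sd Xx xd.
have sA : (size (1 : {poly K})%R <= 1)%N by rewrite size_poly1.
have nx : (rVpoly x)`_d != 0 by rewrite xd oner_neq0.
have ad : (0 + sumn lam)%N = d by rewrite add0n.
have [_ [z ->]] := root_locus_monic lam0 sA ad Xx nx.
rewrite xd scale1r coef1 invr1 scale1r mul1r.
exists [seq (nth 0%N lam i, z i) | i <- iota 0 (size lam)]; split.
  rewrite (_ : unzip1 _ = lam) // /unzip1 -map_comp -[RHS](mkseq_nth 0%N lam); exact: eq_map.
by rewrite lin_prod_iota /pair_prod big_map.
Qed.

Section UniquePreimage.
Variables (K : numClosedFieldType) (d : nat) (lam : seq nat).
Hypothesis hlam : is_partition d lam.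
Let lam0 : 0%N \notin lam. Proof. by case/and3P: hlam. Qed.
Let sd : sumn lam = d. Proof. by case/and3P: hlam => _ _ /eqP. Qed.
Let n := size (part_index lam).

Let coord (i : 'I_n) : {mpoly K[n]} := 'X_i.
Let Gam : {poly {mpoly K[n]}} := factor_prod lam (coef_factor coord).
Let phi := @coef_map_of K d n Gam.

Let monGam : Gam \is monic.
Proof. by have [] := factor_prod_monic (coef_factor_monic (lam := lam) coord). Qed.

Let sizeGam : size Gam = d.+1.
Proof. by have [_] := factor_prod_monic (coef_factor_monic (lam := lam) coord); rewrite sd. Qed.

Let map_coord (y : 'I_n -> K) : (meval y \o coord) = y.
Proof. by apply: funext => i /=; rewrite mevalXU. Qed.

Let evGam y : map_poly (meval y) Gam = factor_prod lam (coef_factor y).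
Proof.
rewrite map_factor_prod; apply: eq_factor_prod => r _.
by rewrite map_coef_factor map_coord.
Qed.

Let meval_phi y k : (phi k).@[y] = (factor_prod lam (coef_factor y))`_k.
Proof. by rewrite meval_coef_map evGam. Qed.

(* The coefficients of the [G_r] embed into the ring of polynomials in their
   roots, where they are visibly integral over the coefficients of [Gam]. *)
Let phi_int j : integralOver (pullback phi) 'X_j.
Proof.
have [h hE] := coef_factor_surj (root_factor_monic (lam := lam) coord).
(* Over a closed field every choice of coefficients comes from some roots, so a polynomial killed by
   [h] vanishes at every point. *)
have h_inj (P : {mpoly K[n]}) : pullback h P = 0 -> P = 0.
  move=> P0; apply: mpoly_all_eq0 => y.
  have [z zE] := root_factor_surj (coef_factor_monic (lam := lam) y).
  have hy : (fun i => (h i).@[z]) = y.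
    apply: funext; apply: (coef_factor_inj (lam := lam)) => r rl.
    have := congr1 (map_poly (meval z)) (hE r rl).
    by rewrite map_coef_factor map_root_factor map_coord zE.
  by rewrite -hy -meval_pullback P0 meval0.
pose Gz := map_poly (pullback h) Gam.
have GzE : Gz = factor_prod lam (root_factor coord).
  rewrite /Gz map_factor_prod; apply: eq_factor_prod => r rl.
  rewrite map_coef_factor -hE //; congr (coef_factor _ r).
  by apply: funext => i; rewrite /= pullbackX.
have [monGz sGz] := factor_prod_monic (root_factor_monic (lam := lam) coord).
rewrite -GzE in monGz sGz; rewrite sd in sGz.
have intz i : integralOver (pullback (@coef_map_of K d n Gz)) (coord i).
  by apply: integral_of_root; rewrite // /root GzE root_factor_prod.
have intX P : integralOver (pullback (@coef_map_of K d n Gz)) (pullback h P) ->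
  integralOver (pullback phi) P.
  have phE e : pullback (@coef_map_of K d n Gz) e = pullback h (pullback phi e).
    elim/mpoly_ring_ind: e => [c|k|a b IHa IHb|a b IHa IHb].
    - by rewrite !pullbackC.
    - by rewrite !pullbackX /coef_map_of coef_map.
    - by rewrite !rmorphD /= IHa IHb.
    - by rewrite !rmorphM /= IHa IHb.
  case=> P1 mP1 rP1; exists P1 => //; apply/eqP/h_inj.
  rewrite -horner_map -map_poly_comp -[RHS](eqP rP1); congr (_.[_]).
  by apply: eq_map_poly => e; rewrite /= phE.
apply: intX; rewrite pullbackX -(coef_factor_coef h j) hE; last exact: part_index_mem.
(* The coefficients of a product of linear factors [X - z_i] are integral because the [z_i] are. *)
move: (nth _ _ _).2 => k; rewrite /root_factor.
elim/big_rec: _ k => [|i p _ IH] k.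
  by rewrite coef1; apply: integral_nat.
rewrite mulrBl coefB coefXM coefCM; apply: integral_sub.
  by case: k => [|k] /=; [apply: integral0 | apply: IH].
by apply: integral_mul; [apply: intz | apply: IH].
Qed.

Variable s : seq (nat * K).
Hypothesis sl : perm_eq (unzip1 s) lam.
Hypothesis HF : forall mu, S_set d lam mu ->
  forall s', perm_eq (unzip1 s') mu -> pair_prod s' <> pair_prod s.

Let group r : {poly K} := \prod_(x <- s | x.1 == r) ('X - (x.2)%:P).

Let group_prod : pair_prod s = factor_prod lam group.
Proof. exact: (prod_group id sl). Qed.

Let root_pairs_eq z : factor_prod lam (root_factor (lam := lam) z) = pair_prod s ->
  {in lam, root_factor z =1 group}.
Proof.
move=> zE r _; rewrite -root_pairs_factor.
apply: perm_big; rewrite perm_sym.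
apply: (preimage_unique hlam HF sl (root_pairs_lam z) erefl).
by rewrite -zE; apply: (prod_root_pairs z id).
Qed.

Let group_monic : monic_factors lam group.
Proof.
have [z zE] := root_pairsP sl => r rl.
by rewrite /group -zE //; apply: root_factor_monic.
Qed.

Let group_coprime : {in lam &, forall r r', r != r' -> coprimep (group r) (group r')}.
Proof.
have cs := preimage_coprime hlam HF sl erefl.
move=> r r' _ _ rr'; rewrite /group.
rewrite [X in coprimep _ X]big_seq_cond; apply: (big_ind (fun p => coprimep _ p)).
- exact: coprimep1.
- by move=> a b ca cb; rewrite coprimepMr ca.
move=> [x z] /= /andP[xs /eqP xr]; rewrite big_seq_cond.
apply: (big_ind (fun p => coprimep p _)).
- exact: coprime1p.
- by move=> a b ca cb; rewrite coprimepMl ca.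
move=> [x' z'] /= /andP[xs' /eqP xr']; rewrite coprimep_XsubC root_XsubC.
apply: contraNneq rr' => zz; rewrite -xr -xr'; apply/eqP.
by apply: (cs _ _ z); rewrite // zz.
Qed.

(** Uniqueness of the preimage gives [fiber_q], coprimality of the [G_r] gives [inj_q]. By
    [tangent_lift] the vector is then, up to a multiple of the point, a directional derivative of
    [Gam], and every such derivative is divisible by [prod_r G_r^(r-1)]. *)
Lemma unique_preimage_tangent v :
  tangent_cone_space (root_locus lam 1) (poly_rV (pair_prod s) : 'rV[K]_d.+1) v ->
  exists2 A : {poly K}, (size A <= (size lam).+1)%N &
    rVpoly v = A * \prod_(x <- s) ('X - (x.2)%:P) ^+ x.1.-1.
Proof.
move=> Tv; have [q qE] := coef_factor_surj group_monic.
have FE : pair_prod s = factor_prod lam (coef_factor q).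
  by rewrite group_prod; apply/esym/eq_factor_prod.
have [monF sF] : pair_prod s \is monic /\ size (pair_prod s) = d.+1.
  by rewrite group_prod -sd; apply: factor_prod_monic.
have Fd : (pair_prod s)`_d = 1 by have := monicP monF; rewrite lead_coefE sF.
set p := poly_rV (pair_prod s) in Tv.
have pE k : p 0 k = (phi k).@[q] by rewrite mxE meval_phi FE.
have pd : p 0 ord_max = 1 by rewrite mxE.
have Xp : root_locus lam 1 p.
  have [z zE] := pairs_lin_prod sl; exists 1, (fun i => 'X - (z i)%:P); split.
  - exact: oner_neq0.
  - by move=> i; rewrite /is_linear_form polyXsubC_eq0 size_XsubC.
  - by rewrite poly_rV_K ?sF // scale1r mul1r /pair_prod (zE id) map_id.
have coneX : is_cone (root_locus lam 1 : set 'rV[K]_d.+1).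
  by move=> t x; apply: root_locus_cone.
(* A tangent vector along the chart of last coordinate 1; the multiple of [p] that is removed is
   itself tangent, by Euler's relation. *)
pose w := v - v 0 ord_max *: p.
have Tw : tangent_cone_space (root_locus lam 1) p w.
  rewrite /w -scaleNr; apply: tangentD => //; apply: tangentZ; apply: tangent_self => //.
  by move=> x; apply: root_locus_neq0; apply: oner_neq0.
have wd : w 0 ord_max = 0 by rewrite !mxE -/(p 0 ord_max) Fd mulr1 subrr.
have evq : map_poly (meval q) \o coef_factor coord =1 coef_factor q.
  by move=> r /=; rewrite map_coef_factor map_coord.
have fiber_q y : (forall k, (phi k).@[y] = (phi k).@[q]) -> y =1 q.
  move=> yq; have yF : factor_prod lam (coef_factor y) = pair_prod s.
    rewrite FE; apply/polyP => k; case: (ltnP k d.+1) => kd.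
      by have := yq (Ordinal kd); rewrite !meval_phi.
    rewrite !nth_default -?FE ?sF //.
    by have [_ ->] := factor_prod_monic (coef_factor_monic (lam := lam) y); rewrite sd.
  have [z zE] := root_factor_surj (coef_factor_monic (lam := lam) y).
  apply: coef_factor_inj => r rl; rewrite qE // -zE //; apply: root_pairs_eq => //.
  by rewrite -yF; apply: eq_factor_prod.
have dirE u r : directional q u (coef_factor coord r) =
    \sum_(i < n | (nth (0, 0)%N (part_index lam) i).1 == r)
      u i *: 'X^((nth (0, 0)%N (part_index lam) i).2).
  exact: directional_affine.
have l0 : 0%N \notin undup lam by rewrite mem_undup.
have dirGam u : directional q u Gam = (\prod_(r <- undup lam) group r ^+ r.-1) *
    log_deriv (map_poly (meval q)) (directional q u) (coef_factor coord) (undup lam).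
  rewrite /Gam /factor_prod (log_derivE (ev := map_poly (meval q))) //.
  - congr (_ * _); rewrite big_seq [RHS]big_seq; apply: eq_bigr => r; rewrite mem_undup => rl.
    by rewrite -qE // -evq.
  - exact: rmorph1.
  - by move=> a b; apply: rmorphM.
  - exact: directional1.
  - exact: directionalM.
have inj_q u : (forall k, \sum_j u j * ((phi k)^`M(j)).@[q] = 0) -> forall j, u j = 0.
  move=> u0; have : directional q u Gam = 0.
    apply/polyP => k; rewrite coef_directional coef0; case: (ltnP k d.+1) => kd.
      exact: (u0 (Ordinal kd)).
    rewrite nth_default ?sizeGam //; apply: big1 => j _.
    by rewrite raddf0 meval0 mulr0.
  rewrite dirGam => /eqP; rewrite mulf_eq0 => /orP[/eqP D0|/eqP W0].
    have [|mD _] := @monic_prod_size K (undup lam) group (fun r => count_mem r lam) predn.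
      by move=> r; rewrite mem_undup; apply: group_monic.
    by have := monic_neq0 mD; rewrite D0 eqxx.
  have du0 : {in undup lam, forall r, directional q u (coef_factor coord r) = 0}.
    apply: (log_deriv_eq0 (ev := map_poly (meval q))) W0 => //.
    - by move=> m /eqP; rewrite pnatr_eq0 => /eqP.
    - exact: undup_uniq.
    - move=> r r'; rewrite !mem_undup => rl rl' rr'.
      by rewrite -!/((map_poly _ \o _) _) !evq !qE //; apply: group_coprime.
    - move=> r; rewrite mem_undup => rl; rewrite -!/((map_poly _ \o _) _) evq.
      have [mr ->] := coef_factor_monic (lam := lam) q rl.
      by rewrite monic_neq0 // dirE ltnS coef_factor_small.
  apply: (coef_factor_inj (lam := lam) (y' := fun=> 0)) => r rl.
  rewrite /coef_factor -dirE du0 ?mem_undup // big1 // => i _; exact: scale0r.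
have [|u uE] := tangent_lift phi_int fiber_q inj_q (w := w 0).
  move=> e pe; have -> : (fun k => (phi k).@[q]) = p 0 by apply: funext.
  apply: (tangent_dehomogenize coneX _ Xp pd wd Tw) => x Xx xd.
  have xd' : (rVpoly x)`_d = 1 by rewrite -xd -coef_rVpoly_ord.
  have [t [tl tE]] := root_locus_pairs lam0 sd Xx xd'.
  have [z zE] := root_pairsP tl.
  have [y yE] := coef_factor_surj (root_factor_monic (lam := lam) z).
  have xE : rVpoly x = factor_prod lam (coef_factor y).
    rewrite tE /pair_prod (prod_group id tl); apply: eq_factor_prod => r rl.
    by rewrite yE // zE.
  have -> : e.@[x 0] = e.@[fun k => (phi k).@[y]].
    by apply: meval_eq => k; rewrite meval_phi -xE coef_rVpoly_ord.
  by rewrite -meval_pullback pe meval0.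
set D := \prod_(x <- s) ('X - (x.2)%:P) ^+ x.1.-1.
have FD : pair_prod s = D * \prod_(x <- s) ('X - (x.2)%:P).
  rewrite /pair_prod /D -big_split big_seq [RHS]big_seq; apply: eq_bigr => x xs /=.
  have : x.1 \in lam by rewrite -(perm_mem sl) map_f.
  by case: x.1 => [|r _]; [rewrite (negbTE lam0) | rewrite exprSr].
have [W wE] : exists W, rVpoly w = D * W.
  exists (log_deriv (map_poly (meval q)) (directional q u) (coef_factor coord) (undup lam)).
  rewrite /D (prod_group predn sl) -dirGam; apply/polyP => k; rewrite coef_directional.
  case: (ltnP k d.+1) => kd; first by rewrite (coef_rVpoly_ord w (Ordinal kd)) uE.
  rewrite nth_default ?(leq_trans (size_poly _ _)) // nth_default ?sizeGam //.
  by rewrite big1 // => j _; rewrite raddf0 meval0 mulr0.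
have vE : rVpoly v = (W + v 0 ord_max *: \prod_(x <- s) ('X - (x.2)%:P)) * D.
  have vE : v = w + v 0 ord_max *: p by rewrite /w subrK.
  rewrite [in LHS]vE linearD linearZ /= poly_rV_K ?sF // wE FD mulrDl mulrC; congr (_ + _).
  by rewrite -scalerAl [D * _]mulrC.
exists (W + v 0 ord_max *: \prod_(x <- s) ('X - (x.2)%:P)) => //.
move: vE; move: (W + _) => A vE.
have mD : D \is monic.
  by apply: monic_prod => x _; apply: monic_exp; apply: monicXsubC.
have sDl : (size D + size lam)%N = d.+1.
  have := sF; rewrite FD size_Mmonic ?monic_neq0 ?monic_prod_XsubC // size_prod_XsubC.
  by rewrite -(perm_size sl) size_map addnS.
have [->|nA] := eqVneq A 0; first by rewrite size_poly0.
have sAD : (size (A * D)%R <= d.+1)%N by rewrite -vE size_poly.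
have D0 : (0 < size D)%N by rewrite lt0n size_poly_eq0 monic_neq0.
move: sAD; rewrite size_Mmonic // -sDl.
by move: D0; move: (size A) (size D) (size lam) => a b c; lia.
Qed.

End UniquePreimage.

(** * The singular locus *)

Section RootLocusRegular.
Variable K : numClosedFieldType.

(** A non-root of the point is moved to infinity and the result is rescaled to be monic. Both [M]
    and [N] preserve each [root_locus m 1], because the substitution fixes the form 1 of degree
    0. *)
Lemma monic_coordinates d (p : 'rV[K]_d.+1) : p != 0 -> exists M N : 'M[K]_d.+1,
  [/\ M *m N = 1%:M, N *m M = 1%:M, (rVpoly (p *m M))`_d = 1 &
      forall m v, sumn m = d -> root_locus m 1 v ->
        root_locus m 1 (v *m M) /\ root_locus m 1 (v *m N)].
Proof.
move=> np; have nF : rVpoly p != 0.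
  by apply: contraNneq np => F0; rewrite -[p]rVpolyK F0 linear0.
have [c nc] := poly_neq0_nonroot nF; set a := (rVpoly p).[c] in nc.
have sub1 (A B : {poly K}) : subst 0 A B 1 = 1.
  by rewrite /subst big_ord1 coef1 /= !expr0 mulr1 scale1r.
have sA : (size (1 : {poly K})%R <= 1)%N by rewrite size_poly1.
exists (a^-1 *: fwd_mx d c), (a *: bwd_mx d c); split.
- by rewrite -scalemxAl -scalemxAr scalerA mulVf // fwd_mxK scale1r.
- by rewrite -scalemxAl -scalemxAr scalerA mulfV // bwd_mxK scale1r.
- rewrite -scalemxAr linearZ /= coefZ /fwd_mx rVpoly_subst ?size_fwdA ?size_polyX //.
  by rewrite fwd_top ?size_poly // mulVf.
move=> m v sm Xv; rewrite -!scalemxAr; split; apply: root_locus_cone.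
- by rewrite invr_eq0.
- by rewrite -(sub1 (fwdA c) 'X); apply: root_locus_fwd.
- exact: nc.
- by rewrite -(sub1 1 (bwdB c)); apply: root_locus_bwd.
Qed.

Lemma pair_prod_root_locus d m (t : seq (nat * K)) (x : 'rV[K]_d.+1) :
  perm_eq (unzip1 t) m -> rVpoly x = pair_prod t -> root_locus m 1 x.
Proof.
move=> tm xE; have [z zE] := pairs_lin_prod tm.
exists 1, (fun i => 'X - (z i)%:P); split; first exact: oner_neq0.
  by move=> i; rewrite /is_linear_form polyXsubC_eq0 size_XsubC.
by rewrite xE scale1r mul1r /pair_prod (zE id) map_id.
Qed.

(** The tangent space is pinned from both sides: the multiples of [prod L_i^(r_i - 1)] are always
    tangent, and [unique_preimage_tangent] allows nothing else. Its dimension [size lam + 1] matches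
    the local dimension found from [local_chain] and [chain_length_leq]. *)
Lemma root_locus_regular d lam (p : 'rV[K]_d.+1) : is_partition d lam ->
  root_locus lam 1 p -> (forall mu, S_set d lam mu -> ~ root_locus mu 1 p) ->
  regular_point (root_locus lam 1) p.
Proof.
move=> hlam Xp nmu; have [_ lam0 /eqP sd] := and3P hlam.
have XE : zariski_closure (root_locus lam 1 : set 'rV[K]_d.+1) = root_locus lam 1.
  by apply: (root_locus_closureE (a := 0)); rewrite ?oner_neq0 ?size_poly1.
exists (size lam); split.
  split; first exact: (local_chain lam0 sd).
  by move=> k C; rewrite -{1}XE; apply: chain_length_leq.
have [M [N [MN NM pM tr]]] := monic_coordinates (root_locus_neq0 (oner_neq0 _) Xp).
have [uM uN] := mulmx1_unit MN.
have XpM := (tr _ _ sd Xp).1.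
have [s [sl sE]] := root_locus_pairs lam0 sd XpM pM.
have pE : p *m M = poly_rV (pair_prod s) by rewrite -sE rVpolyK.
have HF mu : S_set d lam mu -> forall s', perm_eq (unzip1 s') mu -> pair_prod s' <> pair_prod s.
  move=> Smu s' s'mu s's; apply: (nmu _ Smu).
  have smu : sumn mu = d.
    by case: Smu => [[[/and3P[_ _ /eqP]]|[/and3P[_ _ /eqP]]]|[/and3P[_ _ /eqP]]].
  have -> : p = p *m M *m N by rewrite -mulmxA MN mulmx1.
  have pM_mu : root_locus mu 1 (p *m M).
    by apply: (pair_prod_root_locus s'mu); rewrite sE s's.
  exact: (tr _ _ smu pM_mu).2.
have [z zE] := pairs_lin_prod sl.
set D := \prod_(x <- s) ('X - (x.2)%:P) ^+ x.1.-1.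
have DE : D = lin_prod (map predn lam) (fun i => 'X - (z i)%:P) by exact: zE.
have HL i : is_linear_form ('X - (z i)%:P).
  by rewrite /is_linear_form polyXsubC_eq0 size_XsubC.
pose l := size lam.
have sAD (A : {poly K}) : (size A <= l.+1)%N -> (size (A * D)%R <= d.+1)%N.
  by rewrite DE; apply: size_lin_prod_predM => // i; case/andP: (HL i).
have nD : D != 0 by rewrite DE lin_prod_neq0 // => i; case/andP: (HL i).
(* Basis of the tangent space at [p]: multiples of [D] in the monic coordinates, carried back by
   [N]. *)
pose W : 'M[K]_(l.+1, d.+1) := \matrix_(i < l.+1) (poly_rV ('X^i * D) *m N).
have uW (u : 'rV[K]_l.+1) : u *m W = poly_rV (rVpoly u * D) *m N.
  rewrite mulmx_sum_row [rVpoly u]poly_def mulr_suml linear_sum mulmx_suml.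
  apply: eq_bigr => i _; rewrite rowK -scalerAl linearZ -scalemxAl; congr (_ *: _).
  by rewrite valK.
pose f := linfun (mulmxr W : 'rV[K]_l.+1 -> 'rV[K]_d.+1).
have memU v : v \in limg f <-> exists u, v = u *m W.
  split=> [/memv_imgP[u _ ->]|[u ->]]; first by exists u; rewrite lfunE.
  by apply/memv_imgP; exists u; rewrite ?memvf ?lfunE.
exists (limg f); split; last first.
  have dimV : \dim {: 'rV[K]_l.+1} = l.+1 by rewrite dimvf /dim /= mul1n.
  apply/eqP; rewrite eqn_leq; apply/andP; split.
    by rewrite -[X in (_ <= X)%N]dimV -(limg_ker_dim f fullv) leq_addl.
  apply: (row_free_leq_dim (W := W)); last by move=> u; apply/memU; exists u.
  apply: row_free_inj => u; rewrite uW => /(congr1 (mulmx^~ M)); rewrite mul0mx -mulmxA NM mulmx1.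
  move/(congr1 rVpoly); rewrite linear0 poly_rV_K ?sAD ?size_poly //.
  by move/eqP; rewrite mulf_eq0 (negbTE nD) orbF => /eqP u0; rewrite -[u]rVpolyK u0 linear0.
apply/seteqP; split=> v /=.
  case/memU => u ->; rewrite uW.
  have := tangent_root_locus lam0 sd (oner_neq0 K) HL (size_poly _ _ : (size (rVpoly u) <= l.+1)%N).
  rewrite scale1r -DE; have -> : lin_prod lam (fun i => 'X - (z i)%:P) = pair_prod s.
    by rewrite /pair_prod (zE id) map_id.
  rewrite -pE => Tu; have -> : p = p *m M *m N by rewrite -mulmxA MN mulmx1.
  by apply: (tangent_mulmx uN _ Tu) => x Xx; have [] := tr _ _ sd Xx.
move=> Tv; have : tangent_cone_space (root_locus lam 1) (p *m M) (v *m M).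
  by apply: (tangent_mulmx uM _ Tv) => x Xx; have [] := tr _ _ sd Xx.
rewrite pE => /(unique_preimage_tangent hlam sl HF)[A sA vE].
apply/memU; exists (poly_rV A); rewrite uW poly_rV_K // -/D -vE rVpolyK.
by rewrite -mulmxA MN mulmx1.
Qed.

End RootLocusRegular.

Section SingularLocus.
Variables (K : numClosedFieldType) (d : nat) (lam : seq nat).
Hypothesis hlam : is_partition d lam.

Lemma X_locusE m : 0%N \notin m -> sumn m = d -> X_locus K d m = root_locus m 1.
Proof.
move=> m0 sm; rewrite /X_locus f_image_root_locus //.
by apply: (root_locus_closureE (a := 0)); rewrite ?oner_neq0 ?size_poly1.
Qed.

Lemma S_set_partition mu : S_set d lam mu -> is_partition d mu.
Proof. by case=> [[[]|[]]|[]]. Qed.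

Lemma X_locus_perm m m' : perm_eq m m' -> X_locus K d m = X_locus K d m'.
Proof. by move=> mm'; rewrite /X_locus (f_image_perm K d mm'). Qed.

Lemma merge_subset r1 r2 nu : root_locus ((r1 + r2)%N :: nu) 1 `<=`
  (root_locus [:: r1, r2 & nu] 1 : set 'rV[K]_d.+1).
Proof.
move=> v [c [L [nc HL vE]]]; exists c, (fun i => L i.-1); split=> //.
by rewrite vE !lin_prod_cons exprD -mulrA.
Qed.

Lemma two_preimages_subset r1 r2 r3 t1 t2 nu : r3 = (t1 * r1)%N -> r3 = (t2 * r2)%N ->
  root_locus [:: r3, r3 & nu] 1 `<=`
  (root_locus (nseq t1 r1 ++ nseq t2 r2 ++ nu) 1 : set 'rV[K]_d.+1).
Proof.
move=> e1 e2 v [c [L [nc HL vE]]]; exists c.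
exists (fun i => if (i < t1)%N then L 0%N else if (i < t1 + t2)%N then L 1%N
  else L (i - (t1 + t2)).+2); split=> //.
  by move=> i; case: ifP => // _; case: ifP.
rewrite vE !lin_prod_cat !lin_prod_cons !size_nseq.
rewrite (@lin_prod_nseq K t1 r1 _ (L 0%N)) => [|i ->] //.
rewrite (@lin_prod_nseq K t2 r2 _ (L 1%N)) => [|i it].
  rewrite -!exprM [(r1 * t1)%N]mulnC -e1 [(r2 * t2)%N]mulnC -e2; congr (_ *: (_ * (_ * (_ * _)))).
  apply: eq_lin_prod => i _; rewrite addnA; case: ltnP => [|_]; first by lia.
  by case: ltnP => [|_]; [lia | rewrite addKn].
by rewrite ltnNge leq_addr /= ltn_add2l it.
Qed.

(** At a regular point the tangent dimension would be the length of some chain, hence at most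
    [size lam], whereas the extra tangent vector makes it larger. *)
Lemma X_locus_singular mu (p : 'rV[K]_d.+1) : S_set d lam mu -> X_locus K d mu p ->
  X_locus K d lam p /\ ~ regular_point (X_locus K d lam) p.
Proof.
move=> Smu; have [_ lam0 /eqP sd] := and3P hlam.
have [_ mu0 /eqP smu] := and3P (S_set_partition Smu).
(* The excess lemmas concern lists with the fused parts in front, which need not be sorted;
   [X_locus] depends on the list up to permutation. *)
suff main l m : perm_eq lam l -> perm_eq mu m ->
    root_locus m 1 `<=` (root_locus l 1 : set 'rV[K]_d.+1) ->
    (forall k, zariski_closure (root_locus m 1) p ->
      tangent_dim (zariski_closure (root_locus l 1)) p k -> (size l < k)%N) ->
    X_locus K d mu p -> X_locus K d lam p /\ ~ regular_point (X_locus K d lam) p.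
  case: (S_set_lists hlam Smu).
    case=> r1 [r2 [nu [r1p r2p r12 [lP mP]]]]; apply: (main _ _ lP mP).
      exact: merge_subset.
    move=> k; apply: merge_tangent_dim => //; last by rewrite -sd (perm_sumn lP).
    by move: mu0; rewrite (perm_mem mP) inE negb_or => /andP[].
  case=> r1 [r2 [r3 [t1 [t2 [nu [[r1p r2p t1p t12] [e1 e2 lP mP]]]]]]].
  apply: (main _ _ lP mP); first exact: two_preimages_subset.
  move=> k; apply: (two_preimages_tangent_dim r1p r2p _ t1p t12 e1 e2).
    by move: mu0; rewrite (perm_mem mP) !inE !negb_or => /and3P[].
  by rewrite -smu (perm_sumn mP).
move=> lP mP ml tdim; rewrite (X_locus_perm lP) (X_locus_perm mP).
have l0 : 0%N \notin l by rewrite -(perm_mem lP).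
have m0 : 0%N \notin m by rewrite -(perm_mem mP).
have sl : sumn l = d by rewrite -(perm_sumn lP).
have sm : sumn m = d by rewrite -(perm_sumn mP).
rewrite /X_locus !f_image_root_locus // => Xp; split.
  by apply: closureS Xp => v _; apply: ml.
case=> k [[[C HC] _] Tk]; have := tdim k Xp Tk.
by rewrite ltnNge (chain_length_leq l0 sl HC).
Qed.

Lemma singular_locus_X_locus :
  singular_locus (X_locus K d lam) = \bigcup_(mu in S_set d lam) X_locus K d mu.
Proof.
have [_ lam0 /eqP sd] := and3P hlam.
apply/seteqP; split=> p /=.
  case=> Xp nreg; apply: contrapT => nmu; apply: nreg.
  rewrite X_locusE // in Xp *; apply: root_locus_regular => // mu Smu Xmu.
  have [_ mu0 /eqP smu] := and3P (S_set_partition Smu).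
  by apply: nmu; exists mu; rewrite // X_locusE.
by case=> mu Smu /(X_locus_singular Smu).
Qed.

End SingularLocus.

Theorem theorem5p4 (R : realType) (d : nat) (lam : seq nat)
    (hlam : is_partition d lam) :
  singular_locus (X_locus R[i] d lam) =
  \bigcup_(mu in S_set d lam) X_locus R[i] d mu.
Proof. exact: singular_locus_X_locus. Qed.
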